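(* Let $M^N$ be an $N$-dimensional Frobenius manifold (real, smooth, in the sense given in the context) with metric $g$ and multiplication $\circ$. Let $k\ge 1$ and $p\ge 0$ be arbitrary integers. Then $M^N$ can be locally realized as an $N$-dimensional $k$-potential submanifold in a $((k+1)N+p)$-dimensional pseudo-Euclidean space. That is, every point of $M^N$ has a neighbourhood $U$ with flat coordinates $u=(u^1,\dots,u^N)$ of $g$, and there is a $k$-potential submanifold $r:U\to\mathbb{E}$ in a pseudo-Euclidean space $\mathbb{E}$ of dimension $(k+1)N+p$, with data $(\Phi,\eta,c,\mu)$ such that on $U$ $$g=\eta_{ij}\,du^i\,du^j,\qquad \frac{\partial}{\partial u^i}\circ\frac{\partial}{\partial u^j}=\sum_{l,s=1}^N\eta^{ls}\,\frac{\partial^3\Phi}{\partial u^s\partial u^i\partial u^j}\,\frac{\partial}{\partial u^l}.$$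
   Context: **Frobenius manifold.** An $N$-dimensional pseudo-Riemannian manifold $(M^N,g)$ with an algebra structure $\circ$ on each tangent space, depending smoothly on the point, such that for all vector fields $X,Y,Z,W$: (I) $g(X\circ Y,Z)=g(X,Y\circ Z)$; (II) $X\circ Y=Y\circ X$; (III) $(X\circ Y)\circ Z=X\circ(Y\circ Z)$; (IV) $g$ is flat; (V) $A(X,Y,Z)=g(X\circ Y,Z)$ is a symmetric tensor such that $(\nabla_W A)(X,Y,Z)$ is symmetric in $X,Y,Z,W$, where $\nabla$ is the Levi-Civita connection of $g$. No unit, Euler field or quasihomogeneity is required. **Associativity (WDVV) equations.** For a constant nondegenerate symmetric matrix $(\eta^{ij})$ with inverse $(\eta_{ij})$ and a smooth function $\Phi(u^1,\dots,u^N)$: for all $i,j,m,n$, $$\sum_{a,b=1}^N\frac{\partial^3\Phi}{\partial u^i\partial u^j\partial u^a}\eta^{ab}\frac{\partial^3\Phi}{\partial u^b\partial u^m\partial u^n}=\sum_{a,b=1}^N\frac{\partial^3\Phi}{\partial u^i\partial u^m\partial u^a}\eta^{ab}\frac{\partial^3\Phi}{\partial u^b\partial u^j\partial u^n}.$$ **Submanifolds.** A pseudo-Euclidean space $\mathbb{E}$ is a finite-dimensional real affine space (with associated vector space) equipped with a constant nondegenerate symmetric scalar product $(\cdot,\cdot)$. Let $r:U\to\mathbb{E}$, $U\subset\mathbb{R}^N$ open, be a smooth immersion with $\dim\mathbb{E}=N+L$, whose first fundamental form $(\partial_i r,\partial_j r)$ is nondegenerate (''totally nonisotropic''). Let $n_1(u),\dots,n_L(u)$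 be a smooth basis of the normal spaces. Its Gram matrix is $(n_\alpha,n_\beta)$, the second fundamental forms are $\omega_{\alpha ij}=(\partial_i\partial_j r,n_\alpha)$, and the torsion coefficients are $\varkappa_{\alpha\beta i}=(\partial_i n_\alpha,n_\beta)$. **$k$-potential submanifold with data $(\Phi,\eta,c,\mu)$.** Let $L=kN+p$. The data consist of: a constant nondegenerate symmetric $N\times N$ matrix $(\eta^{ij})$ with inverse $(\eta_{ij})$; a constant nondegenerate symmetric $k\times k$ matrix $(c^{\sigma\tau})$; a constant nondegenerate symmetric $L\times L$ matrix $(\mu^{\alpha\beta})$ with inverse $(\mu_{\alpha\beta})$ such that $\mu^{(\sigma-1)N+m,\,(\tau-1)N+n}=c^{\sigma\tau}\eta^{mn}$ for $1\le\sigma,\tau\le k$, $1\le m,n\le N$ (the other entries are arbitrary subject to symmetry and nondegeneracy); and a smooth solution $\Phi(u)$ of the associativity equations. A $k$-potential submanifold with these data is a totally nonisotropic $N$-dimensional submanifold $r(u)$ of an $(N+L)$-dimensional pseudo-Euclidean space that admits a smooth basis $n_1,\dots,n_L$ of the normal spaces for which: the first fundamental form is $(\partial_i r,\partial_j r)=\eta_{ij}$; the Gram matrix is $(n_\alpha,n_\beta)=\mu_{\alpha\beta}$; all torsion coefficients vanish; $\omega_{(\sigma-1)N+m,\,ij}=\partial^3\Phi/\partial u^m\partial u^i\partial u^j$ for $1\le\sigma\le k$, $1\le m\le N$; and $\omega_{\alpha ij}=0$ for $kN+1\le\alpha\le L$. (The signature of the ambient space is then the sum of the signatures of $(\eta_{ij})$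 and $(\mu_{\alpha\beta})$.) *)

(* Defs.v *)
From HB Require Import structures.
From mathcomp Require Import all_boot all_order all_algebra.
From mathcomp Require Import all_classical all_reals all_analysis.

Set Implicit Arguments.
Unset Strict Implicit.
Unset Printing Implicit Defensive.

Import Order.TTheory GRing.Theory Num.Theory.
Import numFieldNormedType.Exports.

Local Open Scope classical_set_scope.
Local Open Scope ring_scope.

(** * Partial derivatives and smooth maps on open subsets of [R^N] *)

Definition pd (R : realType) (N : nat) (V : normedModType R) (i : 'I_N)
    (f : 'rV[R]_N -> V) : 'rV[R]_N -> V :=
  fun x => 'D_(delta_mx 0 i : 'rV[R]_N) f x.

(** [C^oo]: all iterated partial derivatives exist and are continuous on [U].
    It is only ever used with [U] open. *)
Definition smooth_on (R : realType) (N : nat) (V : normedModType R)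
    (U : set 'rV[R]_N) (f : 'rV[R]_N -> V) : Prop :=
  forall (s : seq 'I_N) (x : 'rV[R]_N), U x ->
    {for x, continuous (foldr (@pd R N V) f s)} /\
    forall i, derivable (foldr (@pd R N V) f s) x (delta_mx 0 i : 'rV[R]_N).

Definition pd3 (R : realType) (N : nat) (f : 'rV[R]_N -> R) (i j m : 'I_N) :
    'rV[R]_N -> R :=
  pd i (pd j (pd m f)).

(** The bilinear form with Gram matrix [G]. *)
Definition bform (R : realType) (n : nat) (G : 'M[R]_n) (v w : 'rV[R]_n) : R :=
  (v *m G *m w^T) 0 0.

(** A (possibly indefinite) constant scalar product. *)
Definition nondeg_sym (R : realType) (n : nat) (G : 'M[R]_n) : Prop :=
  G^T = G /\ G \in unitmx.

(** * Smooth manifolds *)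

(** [icoord] is the inverse homeomorphism; its values outside
    [coord @` dom] are irrelevant. *)
Record chart (R : realType) (N : nat) (T : topologicalType) := Chart {
  dom : set T;
  coord : T -> 'rV[R]_N;
  icoord : 'rV[R]_N -> T;
  dom_open : open dom;
  img_open : open (coord @` dom);
  coordK : forall q, dom q -> icoord (coord q) = q;
  coord_cont : {within dom, continuous coord};
  icoord_cont : {within coord @` dom, continuous icoord} }.

Definition img (R : realType) (N : nat) (T : topologicalType)
    (c : chart R N T) : set 'rV[R]_N := coord c @` dom c.

Definition overlap (R : realType) (N : nat) (T : topologicalType)
    (c c' : chart R N T) : set 'rV[R]_N := coord c @` (dom c `&` dom c').

Definition change (R : realType) (N : nat) (T : topologicalType)
    (c c' : chart R N T) : 'rV[R]_N -> 'rV[R]_N := coord c' \o icoord c.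

Definition compatible (R : realType) (N : nat) (T : topologicalType)
    (c c' : chart R N T) : Prop :=
  smooth_on (overlap c c') (change c c') /\
  smooth_on (overlap c' c) (change c' c).

(** The smooth structure is given by its maximal atlas, so that [atlas c]
    says that [coord c] is a system of local coordinates on [dom c]. *)
Record manifold (R : realType) (N : nat) := Manifold {
  carrier :> topologicalType;
  mfd_hausdorff : hausdorff_space carrier;
  mfd_second_countable : @second_countable carrier;
  atlas : set (chart R N carrier);
  atlas_cover : forall q : carrier, exists2 c, atlas c & dom c q;
  atlas_compatible : forall c c', atlas c -> atlas c' -> compatible c c';
  atlas_maximal : forall c,
    (forall c', atlas c' -> compatible c c') -> atlas c }.

(** * Calculus in one coordinate system

    Tangent vectors and vector fields are given by their components,
    [X : 'rV_N] standing for [\sum_i X 0 i d/du^i].  In this part [G] is the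
    matrix of components [g_ij] and [C x i j] is the vector
    [d/du^i o d/du^j] at [x]. *)

Definition tmul (R : realType) (N : nat) (C : 'I_N -> 'I_N -> 'rV[R]_N)
    (X Y : 'rV[R]_N) : 'rV[R]_N :=
  \sum_i \sum_j (X 0 i * Y 0 j) *: C i j.

(** Christoffel symbols [Gamma^l_ij] of the Levi-Civita connection. *)
Definition christoffel (R : realType) (N : nat) (G : 'rV[R]_N -> 'M[R]_N)
    (l i j : 'I_N) (x : 'rV[R]_N) : R :=
  2^-1 * \sum_s invmx (G x) l s *
    (pd i (fun y => G y s j) x + pd j (fun y => G y i s) x
     - pd s (fun y => G y i j) x).

(** The covariant derivative of the vector field [X] along [W]. *)
Definition nabla (R : realType) (N : nat) (G : 'rV[R]_N -> 'M[R]_N)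
    (W X : 'rV[R]_N -> 'rV[R]_N) (x : 'rV[R]_N) : 'rV[R]_N :=
  'D_(W x) X x +
  \row_l \sum_i \sum_j christoffel G l i j x * W x 0 i * X x 0 j.

Definition lie_bracket (R : realType) (N : nat)
    (X Y : 'rV[R]_N -> 'rV[R]_N) (x : 'rV[R]_N) : 'rV[R]_N :=
  'D_(X x) Y x - 'D_(Y x) X x.

Definition riemann (R : realType) (N : nat) (G : 'rV[R]_N -> 'M[R]_N)
    (X Y Z : 'rV[R]_N -> 'rV[R]_N) (x : 'rV[R]_N) : 'rV[R]_N :=
  nabla G X (nabla G Y Z) x - nabla G Y (nabla G X Z) x
  - nabla G (lie_bracket X Y) Z x.

(** [A(X,Y,Z) = g(X o Y, Z)] at a point. *)
Definition tensorA (R : realType) (N : nat) (G : 'M[R]_N)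
    (C : 'I_N -> 'I_N -> 'rV[R]_N) (X Y Z : 'rV[R]_N) : R :=
  bform G (tmul C X Y) Z.

(** [(nabla_W A)(X,Y,Z)]. *)
Definition nablaA (R : realType) (N : nat) (G : 'rV[R]_N -> 'M[R]_N)
    (C : 'rV[R]_N -> 'I_N -> 'I_N -> 'rV[R]_N)
    (W X Y Z : 'rV[R]_N -> 'rV[R]_N) (x : 'rV[R]_N) : R :=
  'D_(W x) (fun y => tensorA (G y) (C y) (X y) (Y y) (Z y)) x
  - tensorA (G x) (C x) (nabla G W X x) (Y x) (Z x)
  - tensorA (G x) (C x) (X x) (nabla G W Y x) (Z x)
  - tensorA (G x) (C x) (X x) (Y x) (nabla G W Z x).

(** * Frobenius manifolds

    The metric and the multiplication are tensor fields: families of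
    components indexed by the local coordinate systems of [M] (the values on
    charts outside the atlas or at points outside [img c] are irrelevant),
    which correspond to each other under the differential
    [X |-> 'D_X (change c c') x] of the change of coordinates.  Invariance
    under all permutations of the arguments is expressed through adjacent
    transpositions. *)
Record frobenius (R : realType) (N : nat) (M : manifold R N) := Frobenius {
  metric : chart R N M -> 'rV[R]_N -> 'M[R]_N;
  product : chart R N M -> 'rV[R]_N -> 'I_N -> 'I_N -> 'rV[R]_N;
  metric_smooth : forall c, atlas c -> forall i j,
    smooth_on (img c) (fun x => metric c x i j);
  product_smooth : forall c, atlas c -> forall i j,
    smooth_on (img c) (fun x => product c x i j);
  metric_nondeg : forall c, atlas c -> forall x, img c x ->
    nondeg_sym (metric c x);
  metric_tensorial : forall c c', atlas c -> atlas c' ->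
    forall x, overlap c c' x -> forall X Y,
    bform (metric c x) X Y =
    bform (metric c' (change c c' x))
      ('D_X (change c c') x) ('D_Y (change c c') x);
  product_tensorial : forall c c', atlas c -> atlas c' ->
    forall x, overlap c c' x -> forall X Y,
    'D_(tmul (product c x) X Y) (change c c') x =
    tmul (product c' (change c c' x))
      ('D_X (change c c') x) ('D_Y (change c c') x);
  frob_invariant : forall c, atlas c -> forall x, img c x -> forall X Y Z,
    bform (metric c x) (tmul (product c x) X Y) Z =
    bform (metric c x) X (tmul (product c x) Y Z);
  frob_comm : forall c, atlas c -> forall x, img c x -> forall X Y,
    tmul (product c x) X Y = tmul (product c x) Y X;
  frob_assoc : forall c, atlas c -> forall x, img c x -> forall X Y Z,
    tmul (product c x) (tmul (product c x) X Y) Z =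
    tmul (product c x) X (tmul (product c x) Y Z);
  frob_flat : forall c, atlas c -> forall X Y Z : 'rV[R]_N -> 'rV[R]_N,
    smooth_on (img c) X -> smooth_on (img c) Y -> smooth_on (img c) Z ->
    forall x, img c x -> riemann (metric c) X Y Z x = 0;
  frob_A_sym : forall c, atlas c -> forall x, img c x -> forall X Y Z,
    tensorA (metric c x) (product c x) X Y Z =
      tensorA (metric c x) (product c x) Y X Z /\
    tensorA (metric c x) (product c x) X Y Z =
      tensorA (metric c x) (product c x) X Z Y;
  frob_nablaA_sym : forall c, atlas c ->
    forall W X Y Z : 'rV[R]_N -> 'rV[R]_N,
    smooth_on (img c) W -> smooth_on (img c) X ->
    smooth_on (img c) Y -> smooth_on (img c) Z ->
    forall x, img c x ->
    [/\ nablaA (metric c) (product c) W X Y Z x =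
        nablaA (metric c) (product c) X W Y Z x,
        nablaA (metric c) (product c) W X Y Z x =
        nablaA (metric c) (product c) W Y X Z x &
        nablaA (metric c) (product c) W X Y Z x =
        nablaA (metric c) (product c) W X Z Y x] }.

(** * Potential submanifolds *)

(** The associativity equations; [etaU] is the matrix [eta^ij]. *)
Definition wdvv (R : realType) (N : nat) (U : set 'rV[R]_N)
    (etaU : 'M[R]_N) (Phi : 'rV[R]_N -> R) : Prop :=
  forall x, U x -> forall i j m n : 'I_N,
    \sum_a \sum_b pd3 Phi i j a x * etaU a b * pd3 Phi b m n x =
    \sum_a \sum_b pd3 Phi i m a x * etaU a b * pd3 Phi b j n x.

Lemma blk_subproof (k N : nat) (s : 'I_k) (m : 'I_N) : (s * N + m < k * N)%N.
Proof.
by rewrite (leq_trans (n := s.+1 * N)) ?leq_mul2r ?ltn_ord ?orbT //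
  mulSn addnC ltn_add2r.
Qed.

(** The [0]-based position [s N + m] among the normals [0, ..., kN + p - 1]. *)
Definition blk (k N p : nat) (s : 'I_k) (m : 'I_N) : 'I_(k * N + p) :=
  lshift p (Ordinal (blk_subproof s m)).

(** The suffix [U] marks matrices with upper indices; those with lower indices
    are their inverses. *)
Record potential_data (R : realType) (N k p : nat) (U : set 'rV[R]_N) :=
  PotentialData {
  etaU : 'M[R]_N;
  cU : 'M[R]_k;
  muU : 'M[R]_(k * N + p);
  Phi : 'rV[R]_N -> R;
  etaU_nondeg : nondeg_sym etaU;
  cU_nondeg : nondeg_sym cU;
  muU_nondeg : nondeg_sym muU;
  muU_block : forall (s t : 'I_k) (m n : 'I_N),
    muU (blk p s m) (blk p t n) = cU s t * etaU m n;
  Phi_smooth : smooth_on U Phi;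
  Phi_wdvv : wdvv U etaU Phi }.

(** The tangent frame of [r]: row [i] is [d_i r]. *)
Definition tangent (R : realType) (N d : nat) (r : 'rV[R]_N -> 'rV[R]_d)
    (x : 'rV[R]_N) : 'M[R]_(N, d) := \matrix_(i < N) pd i r x.

(** A smooth basis of the normal spaces of [r]; [E] is the Gram matrix of the
    scalar product of the ambient space. *)
Definition normal_basis (R : realType) (N L d : nat) (U : set 'rV[R]_N)
    (E : 'M[R]_d) (r : 'rV[R]_N -> 'rV[R]_d)
    (n : 'I_L -> 'rV[R]_N -> 'rV[R]_d) : Prop :=
  (forall a, smooth_on U (n a)) /\
  forall x, U x ->
    row_free (\matrix_(a < L) n a x) /\
    forall v : 'rV[R]_d,
      (forall i, bform E v (pd i r x) = 0) <-> (v <= \matrix_(a < L) n a x)%MS.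

(** The pseudo-Euclidean space of dimension [(k+1)N+p] is [R^((k+1)N+p)] with
    the scalar product of Gram matrix [E]. *)
Definition potential_submanifold (R : realType) (N k p : nat)
    (U : set 'rV[R]_N) (E : 'M[R]_(k.+1 * N + p))
    (r : 'rV[R]_N -> 'rV[R]_(k.+1 * N + p)) (D : potential_data k p U) :
    Prop :=
  [/\ nondeg_sym E,
      open U,
      smooth_on U r,
      (forall x, U x -> row_free (tangent r x)) &
      (forall x, U x -> tangent r x *m E *m (tangent r x)^T \in unitmx)] /\
  exists n : 'I_(k * N + p) -> 'rV[R]_N -> 'rV[R]_(k.+1 * N + p),
    normal_basis U E r n /\
    forall x, U x ->
    [/\ forall i j, bform E (pd i r x) (pd j r x) = invmx (etaU D) i j,
        forall a b, bform E (n a x) (n b x) = invmx (muU D) a b,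
        forall a b i, bform E (pd i (n a) x) (n b x) = 0,
        forall (s : 'I_k) (m i j : 'I_N),
          bform E (pd i (pd j r) x) (n (blk p s m) x) = pd3 (Phi D) m i j x &
        forall (a : 'I_p) (i j : 'I_N),
          bform E (pd i (pd j r) x) (n (rshift (k * N) a) x) = 0].

(* Main.v *)
Require Import Defs.
From HB Require Import structures.
From mathcomp Require Import all_boot all_order all_algebra.
From mathcomp Require Import all_classical all_reals all_analysis.
From mathcomp Require Import mxtens ring lra.
Set Implicit Arguments.
Unset Strict Implicit.
Unset Printing Implicit Defensive.
Import Order.TTheory GRing.Theory Num.Theory.
Import numFieldNormedType.Exports.
Local Open Scope classical_set_scope.
Local Open Scope ring_scope.

(* Flat coordinates, the potential and the submanifold are all obtained by
   integrating a linear system d_i Y = A_i Y whose coefficients satisfy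
   d_i A_j + A_j A_i = d_j A_i + A_i A_j.  Such a system is solved on a small
   ball by solving the ordinary differential equation along every ray from the
   centre; on comparing neighbouring rays the compatibility condition cancels
   the first order error, so that d_j Y = A_j Y at the end points.

   The differentials of flat coordinates solve d_i xi_k = Gamma^l_ik xi_l; they
   are closed because Gamma is symmetric, and their primitives form a chart by
   the inverse function theorem.  In flat coordinates the symmetric tensor
   a_ijm = g(e_i o e_j, e_m) has symmetric derivative, so it is integrated three
   times to Phi, and associativity becomes WDVV.  With W_i = (a_i..) and
   Omega_i = W_i S, where S copies W_i into the k blocks of normals, the frame
   system (T, n) has coefficients [[0, Omega_i mu], [- Omega_i^T eta, 0]].  Its
   compatibility is W_i eta W_j = W_j eta W_i, i.e. WDVV, thanks to
   S mu S^T = k eta. *)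

(** * Calculus on open subsets of R^N *)

(** The frame system is the Gauss-Weingarten system for constant first fundamental form and zero
    torsion. Off the diagonal its integrability is the Codazzi equation, i.e. the symmetry of the
    derivatives of [a_ijm]; on the diagonal stand the Gauss and Ricci equations, quadratic in the
    [W_i]. As all [k] blocks of normals carry the same forms, the choice [c = 1] makes the Gauss
    term [k] times that of one block, so one relation serves both equations for every [k]; the [p]
    extra normals are constant vectors. A linear system yields a frame but not its scalar products.
    These come from first integrals, [Y^T G^-1 Y] for flat coordinates and [Y^T Q^-1 Y] for the
    moving frame, with [Y = 1] at the centre. The ball is so small that the coefficient along a ray
    at most halves norms: Picard iteration converges geometrically and Gronwall needs no
    exponential. Each integration shrinks the ball, while the data must live on the whole image of a
    chart; so the chart itself is restricted at the end, which the maximality of the atlas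
    permits. *)

HB.instance Definition _ (R : realType) m n :=
  Uniform_isComplete.Build 'M[R]_(m, n) (@mx_complete R m n).

Lemma is_derive_line (R : numFieldType) (V W : normedModType R) (f : V -> W)
    (x v : V) (t : R) :
  derivable f (t *: v + x) v ->
  is_derive t 1 (fun s : R => f (s *: v + x)) ('D_v f (t *: v + x)).
Proof.
have E : (fun h : R => h^-1 *:
    (((fun s : R => f (s *: v + x)) \o shift t) (h *: 1) - f (t *: v + x))) =
    (fun h => h^-1 *: ((f \o shift (t *: v + x)) (h *: v) - f (t *: v + x))).
  apply/funext => h /=; congr (_ *: (f _ - _)).
  by rewrite scalerDl [h *: 1]mulr1 addrA.
by move=> df; split; rewrite /derivable /derive /= E.
Qed.

Lemma is_derive_mxP (R : realFieldType) (V : normedModType R) m n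
    (F : V -> 'M[R]_(m, n)) (x v : V) (dF : 'M[R]_(m, n)) :
  is_derive x v F dF <->
  forall i j, is_derive x v (fun y => F y i j) (dF i j).
Proof.
split=> [[dx <-] i j|H].
  split; first by move/derivable_mxP : dx.
  by rewrite derive_mx // mxE.
have dx : derivable F x v by apply/derivable_mxP => i j; have [] := H i j.
split => //; apply/matrixP => i j; rewrite derive_mx // mxE.
by have [_ ->] := H i j.
Qed.

Lemma normr_entry (R : realDomainType) m n (M : 'M[R]_(m, n)) i j :
  `|M i j| <= `|M|.
Proof.
rewrite [leRHS]/Num.Def.normr /= mx_normrE.
exact: (le_bigmax _ (fun ij => `|M ij.1 ij.2|) (i, j)).
Qed.

Lemma mx_norm_le (R : realDomainType) m n (M : 'M[R]_(m, n)) (K : R) :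
  0 <= K -> (forall i j, `|M i j| <= K) -> `|M| <= K.
Proof.
move=> K0 H; rewrite [leLHS]/Num.Def.normr /= mx_normrE.
by apply/bigmax_leP; split => // -[i j] _ /=.
Qed.

Lemma continuous_mxP (R : realFieldType) (T : topologicalType) m n
    (F : T -> 'M[R]_(m, n)) (x : T) :
  ({for x, continuous F}) <-> (forall i j, {for x, continuous (fun y => F y i j)}).
Proof.
split=> [Fc i j|H].
  apply: (@continuous_comp _ _ _ F (fun M : 'M[R]_(m, n) => M i j)) => //.
  exact: coord_continuous.
apply/cvgrPdist_le => /= e e0; near=> y.
apply: mx_norm_le => [|i j]; first exact: ltW.
rewrite !mxE; suff /(_ (i, j)) : forall ij : 'I_m * 'I_n,
  `|F x ij.1 ij.2 - F y ij.1 ij.2| <= e by [].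
near: y; apply: filter_forall => -[i' j'] /=.
exact: ((cvgrPdist_le _ _).1 (H i' j')).
Unshelve. all: by end_near. Qed.

Lemma normr_mulmx (R : realDomainType) m n p (A : 'M[R]_(m, n)) (B : 'M[R]_(n, p)) :
  `|A *m B| <= n%:R * `|A| * `|B|.
Proof.
apply: mx_norm_le => [|i j]; first by rewrite !mulr_ge0 // ler0n.
rewrite mxE (le_trans (ler_norm_sum _ _ _)) //.
apply: (@le_trans _ _ (\sum_(k < n) `|A| * `|B|)).
  by apply: ler_sum => k _; rewrite normrM ler_pM // normr_entry.
by rewrite sumr_const card_ord -mulrA mulr_natl.
Qed.

Lemma near_eq_continuous (T S : topologicalType) (f g : T -> S) (x : T) :
  {near x, f =1 g} -> {for x, continuous f} -> {for x, continuous g}.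
Proof.
move=> fg fc; rewrite /prop_for /continuous_at -(nbhs_singleton fg).
by apply: cvg_trans fc; exact: near_eq_cvg.
Qed.

Lemma open_near_eq (T : topologicalType) (S : Type) (U : set T) (f g : T -> S) x :
  open U -> U x -> (forall y, U y -> f y = g y) -> {near x, f =1 g}.
Proof.
by move=> oU Ux fg; near=> y; apply: fg; near: y; exact: open_nbhs_nbhs.
Unshelve. all: by end_near. Qed.

(** * Smoothness through algebras of functions stable under partial derivatives *)

Section Smooth.
Context {R : realType} {N : nat}.
Implicit Types (U : set 'rV[R]_N) (f g : 'rV[R]_N -> R).

Lemma pd_eq (V : normedModType R) U (f g : 'rV[R]_N -> V) i x : open U -> U x ->
  (forall y, U y -> f y = g y) -> pd i f x = pd i g x.
Proof. by move=> oU Ux fg; apply: near_eq_derive; exact: open_near_eq fg. Qed.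

Lemma is_derive_pd (V : normedModType R) (f : 'rV[R]_N -> V) i x :
  derivable f x (delta_mx 0 i) -> is_derive x (delta_mx 0 i) f (pd i f x).
Proof. by move=> d; split. Qed.

Inductive alg U (B : ('rV[R]_N -> R) -> Prop) : ('rV[R]_N -> R) -> Prop :=
| alg_base f : B f -> alg U B f
| alg_cst (c : R) : alg U B (fun=> c)
| alg_add f g : alg U B f -> alg U B g -> alg U B (fun x => f x + g x)
| alg_mul f g : alg U B f -> alg U B g -> alg U B (fun x => f x * g x)
| alg_eq f g : (forall x, U x -> f x = g x) -> alg U B f -> alg U B g.

Lemma alg_sum U B (I : Type) (r : seq I) (P : pred I) (F : I -> 'rV[R]_N -> R) :
  (forall i, alg U B (F i)) -> alg U B (fun x => \sum_(i <- r | P i) F i x).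
Proof.
move=> H; elim: r => [|a r IH].
  by apply: (alg_eq _ (alg_cst U B 0)) => x _; rewrite big_nil.
case Pa : (P a).
  by apply: (alg_eq _ (alg_add (H a) IH)) => x _; rewrite big_cons Pa.
by apply: (alg_eq _ IH) => x _; rewrite big_cons Pa.
Qed.

(* A bootstrap: smoothness only has to be checked on generators, and only for
   one derivative. *)
Lemma alg_smooth U (B : ('rV[R]_N -> R) -> Prop) : open U ->
  (forall f, B f -> forall x, U x -> {for x, continuous f} /\
     forall i, derivable f x (delta_mx 0 i)) ->
  (forall f i, B f -> alg U B (pd i f)) ->
  forall f, alg U B f -> smooth_on U f.
Proof.
move=> oU B1 B2.
have C1 f : alg U B f -> forall x, U x -> {for x, continuous f} /\
     forall i, derivable f x (delta_mx 0 i).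
  elim=> [g Bg|c|g h _ IHg _ IHh|g h _ IHg _ IHh|g h gh _ IHg] x Ux.
  - exact: B1.
  - by split => [|i]; [exact: cst_continuous|exact: derivable_cst].
  - have [gc gd] := IHg x Ux; have [hc hd] := IHh x Ux.
    by split => [|i]; [exact: continuousD|exact: derivableD].
  - have [gc gd] := IHg x Ux; have [hc hd] := IHh x Ux.
    by split => [|i]; [exact: continuousM|exact: derivableM].
  - have [gc gd] := IHg x Ux.
    have ngh := open_near_eq oU Ux gh.
    split => [|i]; first exact: near_eq_continuous gc.
    exact: near_eq_derivable (gd i).
have C2 f : alg U B f -> forall i, alg U B (pd i f).
  elim=> [g Bg|c|g h ag IHg ah IHh|g h ag IHg ah IHh|g h gh ag IHg] i.
  - exact: B2.
  - by apply: (alg_eq _ (alg_cst U B 0)) => x _; rewrite /pd derive_cst.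
  - apply: (alg_eq _ (alg_add (IHg i) (IHh i))) => x Ux.
    have [_ gd] := C1 _ ag _ Ux; have [_ hd] := C1 _ ah _ Ux.
    by rewrite /pd -deriveD.
  - apply: (alg_eq _ (alg_add (alg_mul ag (IHh i)) (alg_mul ah (IHg i)))) => x Ux.
    have [_ gd] := C1 _ ag _ Ux; have [_ hd] := C1 _ ah _ Ux.
    by rewrite /pd [RHS](deriveM (gd i) (hd i)).
  - by apply: (alg_eq _ (IHg i)) => x Ux; exact: pd_eq gh.
move=> f af s; have {}af : alg U B (foldr (@pd R N R) f s).
  by elim: s => //= i s IH; exact: C2.
exact: C1 af.
Qed.

Lemma smooth_cont (V : normedModType R) U (f : 'rV[R]_N -> V) x :
  smooth_on U f -> U x -> {for x, continuous f}.
Proof. by move=> sf Ux; have [] := sf [::] x Ux. Qed.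

Lemma smooth_derivable (V : normedModType R) U (f : 'rV[R]_N -> V) x i :
  smooth_on U f -> U x -> derivable f x (delta_mx 0 i).
Proof. by move=> sf Ux; have [_] := sf [::] x Ux; exact. Qed.

Lemma smooth_pd (V : normedModType R) U (f : 'rV[R]_N -> V) i :
  smooth_on U f -> smooth_on U (pd i f).
Proof.
by move=> sf s x Ux; have := sf (rcons s i) x Ux; rewrite -cats1 foldr_cat.
Qed.

Lemma smooth_sub (V : normedModType R) U U' (f : 'rV[R]_N -> V) :
  U' `<=` U -> smooth_on U f -> smooth_on U' f.
Proof. by move=> UU' sf s x /UU'; exact: sf. Qed.

Lemma smooth_alg U f : open U -> alg U (@smooth_on R N R U) f -> smooth_on U f.
Proof.
move=> oU; apply: alg_smooth => // [g sg x Ux|g i sg].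
  by split => [|i]; [exact: smooth_cont Ux|exact: smooth_derivable Ux].
by apply: alg_base; exact: smooth_pd.
Qed.

Lemma smooth_base U f : smooth_on U f -> alg U (@smooth_on R N R U) f.
Proof. exact: alg_base. Qed.

Lemma smoothD U f g : open U -> smooth_on U f -> smooth_on U g ->
  smooth_on U (fun x => f x + g x).
Proof.
by move=> oU sf sg; exact: (smooth_alg oU (alg_add (smooth_base sf) (smooth_base sg))).
Qed.

Lemma smoothM U f g : open U -> smooth_on U f -> smooth_on U g ->
  smooth_on U (fun x => f x * g x).
Proof.
by move=> oU sf sg; exact: (smooth_alg oU (alg_mul (smooth_base sf) (smooth_base sg))).
Qed.

Lemma smooth_cst U (c : R) : open U -> smooth_on U (fun=> c).
Proof. by move=> oU; exact: (smooth_alg oU (alg_cst _ _ c)). Qed.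

Lemma smooth_eq U f g : open U -> (forall x, U x -> f x = g x) ->
  smooth_on U f -> smooth_on U g.
Proof.
by move=> oU fg sf; exact: (smooth_alg oU (alg_eq fg (smooth_base sf))).
Qed.

Lemma smooth_sum U (I : Type) (r : seq I) (P : pred I) (F : I -> 'rV[R]_N -> R) :
  open U -> (forall i, smooth_on U (F i)) ->
  smooth_on U (fun x => \sum_(i <- r | P i) F i x).
Proof.
move=> oU sF; apply: (smooth_alg oU); apply: alg_sum => i; exact: smooth_base.
Qed.

Lemma smooth_prod U (I : Type) (r : seq I) (P : pred I) (F : I -> 'rV[R]_N -> R) :
  open U -> (forall i, smooth_on U (F i)) ->
  smooth_on U (fun x => \prod_(i <- r | P i) F i x).
Proof.
move=> oU sF; elim: r => [|a r IH].
  by apply: (smooth_eq oU _ (smooth_cst 1 oU)) => x _; rewrite big_nil.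
case Pa : (P a).
  by apply: (smooth_eq oU _ (smoothM oU (sF a) IH)) => x _; rewrite big_cons Pa.
by apply: (smooth_eq oU _ IH) => x _; rewrite big_cons Pa.
Qed.

(** The smooth functions together with the single generator [f^-1] suffice, since
    [d(f^-1) = - f^-1 f^-1 df] stays in the algebra they generate. *)
Lemma smoothV U f : open U -> (forall x, U x -> f x != 0) -> smooth_on U f ->
  smooth_on U (fun x => (f x)^-1).
Proof.
move=> oU f0 sf.
apply: (@alg_smooth U (fun g => smooth_on U g \/ g = (fun x => (f x)^-1))) => //;
  last by apply: alg_base; right.
- move=> g [sg|->] x Ux.
    by split => [|i]; [exact: smooth_cont Ux|exact: smooth_derivable Ux].
  split => [|i]; last by apply: derivableV; [exact: f0|exact: smooth_derivable Ux].
  by apply: continuousV; [exact: f0|exact: smooth_cont Ux].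
- move=> g i [sg|->]; first by apply: alg_base; left; exact: smooth_pd.
  have a1 : alg U (fun g => smooth_on U g \/ g = (fun x => (f x)^-1)) (fun x => (f x)^-1).
    by apply: alg_base; right.
  have a2 : alg U (fun g => smooth_on U g \/ g = (fun x => (f x)^-1)) (pd i f).
    by apply: alg_base; left; exact: smooth_pd.
  apply: (alg_eq _ (alg_mul (alg_cst _ _ (-1)) (alg_mul (alg_mul a1 a1) a2))).
  move=> x Ux; rewrite /pd deriveV; [|exact: f0|exact: smooth_derivable Ux].
  by rewrite scaleNr mulN1r expr2 invfM.
Qed.

Lemma smooth_coord U m n : open U ->
  smooth_on U (fun x : 'rV[R]_N => x m n).
Proof.
move=> oU; apply: (@alg_smooth U (fun g => g = fun x => x m n)) => //.
- move=> _ -> x Ux; split => [|j]; first exact: coord_continuous.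
  exact/diff_derivable/differentiable_coord.
- move=> _ j ->; apply: (alg_eq _ (alg_cst _ _ ((delta_mx 0 j : 'rV[R]_N) m n))).
  move=> x Ux; rewrite /pd; have := @derive_id R 'rV[R]_N x (delta_mx 0 j).
  by rewrite derive_mx // => /matrixP /(_ m n); rewrite mxE => ->.
- exact: alg_base.
Qed.

(** [smooth_on] of a matrix-valued map differentiates in the space of matrices; passing to entries
    requires derivability at each stage, hence an induction along [s]. *)
Lemma foldr_pd_mx U m n (F : 'rV[R]_N -> 'M[R]_(m, n)) :
  (forall a b, smooth_on U (fun x => F x a b)) -> open U ->
  forall s x a b, U x ->
  foldr (@pd R N 'M[R]_(m, n)) F s x a b =
  foldr (@pd R N R) (fun x => F x a b) s x.
Proof.
move=> sF oU; elim => [//|i s IH] x a b Ux /=.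
rewrite /pd derive_mx ?mxE; last first.
  apply/derivable_mxP => c d.
  apply: (@near_eq_derivable _ _ _ (foldr (@pd R N R) (fun x => F x c d) s)).
    by apply: open_near_eq Ux _ => // y Uy; rewrite IH.
  by have [_] := sF c d s x Ux; exact.
by apply: near_eq_derive; apply: open_near_eq Ux _ => // y Uy; rewrite IH.
Qed.

Lemma smooth_mxP U m n (F : 'rV[R]_N -> 'M[R]_(m, n)) : open U ->
  smooth_on U F <-> forall a b, smooth_on U (fun x => F x a b).
Proof.
move=> oU; split=> [sF a b s x Ux|sF s x Ux].
  have H : forall x, U x -> foldr (@pd R N 'M[R]_(m, n)) F s x a b =
      foldr (@pd R N R) (fun x => F x a b) s x.
    elim: s => [//|i s IH] y Uy /=.
    rewrite /pd derive_mx ?mxE; last by have [_] := sF s y Uy; exact.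
    by apply: near_eq_derive; apply: open_near_eq Uy _ => // z Uz; rewrite IH.
  have [sc sd] := sF s x Ux.
  split => [|i].
    apply: near_eq_continuous ((continuous_mxP _ _).1 sc a b).
    exact: open_near_eq H.
  apply: near_eq_derivable ((derivable_mxP _ _ _).1 (sd i) a b).
  exact: open_near_eq H.
split => [|i].
  apply/continuous_mxP => a b; have [sc _] := sF a b s x Ux.
  apply: near_eq_continuous sc.
  by apply: open_near_eq Ux _ => // y Uy; rewrite (@foldr_pd_mx U).
apply/derivable_mxP => a b; have [_ /(_ i)] := sF a b s x Ux.
apply: near_eq_derivable.
by apply: open_near_eq Ux _ => // y Uy; rewrite (@foldr_pd_mx U).
Qed.

End Smooth.

(** * Mean value estimates and differentiability in several variables *)

Lemma MVT_any (R : realType) (f df : R -> R) (a b : R) :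
  (forall t, Num.min a b <= t <= Num.max a b -> is_derive t 1 f (df t)) ->
  exists2 c, Num.min a b <= c <= Num.max a b & f b - f a = df c * (b - a).
Proof.
have H (u v : R) : u <= v -> (forall t, u <= t <= v -> is_derive t 1 f (df t)) ->
    exists2 c, u <= c <= v & f v - f u = df c * (v - u).
  move=> uv d; have [||c] := @MVT_segment R f df u v uv.
  - by move=> t /[!in_itv] /= /andP[ut tv]; apply: d; rewrite !ltW.
  - apply: derivable_within_continuous => t tuv.
    by move: tuv; rewrite in_itv /= => /d[].
  - by rewrite in_itv => /= cuv E; exists c.
have [ab|ba] := leP a b => d; first exact: H.
have [c cab E] := H b a (ltW ba) d; exists c => //.
by rewrite -opprB E -mulrN opprB.
Qed.

Lemma continuous_epsP (R : numFieldType) (X V : normedModType R) (f : X -> V) x :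
  ({for x, continuous f}) <-> (forall e : R, 0 < e -> exists2 d : R, 0 < d &
    forall y, `|x - y| < d -> `|f x - f y| <= e).
Proof.
split=> [fc e e0|H].
  have /(@cvgrPdist_le _ _ _ (nbhs x)) /(_ e e0) /nbhs_ballP[d d0 Hd] := fc.
  by exists d => // y xy; apply: Hd; rewrite -ball_normE.
suff : (f y @[y --> x] --> f x) by [].
apply/(@cvgrPdist_le _ _ _ (nbhs x)) => e e0; apply/nbhs_ballP.
have [d d0 Hd] := H e e0; exists d => // y; rewrite -ball_normE; exact: Hd.
Qed.

Section MeanValue.
Context {R : realType} {N : nat}.
Implicit Types (x y z : 'rV[R]_N) (f : 'rV[R]_N -> R).

Lemma ball_rowP (x0 y : 'rV[R]_N) (r : R) :
  ball x0 r y <-> 0 < r /\ forall j, `|x0 0 j - y 0 j| < r.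
Proof.
split=> [[r0 H]|[r0 H]]; first by split => // j; exact: H.
by split => // i j; rewrite ord1; exact: H.
Qed.

Lemma ball_segment (x0 x y : 'rV[R]_N) (r t : R) : 0 <= t <= 1 ->
  ball x0 r x -> ball x0 r y -> ball x0 r (t *: (y - x) + x).
Proof.
move=> /andP[t0 t1]; rewrite -!ball_normE /= => bx by_.
have -> : x0 - (t *: (y - x) + x) = (1 - t) *: (x0 - x) + t *: (x0 - y).
  by apply/rowP => j; rewrite !mxE; ring.
have u0 : 0 <= 1 - t by rewrite subr_ge0.
rewrite (le_lt_trans (ler_normD _ _)) // !normrZ (ger0_norm t0) (ger0_norm u0).
have [->|tn0] := eqVneq t 0; first by rewrite subr0 mul1r mul0r addr0.
have -> : r = (1 - t) * r + t * r by ring.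
apply: ler_ltD; first by rewrite ler_wpM2l // ltW.
by rewrite ltr_pM2l // lt_def tn0.
Qed.

Lemma sum_normr_entries (u : 'rV[R]_N) : \sum_j `|u 0 j| <= N%:R * `|u|.
Proof.
apply: (@le_trans _ _ (\sum_(j < N) `|u|)).
  by apply: ler_sum => j _; exact: normr_entry.
by rewrite sumr_const card_ord mulr_natl.
Qed.

(** The intermediate point is given as a fraction [t] of the step, whatever the sign of [s], so that
    convexity of balls places it in the domain. *)
Lemma line_mvt f x i (s : R) :
  (forall t, 0 <= t <= 1 -> derivable f ((t * s) *: delta_mx 0 i + x) (delta_mx 0 i)) ->
  exists2 t, 0 <= t <= 1 &
    f (s *: delta_mx 0 i + x) - f x = s * pd i f ((t * s) *: delta_mx 0 i + x).
Proof.
move=> d; set e : 'rV_N := delta_mx 0 i.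
have [->|s0] := eqVneq s 0.
  by exists 0; rewrite ?lexx ?ler01 // scale0r add0r subrr mul0r.
have tP t : Num.min 0 s <= t <= Num.max 0 s -> 0 <= t / s <= 1.
  have [s1|s1] := leP 0 s => /andP[t1 t2].
    have {}s1 : 0 < s by rewrite lt_def s0.
    by rewrite divr_ge0 ?(ltW s1) //= ler_pdivrMr // mul1r.
  by rewrite -mulrNN -invrN divr_ge0 ?oppr_ge0 ?(ltW s1) //= ler_pdivrMr
    ?oppr_gt0 // mul1r lerN2.
have [t tb|c cb] := @MVT_any R (fun t => f (t *: e + x)) (fun t => pd i f (t *: e + x)) 0 s.
  apply: is_derive_line; have := d _ (tP _ tb); by rewrite divfK.
rewrite scale0r add0r subr0 => ->; exists (c / s); first exact: tP.
by rewrite divfK // mulrC.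
Qed.

(** Balls of the sup norm are boxes: one can go from [x] to [y] inside the ball by changing one
    coordinate at a time and apply the one-variable theorem to each edge. *)
Lemma box_mvt (x0 : 'rV[R]_N) (r : R) f (a : 'I_N -> R) (eps : R) :
  (forall z, ball x0 r z -> forall j, derivable f z (delta_mx 0 j)) ->
  (forall z, ball x0 r z -> forall j, `|pd j f z - a j| <= eps) ->
  forall x y, ball x0 r x -> ball x0 r y ->
  `|f y - f x - \sum_j a j * (y 0 j - x 0 j)| <= eps * \sum_j `|y 0 j - x 0 j|.
Proof.
move=> d H x y bx by_.
(* The corner reached after the coordinates listed in [s] have been moved from [x] to [y]. *)
pose p (s : seq 'I_N) : 'rV[R]_N := \row_j (if j \in s then y 0 j else x 0 j).
have bp s : ball x0 r (p s).
  apply/ball_rowP; move/ball_rowP : bx => [r0 bx]; move/ball_rowP : by_ => [_ by_].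
  by split => // j; rewrite mxE; case: ifP.
have step i s : i \notin s -> p (i :: s) = (y 0 i - x 0 i) *: delta_mx 0 i + p s.
  move=> is_; apply/rowP => j; rewrite !mxE /= in_cons.
  have [->|ji] := eqVneq j i; first by rewrite (negbTE is_) mulr1 subrK.
  by rewrite mulr0 add0r.
suff K (s : seq 'I_N) : uniq s ->
   `|f (p s) - f x - \sum_(j <- s) a j * (y 0 j - x 0 j)| <=
     eps * \sum_(j <- s) `|y 0 j - x 0 j|.
  have := K (index_enum 'I_N) (index_enum_uniq _).
  suff -> : p (index_enum 'I_N) = y by [].
  by apply/rowP => j; rewrite mxE mem_index_enum.
elim: s => [_|i s IH /= /andP[is_ us]].
  rewrite !big_nil mulr0 subr0 (_ : p [::] = x) ?subrr ?normr0 //.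
  by apply/rowP => j; rewrite mxE.
have seg t : 0 <= t <= 1 ->
    ball x0 r ((t * (y 0 i - x 0 i)) *: delta_mx 0 i + p s).
  move=> t01; have := ball_segment t01 (bp s) (bp (i :: s)).
  by rewrite step // addrK scalerA.
have [t t01|t t01 E] := @line_mvt f (p s) i (y 0 i - x 0 i).
  exact/d/seg.
rewrite step // !big_cons.
rewrite (_ : _ - _ = (f (p s) - f x - \sum_(j <- s) a j * (y 0 j - x 0 j)) +
  (pd i f ((t * (y 0 i - x 0 i)) *: delta_mx 0 i + p s) - a i) *
  (y 0 i - x 0 i)); last first.
  by move/eqP: E; rewrite subr_eq => /eqP ->; ring.
rewrite (le_trans (ler_normD _ _)) // [leRHS]mulrDr [leLHS]addrC lerD ?IH //.
by rewrite normrM ler_wpM2r //; apply/H/seg.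
Qed.

Lemma ball_pd0_cst (x0 : 'rV[R]_N) (r : R) f :
  (forall z, ball x0 r z -> forall j, is_derive z (delta_mx 0 j) f 0) ->
  forall x y, ball x0 r x -> ball x0 r y -> f x = f y.
Proof.
move=> H x y bx by_.
have := @box_mvt x0 r f (fun=> 0) 0 _ _ y x by_ bx.
rewrite mul0r big1 => [|j _]; last by rewrite mul0r.
rewrite subr0 normr_le0 subr_eq0 => K; apply/eqP/K => z bz j.
  by have [] := H z bz j.
by have [_] := H z bz j; rewrite /pd => ->; rewrite subrr normr0.
Qed.

(** Bounded partial derivatives already give a Lipschitz estimate. This serves the solutions built
    along rays, whose partial derivatives are computed before continuity is known. *)
Lemma bounded_pd_continuous (x0 : 'rV[R]_N) (r K : R) f :
  (forall z, ball x0 r z -> forall j, derivable f z (delta_mx 0 j)) ->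
  (forall z, ball x0 r z -> forall j, `|pd j f z| <= K) ->
  forall x, ball x0 r x -> {for x, continuous f}.
Proof.
move=> d H x bx; have ox : nbhs x (ball x0 r).
  by apply: open_nbhs_nbhs; split => //; exact: ball_open.
have K0 : 0 <= `|K| * N%:R + 1 by rewrite addr_ge0 // mulr_ge0 // ler0n.
have K1 : 0 < `|K| * N%:R + 1 by rewrite ltr_wpDl // mulr_ge0 // ler0n.
have /nbhs_ballP[d1 /= d1p Hd1] := ox.
apply/continuous_epsP => e e0.
exists (Num.min d1 (e / (`|K| * N%:R + 1))) => [|y].
  by rewrite lt_min d1p divr_gt0.
rewrite lt_min => /andP[yd1 yd2].
have by_ : ball x0 r y by apply: Hd1; rewrite -ball_normE.
have := @box_mvt x0 r f (fun=> 0) `|K| d _ y x by_ bx.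
rewrite big1 => [|j _]; last by rewrite mul0r.
rewrite subr0 => /(_ _)/le_trans; apply.
  by move=> z bz j; rewrite subr0 (le_trans (H z bz j)) // ler_norm.
apply: (@le_trans _ _ (`|K| * (N%:R * `|x - y|))).
  rewrite ler_wpM2l //.
  apply: le_trans (sum_normr_entries _).
  by apply: ler_sum => j _; rewrite !mxE.
rewrite mulrA (@le_trans _ _ ((`|K| * N%:R + 1) * `|x - y|)) //.
  by rewrite ler_wpM2r // lerDl.
by rewrite mulrC -ler_pdivlMr // ltW.
Qed.

Definition rowform (a : 'I_N -> R) (v : 'rV[R]_N) : R := \sum_j v 0 j * a j.

Fact rowform_linear a : linear (rowform a : 'rV[R]_N -> R^o).
Proof.
move=> c u v; rewrite /rowform scaler_sumr -big_split /=.
by apply: eq_bigr => j _; rewrite !mxE mulrDl -mulrA.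
Qed.

HB.instance Definition _ a :=
  GRing.isLinear.Build R 'rV[R]_N R^o *:%R (rowform a) (rowform_linear a).

Lemma rowform_continuous a : continuous (rowform a).
Proof.
move=> v; apply: (@differentiable_continuous R 'rV[R]_N R^o).
have -> : rowform a = \sum_j ((a j) \*: (fun v : 'rV[R]_N => v 0 j : R^o)).
  by apply/funext => u; rewrite fct_sumE; apply: eq_bigr => j _; rewrite mulrC.
apply: differentiable_sum => j; apply: differentiableZ.
exact: differentiable_coord.
Qed.

(** [box_mvt] with [a] the partial derivatives at [x] bounds the remainder by the oscillation of the
    partial derivatives, which continuity makes small. *)
Lemma C1_differentiable (U : set 'rV[R]_N) f x : open U -> U x ->
  (forall z, U z -> forall j, derivable f z (delta_mx 0 j)) ->
  (forall j, {for x, continuous (pd j f)}) ->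
  differentiable f x /\ 'd f x = rowform (fun j => pd j f x) :> (_ -> _).
Proof.
move=> oU Ux d c; set a := fun j => pd j f x.
have E : (f : 'rV[R]_N -> R^o) \o shift x =
    cst (f x) + (rowform a : {linear 'rV[R]_N -> R^o}) +o_ (0 : 'rV[R]_N) id.
  apply/eqaddoP => e e0.
  (* Summing over coordinates costs a factor [N]; the [+ 1] keeps the denominator positive when
     [N = 0]. *)
  pose eps := e / (N%:R + 1).
  have N1 : 0 < N%:R + 1 :> R by rewrite ltr_wpDl // ler0n.
  have eps0 : 0 < eps by rewrite divr_gt0.
  have : \forall z \near x, U z /\ forall j, `|pd j f z - a j| <= eps.
    apply: filterI; first exact: open_nbhs_nbhs.
    apply: (@filter_forall _ 'I_N (fun j z => `|pd j f z - a j| <= eps) (nbhs x)) => j.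
    have /continuous_epsP /(_ _ eps0) [d' d'0 Hd] := c j.
    apply/nbhs_ballP; exists d' => // z; rewrite -ball_normE /= => /Hd.
    by rewrite distrC.
  move=> /nbhs_ballP[r /= r0 H].
  apply/nbhs_ballP; exists r => // h.
  rewrite -ball_normE /= sub0r normrN => hr; rewrite !fctE /= opprD addrA.
  have bx : ball x r x by exact: ballxx.
  have bh : ball x r (h + x).
    by rewrite -ball_normE /= opprD addrC subrK normrN.
  have -> : rowform a h = \sum_j a j * ((h + x) 0 j - x 0 j).
    by apply: eq_bigr => j _; rewrite mxE addrK mulrC.
  apply: (le_trans (box_mvt _ _ bx bh)) => [z bz j|z bz j|].
  - by have [Uz _] := H z bz; exact: d.
  - by have [_] := H z bz; exact.
  - apply: (@le_trans _ _ (eps * (N%:R * `|h|))).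
      rewrite ler_wpM2l ?(ltW eps0) //.
      apply: le_trans (sum_normr_entries _).
      by apply: ler_sum => j _; rewrite mxE addrK.
    rewrite mulrA ler_wpM2r // /eps mulrAC ler_pdivrMr // ler_wpM2l ?ltW //.
    by rewrite ltrDl.
have dE := diff_unique (@rowform_continuous a) E.
by split => //; apply/diff_locallyP; rewrite dE; split => //; exact: rowform_continuous.
Qed.

Lemma smooth_differentiable (U : set 'rV[R]_N) f x : open U -> U x ->
  smooth_on U f ->
  differentiable f x /\ 'd f x = rowform (fun j => pd j f x) :> (_ -> _).
Proof.
move=> oU Ux sf; apply: (C1_differentiable oU Ux) => [z Uz j|j].
  exact: smooth_derivable sf Uz.
exact: smooth_cont (smooth_pd j sf) Ux.
Qed.

(** Only a directional derivative of [g] is available. Restricted to the line through [x] along [v]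
    it becomes a differentiable curve, to which the chain rule for the differentiable [h]
    applies. *)
Lemma is_derive_chain (W : normedModType R) (U : set 'rV[R]_N) (h : 'rV[R]_N -> R)
    (g : W -> 'rV[R]_N) (x v : W) : open U -> smooth_on U h -> U (g x) ->
  derivable g x v ->
  is_derive x v (h \o g) (\sum_j ('D_v g x) 0 j * pd j h (g x)).
Proof.
move=> oU sh Ugx dg.
have [dh dhE] := smooth_differentiable oU Ugx sh.
pose l := fun t : R => g (t *: v + x).
have dl : derivable l 0 1 by exact: (derivable1P g x v).1.
have l0 : l 0 = g x by rewrite /l scale0r add0r.
have Dl : 'D_1 l 0 = 'D_v g x.
  have d0 : derivable g (0 *: v + x) v by rewrite scale0r add0r.
  by have [_] := is_derive_line d0; rewrite scale0r add0r.
have dl' : differentiable l 0 by apply/derivable1_diffP.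
have dhl : differentiable h (l 0) by rewrite l0.
have dc : differentiable (h \o l) 0 by exact: differentiable_comp.
have dd : derivable (h \o g) x v by apply: (derivable1P (h \o g) x v).2; exact: diff_derivable.
split => //.
have d0 : derivable (h \o g) (0 *: v + x) v by rewrite scale0r add0r.
have [_] := is_derive_line d0; rewrite scale0r add0r => <-.
rewrite [LHS](_ : _ = 'D_1 (h \o l) 0) // deriveE // diff_comp //=.
have -> : 'd l 0 1 = 'D_v g x by rewrite -Dl deriveE.
rewrite l0 dhE.
by [].
Qed.

End MeanValue.

(** * Product and chain rules for matrix-valued functions *)

Section MatrixCalculus.
Context {R : realType}.

Lemma is_derive_sumf (V W : normedModType R) (I : Type) (r : seq I)
    (F : I -> V -> W) (dF : I -> W) (x v : V) :
  (forall i, is_derive x v (F i) (dF i)) ->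
  is_derive x v (fun y => \sum_(i <- r) F i y) (\sum_(i <- r) dF i).
Proof.
move=> H; elim: r => [|i r IH].
  rewrite big_nil (_ : (fun _ => _) = cst 0); first exact: is_derive_cst.
  by apply/funext => y; rewrite big_nil.
rewrite big_cons (_ : (fun _ => _) = F i + (fun y => \sum_(i <- r) F i y)).
  exact: is_deriveD.
by apply/funext => y; rewrite big_cons.
Qed.

Lemma continuous_sumf (T : topologicalType) (W : normedModType R) (I : Type)
    (r : seq I) (F : I -> T -> W) (x : T) :
  (forall i, {for x, continuous (F i)}) ->
  {for x, continuous (fun y => \sum_(i <- r) F i y)}.
Proof.
move=> H; elim: r => [|i r IH].
  rewrite (_ : (fun _ => _) = cst 0); first exact: cst_continuous.
  by apply/funext => y; rewrite big_nil.
rewrite (_ : (fun _ => _) = F i + (fun y => \sum_(i <- r) F i y)).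
  exact: continuousD (H i) IH.
by apply/funext => y; rewrite big_cons.
Qed.

Lemma is_derive_mulmx (V : normedModType R) m n p (A : V -> 'M[R]_(m, n))
    (B : V -> 'M[R]_(n, p)) dA dB (x v : V) :
  is_derive x v A dA -> is_derive x v B dB ->
  is_derive x v (fun y => A y *m B y) (dA *m B x + A x *m dB).
Proof.
move=> /is_derive_mxP HA /is_derive_mxP HB; apply/is_derive_mxP => i j.
rewrite (_ : (fun y => _) = fun y => \sum_k A y i k * B y k j); last first.
  by apply/funext => y; rewrite mxE.
rewrite !mxE -big_split /=; apply: is_derive_sumf => k.
have H := is_deriveM (HA i k) (HB k j).
by split; [case: H|case: H => _ ->; rewrite addrC [_ *: dA i k]mulrC].
Qed.

Lemma is_derive_trmx (V : normedModType R) m n (A : V -> 'M[R]_(m, n)) dA (x v : V) :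
  is_derive x v A dA -> is_derive x v (fun y => (A y)^T) (dA^T).
Proof.
move=> /is_derive_mxP HA; apply/is_derive_mxP => i j; rewrite mxE.
rewrite (_ : (fun y => _) = fun y => A y j i) //.
by apply/funext => y; rewrite mxE.
Qed.

Lemma is_derive_scalef (V : normedModType R) m n (a : V -> R) (F : V -> 'M[R]_(m, n))
    da dF (x v : V) : is_derive x v a da -> is_derive x v F dF ->
  is_derive x v (fun y => a y *: F y) (da *: F x + a x *: dF).
Proof.
move=> Ha /is_derive_mxP HF; apply/is_derive_mxP => i j.
rewrite (_ : (fun y => _) = fun y => a y * F y i j); last first.
  by apply/funext => y; rewrite mxE.
have H := is_deriveM Ha (HF i j); rewrite !mxE.
by split; [case: H|case: H => _ ->; rewrite addrC [_ *: da]mulrC].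
Qed.

Context {N : nat}.
Implicit Types (U : set 'rV[R]_N).

Lemma pd_entry (m n : nat) (F : 'rV[R]_N -> 'M[R]_(m, n)) i x a b :
  derivable F x (delta_mx 0 i) ->
  pd i (fun y => F y a b) x = pd i F x a b.
Proof. by move=> dF; rewrite [in RHS]/pd derive_mx // mxE. Qed.

Lemma is_derive_chain_mx (W : normedModType R) U m n (h : 'rV[R]_N -> 'M[R]_(m, n))
    (g : W -> 'rV[R]_N) (x v : W) : open U -> smooth_on U h -> U (g x) ->
  derivable g x v ->
  is_derive x v (h \o g) (\sum_j ('D_v g x) 0 j *: pd j h (g x)).
Proof.
move=> oU sh Ugx dg; apply/is_derive_mxP => a b.
have H := is_derive_chain oU ((smooth_mxP h oU).1 sh a b) Ugx dg.
rewrite summxE (eq_bigr (fun j => 'D_v g x 0 j * pd j (fun x => h x a b) (g x))).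
  exact: H.
move=> j _; rewrite mxE pd_entry; first exact: erefl.
exact: smooth_derivable sh Ugx.
Qed.

Lemma smooth_is_derive (V : normedModType R) U (f : 'rV[R]_N -> V) x i :
  smooth_on U f -> U x -> is_derive x (delta_mx 0 i) f (pd i f x).
Proof. by move=> sf Ux; apply: is_derive_pd; exact: smooth_derivable sf Ux. Qed.

Lemma smooth_mulmx U m n p (A : 'rV[R]_N -> 'M[R]_(m, n)) (B : 'rV[R]_N -> 'M[R]_(n, p)) :
  open U -> smooth_on U A -> smooth_on U B -> smooth_on U (fun x => A x *m B x).
Proof.
move=> oU /(smooth_mxP _ oU) sA /(smooth_mxP _ oU) sB.
apply/(smooth_mxP _ oU) => i j.
apply: (@smooth_eq _ _ _ (fun x => \sum_k A x i k * B x k j)) => //.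
  by move=> x _; rewrite mxE.
by apply: smooth_sum => // k; exact: smoothM.
Qed.

Lemma smooth_trmx U m n (A : 'rV[R]_N -> 'M[R]_(m, n)) :
  open U -> smooth_on U A -> smooth_on U (fun x => (A x)^T).
Proof.
move=> oU /(smooth_mxP _ oU) sA; apply/(smooth_mxP _ oU) => i j.
by apply: smooth_eq (sA j i) => // x _; rewrite mxE.
Qed.

Lemma smooth_det U n (A : 'rV[R]_N -> 'M[R]_n) :
  open U -> (forall i j, smooth_on U (fun x => A x i j)) ->
  smooth_on U (fun x => \det (A x)).
Proof.
move=> oU sA; apply: smooth_sum => // s; apply: smoothM => //.
  exact: smooth_cst.
exact: smooth_prod.
Qed.

(** Cramer's rule: each entry is a polynomial in the entries of [A] divided by a nonvanishing
    determinant. *)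
Lemma smooth_invmx U n (A : 'rV[R]_N -> 'M[R]_n) :
  open U -> (forall x, U x -> A x \in unitmx) -> smooth_on U A ->
  smooth_on U (fun x => invmx (A x)).
Proof.
move=> oU uA /(smooth_mxP _ oU) sA; apply/(smooth_mxP _ oU) => i j.
apply: (@smooth_eq _ _ _ (fun x => (\det (A x))^-1 * cofactor (A x) j i)) => //.
  by move=> x Ux; rewrite /invmx uA // !mxE.
apply: smoothM => //.
  apply: smoothV => //; last exact: smooth_det.
  by move=> x Ux; have := uA x Ux; rewrite unitmxE unitfE.
apply: smoothM => //; first exact: smooth_cst.
apply: smooth_det => // a b.
by apply: smooth_eq (sA (lift j a) (lift i b)) => // x _; rewrite !mxE.
Qed.

(** By the chain rule the functions smooth on [U] and the composites of [g] with functions smooth on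
    [V] generate an algebra stable under partial derivatives. *)
Lemma smooth_comp M U (V : set 'rV[R]_M) (h : 'rV[R]_M -> R) (g : 'rV[R]_N -> 'rV[R]_M) :
  open U -> open V -> smooth_on U g -> (forall x, U x -> V (g x)) ->
  smooth_on V h -> smooth_on U (h \o g).
Proof.
move=> oU oV sg gV sh.
pose B (f : 'rV[R]_N -> R) :=
  smooth_on U f \/ exists2 h : 'rV[R]_M -> R, smooth_on V h & f = h \o g.
have pdE (h' : 'rV[R]_M -> R) i x : smooth_on V h' -> U x ->
    is_derive x (delta_mx 0 i) (h' \o g) (\sum_j (pd i g x) 0 j * pd j h' (g x)).
  move=> sh' Ux; apply: (is_derive_chain oV sh') => //; first exact: gV.
  exact: smooth_derivable sg Ux.
apply: (@alg_smooth R N U B oU _ _ (h \o g)); last by apply: alg_base; right; exists h.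
- move=> f [sf|[h' sh' ->]] x Ux.
    by split => [|i]; [exact: smooth_cont Ux|exact: smooth_derivable Ux].
  split => [|i]; last by have [] := pdE h' i x sh' Ux.
  apply: continuous_comp; first exact: smooth_cont sg Ux.
  by apply: (smooth_cont sh'); exact: gV.
- move=> f i [sf|[h' sh' ->]]; first by apply: alg_base; left; exact: smooth_pd.
  apply: (@alg_eq _ _ _ _ (fun x => \sum_j (pd i g x) 0 j * pd j h' (g x))).
    by move=> x Ux; have [_] := pdE h' i x sh' Ux.
  apply: alg_sum => j; apply: alg_mul; apply: alg_base.
    left; exact: (smooth_mxP _ oU).1 (smooth_pd i sg) 0 j.
  right; exists (pd j h'); [exact: smooth_pd|exact: erefl].
Qed.

Lemma smooth_comp_mx M U (V : set 'rV[R]_M) m n (h : 'rV[R]_M -> 'M[R]_(m, n))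
    (g : 'rV[R]_N -> 'rV[R]_M) :
  open U -> open V -> smooth_on U g -> (forall x, U x -> V (g x)) ->
  smooth_on V h -> smooth_on U (h \o g).
Proof.
move=> oU oV sg gV /(smooth_mxP _ oV) sh; apply/(smooth_mxP _ oU) => i j.
exact: (smooth_comp oU oV sg gV (sh i j)).
Qed.

End MatrixCalculus.

(** * Mean value inequalities on the unit interval *)

Section LinearODE.
Context {R : realType}.

Definition clamp (t : R) : R := Num.max 0 (Num.min t 1).

Lemma clamp01 (t : R) : 0 <= clamp t <= 1.
Proof. by rewrite /clamp le_max lexx /= ge_max ler01 ge_min lexx orbT. Qed.

Lemma clamp_id (t : R) : 0 <= t <= 1 -> clamp t = t.
Proof. by move=> /andP[t0 t1]; rewrite /clamp (min_idPl t1) (max_idPr t0). Qed.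

Lemma clamp_continuous : continuous clamp.
Proof.
move=> t; have H : {for t, continuous ((cst 0 : R -> R^o) \max (id \min cst 1))}.
  apply: continuous_max; first exact: cst_continuous.
  apply: continuous_min; [exact: cvg_id | exact: cst_continuous].
exact: H.
Qed.

(** For the sup norm the scalar theorem can be applied to each entry with its own intermediate
    point. *)
Lemma mx_mvt m n (F dF : R -> 'M[R]_(m, n)) (K : R) :
  (forall t : R, 0 <= t <= 1 -> is_derive t 1 F (dF t)) ->
  (forall t : R, 0 <= t <= 1 -> `|dF t| <= K) ->
  forall s t : R, 0 <= s <= 1 -> 0 <= t <= 1 -> `|F t - F s| <= K * `|t - s|.
Proof.
move=> d dK s t s01 t01.
have K0 : 0 <= K by apply: le_trans (normr_ge0 _) (dK s s01).
apply: mx_norm_le => [|i j]; first exact: mulr_ge0.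
have H u : Num.min s t <= u <= Num.max s t -> 0 <= u <= 1.
  move: s01 t01 => /andP[s0 s1] /andP[t0 t1] /andP[u1 u2].
  apply/andP; split; first by rewrite (le_trans _ u1) // le_min s0.
  by rewrite (le_trans u2) // ge_max s1.
have [u us|c cs] := @MVT_any R (fun u => F u i j) (fun u => dF u i j) s t.
  exact: (is_derive_mxP _ _ _ _).1 (d u (H u us)) i j.
rewrite !mxE => ->; rewrite normrM ler_wpM2r //.
exact: le_trans (normr_entry _ _ _) (dK c (H c cs)).
Qed.

Lemma mx_mvt0 m n (F dF : R -> 'M[R]_(m, n)) (K : R) :
  (forall t : R, 0 <= t <= 1 -> is_derive t 1 F (dF t)) ->
  (forall t : R, 0 <= t <= 1 -> `|dF t| <= K) ->
  forall t : R, 0 <= t <= 1 -> `|F t - F 0| <= K.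
Proof.
move=> d dK t t01; have z01 : 0 <= (0 : R) <= 1 by rewrite lexx ler01.
apply: le_trans (mx_mvt d dK z01 t01) _.
rewrite subr0 ler_piMr //; first by apply: le_trans (normr_ge0 _) (dK 0 z01).
by case/andP: t01 => t0 t1; rewrite ger0_norm.
Qed.

End LinearODE.

(** * Linear ordinary differential equations *)

Section LinearODE2.
Context {R : realType}.

(** At a point [u] where the norm is maximal, [|F u| <= |F 0| + |F u| / 2 + c], and the middle term
    is absorbed on the left. *)
Lemma half_gronwall m n (F dF : R -> 'M[R]_(m, n)) (c : R) :
  (forall t : R, 0 <= t <= 1 -> is_derive t 1 F (dF t)) ->
  (forall t : R, 0 <= t <= 1 -> `|dF t| <= 2^-1 * `|F t| + c) ->
  forall t : R, 0 <= t <= 1 -> `|F t| <= 2 * (`|F 0| + c).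
Proof.
move=> d dK.
have [|u u01 umax] := @EVT_max R (fun t => `|F t|) 0 1 ler01.
  have cF : {within `[0, 1], continuous F}.
    by apply: derivable_within_continuous => t; rewrite in_itv /= => /d[].
  by move=> t; apply: continuous_comp (cF t) _; exact: norm_continuous.
rewrite in_itv /= in u01.
have H : `|F u - F 0| <= 2^-1 * `|F u| + c.
  apply: (mx_mvt0 d) => // t t01; apply: le_trans (dK t t01) _.
  by rewrite lerD2r ler_wpM2l ?invr_ge0 ?ler0n // umax // in_itv.
move=> t t01; apply: le_trans (umax t _) _; first by rewrite in_itv.
have : `|F u| <= `|F u - F 0| + `|F 0| by rewrite -[in leLHS](subrK (F 0) (F u)) ler_normD.
move: H; set a := `|F u|; set b := `|F 0|; set e := `|_ - _| => H1 H2.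
by lra.
Qed.

Lemma primitive_exists (f : R -> R) : continuous f ->
  exists F : R -> R, F 0 = 0 /\ forall t : R, 0 <= t <= 1 -> is_derive t 1 F (f t).
Proof.
move=> cf.
(* Integrating over [[-1, 2]] puts [[0, 1]] in the interior, so that the derivative is two-sided at
   0 and 1 as well. *)
pose G x := (\int[lebesgue_measure]_(t in [set` `[(-1 : R), x]]) (f t))%R.
have fi : lebesgue_measure.-integrable `[(-1 : R), 2] (EFin \o f).
  apply: continuous_compact_integrable; first exact: segment_compact.
  exact: continuous_subspaceT.
have dG (t : R) : 0 <= t <= 1 -> is_derive t 1 G (f t).
  move=> /andP[t0 t1].
  have t2 : t < 2 by rewrite (le_lt_trans t1) // ltr1n.
  have tN1 : -1 < t by rewrite (lt_le_trans _ t0) // ltrN10.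
  have [dG GE] := continuous_FTC1_closed t2 fi tN1 (cf t).
  by split; [exact: dG|rewrite -derive1E; exact: GE].
exists (fun t => G t - G 0); split; first by rewrite subrr.
move=> t t01; have H := is_deriveB (dG t t01) (@is_derive_cst R R R (G 0) t 1).
by rewrite subr0 in H.
Qed.

Lemma mx_primitive_exists m n (F : R -> 'M[R]_(m, n)) : continuous F ->
  exists P : R -> 'M[R]_(m, n), P 0 = 0 /\
    forall t : R, 0 <= t <= 1 -> is_derive t 1 P (F t).
Proof.
move=> cF.
have H (ij : 'I_m * 'I_n) : exists P : R -> R, P 0 = 0 /\
    forall t : R, 0 <= t <= 1 -> is_derive t 1 P (F t ij.1 ij.2).
  apply: primitive_exists => t; exact: (continuous_mxP _ _).1 (cF t) ij.1 ij.2.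
have [P HP] := choice H.
exists (fun t => \matrix_(i, j) P (i, j) t); split.
  by apply/matrixP => i j; rewrite !mxE; have [] := HP (i, j).
move=> t t01; apply/is_derive_mxP => i j.
rewrite (_ : (fun y => _) = P (i, j)); first by have [_] := HP (i, j); exact.
by apply/funext => y; rewrite mxE.
Qed.

(** Telescoping against a geometric series. The explicit rate of convergence is kept; it is used
    both for Picard iteration and for the inverse function theorem. *)
Lemma geometric_cvg (V : completeNormedModType R) (u : nat -> V) (C : R) :
  (forall n, `|u n.+1 - u n| <= C / 2 ^+ n) ->
  exists l, forall n, `|l - u n| <= 2 * C / 2 ^+ n.
Proof.
move=> H.
have C0 : 0 <= C by have := le_trans (normr_ge0 _) (H 0); rewrite expr0 divr1.
have H2 n m : `|u (n + m)%N - u n| <= 2 * C * ((2 ^+ n)^-1 - (2 ^+ (n + m)%N)^-1).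
  elim: m => [|m IH]; first by rewrite addn0 !subrr normr0 mulr0.
  rewrite addnS -(subrKA (u (n + m)%N)) (le_trans (ler_normD _ _)) //.
  apply: le_trans (lerD (H _) IH) _.
  rewrite [in leRHS]exprS invfM; set a := (2 ^+ n)^-1; set b := (2 ^+ (n + m)%N)^-1.
  rewrite le_eqVlt; apply/orP; left; apply/eqP; by field.
have H3 n m : `|u (n + m)%N - u n| <= 2 * C / 2 ^+ n.
  apply: le_trans (H2 n m) _; rewrite ler_wpM2l ?mulr_ge0 // gerBl.
  by rewrite invr_ge0 exprn_ge0.
have cu : cvgn u.
  have cs : cvgn (series (fun n => u n.+1 - u n)).
    apply: normed_cvg; apply: (@series_le_cvg _ _ (geometric C (2^-1))).
    - by move=> n; exact: normr_ge0.
    - by move=> n; rewrite /geometric /= mulr_ge0 // exprn_ge0 // invr_ge0.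
    - by move=> n; rewrite /geometric /= exprVn; exact: H.
    - apply: is_cvg_geometric_series; rewrite ger0_norm ?invr_ge0 //.
      by rewrite invf_lt1 // ltr1n.
  rewrite (_ : u = series (fun n => u n.+1 - u n) + cst (u 0)).
    by apply: is_cvgD cs _; exact: is_cvg_cst.
  by apply/funext => n; rewrite fctE /= /series /= telescope_sumr // subrK.
exists (limn u) => n; apply/ler_addgt0Pr => e e0.
have /cvgrPdist_le /(_ e e0) [k _ Hk] := cu.
have Hnk := Hk (n + k)%N (leq_addl _ _).
rewrite -(subrKA (u (n + k)%N)) (le_trans (ler_normD _ _)) // [leRHS]addrC.
exact: lerD Hnk (H3 n k).
Qed.

(** Turns errors of order [2^-n] into equalities, so that no limit has to be exchanged with an
    integral or with a function. *)
Lemma le0_geometric (x K : R) : (forall n, x <= K / 2 ^+ n) -> x <= 0.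
Proof.
move=> H; have c : geometric K (2^-1) n @[n --> \oo] --> (0 : R).
  by apply: cvg_geometric; rewrite ger0_norm ?invr_ge0 // invf_lt1 // ltr1n.
apply/ler_addgt0Pr => e e0; rewrite add0r.
have /cvgrPdist_le /(_ e e0) [k _ Hk] := c.
have := Hk k (leqnn k); rewrite /geometric /= sub0r normrN exprVn => Hk'.
exact: le_trans (H k) (le_trans (ler_norm _) Hk').
Qed.

(* Picard iteration; composing with [clamp] makes all estimates uniform on [R]. *)
Lemma linear_ode m d (B : R -> 'M[R]_m) (Y0 : 'M[R]_(m, d)) : continuous B ->
  (forall t (Z : 'M[R]_(m, d)), `|B t *m Z| <= 2^-1 * `|Z|) ->
  exists Y : R -> 'M[R]_(m, d), Y 0 = Y0 /\
    forall t : R, 0 <= t <= 1 -> is_derive t 1 Y (B t *m Y t).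
Proof.
move=> cB HB.
have cBS S : continuous S -> continuous (fun s => B s *m S s : 'M[R]_(m, d)).
  move=> cS t; apply/continuous_mxP => i j.
  rewrite (_ : (fun y => _) = fun s => \sum_k B s i k * S s k j); last first.
    by apply/funext => s; rewrite mxE.
  apply: continuous_sumf => k; apply: continuousM.
    exact: (continuous_mxP _ _).1 (cB t) i k.
  exact: (continuous_mxP _ _).1 (cS t) k j.
pose prop (F P : R -> 'M[R]_(m, d)) := P 0 = 0 /\
    forall t : R, 0 <= t <= 1 -> is_derive t 1 P (F t).
(* Makes the choice of a primitive an operator on functions; the default 0 is returned only where no
   primitive exists. *)
pose pr F : R -> 'M[R]_(m, d) := xget 0 [set P | prop F P].
have prP F : continuous F -> prop F (pr F).
  by move=> /mx_primitive_exists[P HP]; apply: (@xgetPex _ _ [set P | prop F P]); exists P.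
pose I S : R -> 'M[R]_(m, d) := pr (fun s => B s *m S s).
have I0 S : continuous S -> I S 0 = 0 by move=> /cBS/prP[].
have ID S : continuous S -> forall t : R, 0 <= t <= 1 -> is_derive t 1 (I S) (B t *m S t).
  by move=> /cBS/prP[].
have IB S S' c : continuous S -> continuous S' -> (forall t, `|S t - S' t| <= c) ->
    forall t : R, 0 <= t <= 1 -> `|I S t - I S' t| <= 2^-1 * c.
  move=> cS cS' Sc t t01.
  have dd (u : R) : 0 <= u <= 1 -> is_derive u 1 (I S - I S') (B u *m S u - B u *m S' u).
    by move=> u01; exact: is_deriveB (ID _ cS u u01) (ID _ cS' u u01).
  have := @mx_mvt0 _ _ _ _ _ (2^-1 * c) dd _ t t01.
  rewrite !fctE I0 // I0 // subrr subr0; apply => u u01.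
  by rewrite -mulmxBr (le_trans (HB _ _)) // ler_wpM2l // invr_ge0.
have cI S : continuous S -> continuous (fun t => Y0 + I S (clamp t)).
  move=> cS t; suff H : {for t, continuous (I S \o clamp)}.
    have H' : {for t, continuous (cst Y0 + (I S \o clamp))}.
      by apply: continuousD H; exact: cst_continuous.
    exact: H'.
  apply: continuous_comp; first exact: clamp_continuous.
  have [dI _] := ID S cS (clamp t) (clamp01 t).
  exact/differentiable_continuous/derivable1_diffP.
pose S n : R -> 'M[R]_(m, d) := iter n (fun S t => Y0 + I S (clamp t)) (cst Y0).
have cS n : continuous (S n).
  by case: n => [|n]; [exact: cst_continuous|elim: n => [|n IH]; apply: cI => //; exact: cst_continuous].
have z01 : 0 <= (0 : R) <= 1 by rewrite lexx ler01.
have HS n t : `|S n.+1 t - S n t| <= `|Y0| / 2 ^+ n.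
  elim: n t => [|n IH] t.
    rewrite /= addrC addKr expr0 divr1.
    have := @mx_mvt0 _ _ _ _ _ (`|Y0|) (ID _ (cS 0)) _ _ (clamp01 t).
    rewrite I0; last exact: (cS 0).
    rewrite subr0; apply => u u01; apply: le_trans (HB _ _) _.
    by rewrite ler_piMl // invf_le1 // ler1n.
  rewrite [S n.+2 t](_ : _ = Y0 + I (S n.+1) (clamp t)) //.
  rewrite [S n.+1 t](_ : _ = Y0 + I (S n) (clamp t)) //.
  rewrite opprD addrACA subrr add0r.
  apply: le_trans (IB _ _ (`|Y0| / 2 ^+ n) _ _ _ _ (clamp01 t)) _ => //.
  by rewrite exprS invfM mulrCA.
have [L HL] := choice (fun t => geometric_cvg (fun n => HS n t)).
have cL : continuous L.
  move=> t; apply/continuous_epsP => e e0.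
  have [n Hn] : exists n, 2 * `|Y0| / 2 ^+ n <= e / 3.
    apply: contrapT => /forallNP Hn; suff : e / 3 <= 0 by lra.
    apply: (@le0_geometric _ (2 * `|Y0|)) => n; apply: ltW; rewrite ltNge.
    exact/negP/Hn.
  have e3 : 0 < e / 3 by lra.
  have /continuous_epsP /(_ _ e3) [del del0 Hd] := cS n t.
  exists del => // s /Hd Hs.
  rewrite (_ : L t - L s = (L t - S n t) + (S n t - S n s) - (L s - S n s)); last first.
    by rewrite subrKA opprB subrKA.
  have H1 := le_trans (HL t n) Hn; have H2 := le_trans (HL s n) Hn.
  apply: le_trans (ler_normB _ _) _.
  apply: le_trans (lerD (ler_normD _ _) (lexx _)) _; lra.
have LE t : L t = Y0 + I L (clamp t).
  apply/eqP; rewrite -subr_eq0 -normr_le0.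
  apply: (@le0_geometric _ (2 * `|Y0|)) => n.
  have H1 := HL t n.+1.
  have cn : forall t, `|S n t - L t| <= 2 * `|Y0| / 2 ^+ n.
    by move=> u; rewrite distrC; exact: HL.
  have H2 := IB _ _ _ (cS n) cL cn _ (clamp01 t).
  rewrite (_ : L t - _ = (L t - S n.+1 t) + (I (S n) (clamp t) - I L (clamp t))); last first.
    by rewrite [S n.+1 t](_ : _ = Y0 + I (S n) (clamp t)) // !opprD !addrA subrK.
  apply: le_trans (ler_normD _ _) _; apply: le_trans (lerD H1 H2) _.
  rewrite exprS invfM; set a := (2 ^+ n)^-1; rewrite le_eqVlt; apply/orP; left.
  by apply/eqP; field.
(* The limit [L] is constant outside [[0, 1]] and may have corners at the end points; without
   [clamp] the same formula has two-sided derivatives there. *)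
exists (fun t => Y0 + I L t); split; first by rewrite I0 // addr0.
move=> t t01; have H : is_derive t 1 (cst Y0 + I L) (0 + B t *m L t).
  apply: is_deriveD; exact: ID.
by rewrite add0r LE clamp_id in H.
Qed.

End LinearODE2.

(** * Integrable linear systems *)

Lemma is_derive_eps (R : realType) (V W : normedModType R) (f : V -> W)
    (x v : V) (l : W) :
  (forall e : R, 0 < e -> exists2 d : R, 0 < d & forall h : R, `|h| < d ->
     `|f (h *: v + x) - f x - h *: l| <= e * `|h|) ->
  is_derive x v f l.
Proof.
move=> H.
have c : h^-1 *: ((f \o shift x) (h *: v) - f x) @[h --> 0^'] --> l.
  apply/cvgrPdist_le => e e0; have [d d0 Hd] := H e e0.
  near=> h.
  have h0 : h != 0 by near: h; exact: nbhs_dnbhs_neq.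
  have hd : `|h| < d by near: h; exact: dnbhs0_lt.
  rewrite /= distrC (_ : _ - l = h^-1 *: (f (h *: v + x) - f x - h *: l)); last first.
    by rewrite [RHS]scalerBr scalerA mulVf // scale1r.
  by rewrite normrZ normfV ler_pdivrMl ?normr_gt0 // mulrC Hd.
split; first by apply/cvg_ex; exists l.
exact: cvg_lim c.
Unshelve. all: by end_near. Qed.

(** The form in which the comparison of neighbouring rays delivers a partial derivative: a remainder
    of second order in the displacement. *)
Lemma is_derive_quadratic (R : realType) (V W : normedModType R) (f : V -> W)
    (x v : V) (l : W) (C d : R) : 0 < d ->
  (forall h : R, `|h| < d -> `|f (h *: v + x) - f x - h *: l| <= C * `|h| ^+ 2) ->
  is_derive x v f l.
Proof.
move=> d0 H; apply: is_derive_eps => e e0.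
have C0 : 0 < `|C| + 1 by rewrite ltr_wpDl.
exists (Num.min d (e / (`|C| + 1))) => [|h]; first by rewrite lt_min d0 divr_gt0.
rewrite lt_min => /andP[hd]; rewrite ltr_pdivlMr // => he.
apply: le_trans (H h hd) _; rewrite expr2 mulrA ler_wpM2r //.
apply: le_trans (ltW he); rewrite mulrC ler_wpM2l //.
by rewrite (le_trans (ler_norm _)) // lerDl.
Qed.

Lemma pd_lipschitz (R : realType) (N m n : nat) (x0 : 'rV[R]_N) (r K : R)
    (F : 'rV[R]_N -> 'M[R]_(m, n)) (j : 'I_N) :
  smooth_on (ball x0 r) F ->
  (forall z, ball x0 r z -> `|pd j F z| <= K) ->
  forall z s, ball x0 r z -> ball x0 r (s *: delta_mx 0 j + z) ->
  `|F (s *: delta_mx 0 j + z) - F z| <= K * `|s|.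
Proof.
move=> sF HK z s bz bs.
have K0 : 0 <= K by apply: le_trans (normr_ge0 _) (HK z bz).
have b t : 0 <= t <= 1 -> ball x0 r ((t * s) *: delta_mx 0 j + z).
  by move=> t01; have := ball_segment t01 bz bs; rewrite addrK scalerA.
have oU : open (ball x0 r) by exact: ball_open.
have sF' := (smooth_mxP F oU).1 sF.
apply: mx_norm_le => [|a c]; first exact: mulr_ge0.
have [t t01|t t01 E] := @line_mvt R N (fun x => F x a c) z j s.
  by apply: smooth_derivable (sF' a c) _; exact: b.
rewrite !mxE E normrM mulrC ler_wpM2r //.
rewrite pd_entry; last by apply: smooth_derivable sF _; exact: b.
by apply: le_trans (normr_entry _ _ _) (HK _ (b t t01)).
Qed.

(** The mean value theorem replaces the increment by a derivative at an intermediate point, and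
    [pd_lipschitz] compares that with the derivative at [z]; the sharper factor 1/2 of Taylor's
    formula is given up. *)
Lemma pd_taylor (R : realType) (N m n : nat) (x0 : 'rV[R]_N) (r K : R)
    (F : 'rV[R]_N -> 'M[R]_(m, n)) (j : 'I_N) :
  smooth_on (ball x0 r) F ->
  (forall z, ball x0 r z -> `|pd j (pd j F) z| <= K) ->
  forall z s, ball x0 r z -> ball x0 r (s *: delta_mx 0 j + z) ->
  `|F (s *: delta_mx 0 j + z) - F z - s *: pd j F z| <= K * `|s| ^+ 2.
Proof.
move=> sF HK z s bz bs.
have K0 : 0 <= K by apply: le_trans (normr_ge0 _) (HK z bz).
have b t : 0 <= t <= 1 -> ball x0 r ((t * s) *: delta_mx 0 j + z).
  by move=> t01; have := ball_segment t01 bz bs; rewrite addrK scalerA.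
have oU : open (ball x0 r) by exact: ball_open.
have sF' := (smooth_mxP F oU).1 sF.
have pdE a c y : ball x0 r y -> pd j (fun x => F x a c) y = pd j F y a c.
  by move=> by_; apply: pd_entry; exact: smooth_derivable sF _.
apply: mx_norm_le => [|a c]; first by rewrite mulr_ge0 // exprn_ge0.
have [t t01|t t01 E] := @line_mvt R N (fun x => F x a c) z j s.
  by apply: smooth_derivable (sF' a c) _; exact: b.
have bt := b t t01.
rewrite !mxE E (pdE a c _ bt) -mulrBr normrM mulrC expr2 mulrA ler_wpM2r //.
have := pd_lipschitz (smooth_pd j sF) HK bz bt => H.
have := le_trans (normr_entry _ a c) H; rewrite !mxE => {}H.
apply: le_trans H _; rewrite ler_wpM2l // normrM ler_piMl //.
by case/andP: t01 => t0 t1; rewrite ger0_norm.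
Qed.

(* The algebra behind the estimate of [pfaff_core]: [y], [y'] are the solutions
   along two neighbouring rays, [B] the coefficient of the first one. *)
Lemma pfaff_identity (R : comPzRingType) m d (B S2 S3 S4 Aj Aj' : 'M[R]_m)
    (y y' : 'M[R]_(m, d)) (h t : R) :
  S3 + Aj *m B = S4 + B *m Aj ->
  (S2 + h *: Aj') *m y' - B *m y -
    (h *: (Aj *m y) + (t * h) *: (S3 *m y + Aj *m (B *m y))) =
  B *m (y' - y - (t * h) *: (Aj *m y)) +
  ((S2 - B - (t * h) *: S4) *m y' + (t * h) *: (S4 *m (y' - y)) +
   h *: ((Aj' - Aj) *m y') + h *: (Aj *m (y' - y))).
Proof.
move=> E; rewrite mulmxA -mulmxDl E mulmxDl.
rewrite !mulmxBr !mulmxBl !mulmxDl -!scalemxAl -!scalemxAr -!mulmxA.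
move: (B *m y') (B *m y) (B *m (Aj *m y)) (S2 *m y') (S4 *m y') (S4 *m y)
  (Aj' *m y') (Aj *m y') (Aj *m y) => p1 p2 p3 p4 p5 p6 p7 p8 p9.
by apply/matrixP => a b; rewrite !mxE; ring.
Qed.

Lemma normr_sum_scale (R : realType) (N m n : nat) (u : 'rV[R]_N)
    (A : 'I_N -> 'M[R]_(m, n)) (r K : R) : 0 <= K ->
  `|u| <= r -> (forall i, `|A i| <= K) ->
  `|\sum_i u 0 i *: A i| <= N%:R * (r * K).
Proof.
move=> K0 ur HA; apply: le_trans (ler_norm_sum _ _ _) _.
apply: (@le_trans _ _ (\sum_(i < N) r * K)); last first.
  by rewrite sumr_const card_ord mulr_natl.
apply: ler_sum => i _; rewrite normrZ ler_pM //.
by apply: le_trans ur; exact: normr_entry.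
Qed.

Lemma normr_mulmx_le (R : realDomainType) m n p (A : 'M[R]_(m, n))
    (B : 'M[R]_(n, p)) (a b : R) :
  `|A| <= a -> `|B| <= b -> `|A *m B| <= n%:R * (a * b).
Proof.
move=> Aa Bb; apply: le_trans (normr_mulmx _ _) _; rewrite -mulrA.
by rewrite ler_wpM2l ?ler0n // ler_pM.
Qed.

(** * Integrating a compatible linear system along rays *)

Section PfaffCore.
Context {R : realType} {N m : nat}.
Variables (x0 : 'rV[R]_N) (r K : R) (A : 'I_N -> 'rV[R]_N -> 'M[R]_m).
Let U := ball x0 r.
Hypothesis r0 : 0 < r.
Hypothesis K0 : 0 <= K.
Hypothesis sA : forall i, smooth_on U (A i).
Hypothesis b0 : forall i z, U z -> `|A i z| <= K.
Hypothesis b1 : forall i j z, U z -> `|pd j (A i) z| <= K.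
Hypothesis b2 : forall i j z, U z -> `|pd j (pd j (A i)) z| <= K.
Hypothesis small : m%:R * (N%:R * (r * K)) <= 2^-1.
Hypothesis flat : forall i j z, U z ->
  pd i (A j) z + A j z *m A i z = pd j (A i) z + A i z *m A j z.

Let oU : open U. Proof. exact: ball_open. Qed.
Let Ux0 : U x0. Proof. exact: ballxx. Qed.

Let ray (x : 'rV[R]_N) (t : R) := t *: (x - x0) + x0.

Let ray_in x (t : R) : U x -> 0 <= t <= 1 -> U (ray x t).
Proof. by move=> Ux t01; exact: ball_segment. Qed.

(** Coefficient of the equation restricted to the ray from [x0] to [x]. [clamp] freezes it outside
    [[0, 1]], where the ray could leave the ball, so that it is continuous and bounded on the whole
    line. *)
Let B (x : 'rV[R]_N) (t : R) : 'M[R]_m :=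
  \sum_i (x - x0) 0 i *: A i (ray x (clamp t)).

Let diff_le x : U x -> `|x - x0| <= r.
Proof. by rewrite /U -ball_normE /= distrC => /ltW. Qed.

Let ray_derive x (t : R) : is_derive t 1 (ray x) (x - x0).
Proof.
have d1 : derivable (fun y : 'rV[R]_N => y) (t *: (x - x0) + x0) (x - x0).
  exact: derivable_id.
by have := is_derive_line d1; rewrite derive_id.
Qed.

Let B_continuous x : U x -> continuous (B x).
Proof.
move=> Ux t; apply: continuous_sumf => i.
have cAr : {for t, continuous (A i \o (ray x \o clamp))}.
  apply: continuous_comp; last first.
    by apply: smooth_cont (sA i) _; apply: ray_in => //; exact: clamp01.
  apply: continuous_comp; first exact: clamp_continuous.
  have [dr _] := ray_derive x (clamp t).
  exact/differentiable_continuous/derivable1_diffP.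
apply/continuous_mxP => a c.
rewrite (_ : (fun y => _) =
  (cst ((x - x0) 0 i)) * (fun y => (A i \o (ray x \o clamp)) y a c)); last first.
  by apply/funext => y; rewrite mxE.
apply: continuousM; first exact: cst_continuous.
exact: (continuous_mxP _ _).1 cAr a c.
Qed.

Let T1 := N%:R * (r * K).
Let T1_ge0 : 0 <= T1. Proof. by rewrite !mulr_ge0 // ltW. Qed.

(** A matrix product costs a factor [m] in the sup norm; [small] is tuned so that the total is at
    most one half. *)
Let B_bound d x t (Z : 'M[R]_(m, d)) : U x -> `|B x t *m Z| <= 2^-1 * `|Z|.
Proof.
move=> Ux; have Ur := ray_in Ux (clamp01 t).
have H : `|B x t| <= T1.
  by apply: normr_sum_scale => [||i]; [exact: K0|exact: diff_le|exact: b0].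
apply: le_trans (normr_mulmx_le H (lexx _)) _.
by rewrite mulrA ler_wpM2r.
Qed.

Let ray_shift (x : 'rV[R]_N) j (h t : R) :
  ray (h *: delta_mx 0 j + x) t = (t * h) *: delta_mx 0 j + ray x t.
Proof. by rewrite /ray -addrA scalerDr scalerA addrA. Qed.

(** Moving the end point by [h] in direction [j] has two effects: the point at time [t] moves by
    [t h], and the velocity gains [h] in direction [j], which contributes the extra term with
    [A j]. *)
Let B_shift (x : 'rV[R]_N) j (h t : R) : 0 <= t <= 1 ->
  B (h *: delta_mx 0 j + x) t =
  \sum_i (x - x0) 0 i *: A i ((t * h) *: delta_mx 0 j + ray x t) +
  h *: A j ((t * h) *: delta_mx 0 j + ray x t).
Proof.
move=> t01; rewrite /B clamp_id // ray_shift.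
rewrite (eq_bigr (fun i => (x - x0) 0 i *: A i ((t * h) *: delta_mx 0 j + ray x t) +
   (h * (i == j)%:R) *: A i ((t * h) *: delta_mx 0 j + ray x t))).
  rewrite big_split /=; congr (_ + _).
  rewrite (bigD1 j) //= eqxx mulr1 big1 ?addr0 // => i ij.
  by rewrite (negbTE ij) mulr0 scale0r.
by move=> i _; rewrite -scalerDl !mxE /=; congr (_ *: _); ring.
Qed.

(** [Y x] is the value at time 1 of the solution [y x] along the ray to [x]. The variation of [y] in
    direction [j] should be [t h A_j y] to first order; compatibility makes the defect solve the
    same linear equation up to an error of order [h^2], so that by Gronwall it is itself of that
    order. *)
Lemma pfaff_core d (Y0 : 'M[R]_(m, d)) :
  exists Y : 'rV[R]_N -> 'M[R]_(m, d), Y x0 = Y0 /\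
    forall x, U x -> {for x, continuous Y} /\
    forall j, is_derive x (delta_mx 0 j) Y (A j x *m Y x).
Proof.
have H x : exists y : R -> 'M[R]_(m, d), U x -> y 0 = Y0 /\
    forall t : R, 0 <= t <= 1 -> is_derive t 1 y (B x t *m y t).
  have [Ux|nUx] := pselect (U x); last by exists (fun=> 0).
  have [y Hy] := linear_ode Y0 (B_continuous Ux) (fun t Z => @B_bound d x t Z Ux).
  by exists y.
have [y Hy] := choice H.
have y0 x : U x -> y x 0 = Y0 by move=> /Hy[].
have yD x : U x -> forall t : R, 0 <= t <= 1 -> is_derive t 1 (y x) (B x t *m y x t).
  by move=> /Hy[].
have z01 : 0 <= (0 : R) <= 1 by rewrite lexx ler01.
have o01 : 0 <= (1 : R) <= 1 by rewrite lexx ler01.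
pose M := 2 * (`|Y0| + 0).
have M0 : 0 <= M by rewrite /M addr0 mulr_ge0.
have yM x t : U x -> 0 <= t <= 1 -> `|y x t| <= M.
  move=> Ux t01; rewrite /M -(y0 x Ux).
  apply: (half_gronwall (yD x Ux)) t01 => u u01.
  by rewrite addr0 B_bound.
(* Lipschitz constant of the solutions in the end point: [T1] accounts for the displaced points of
   the ray, [K] for its changed velocity, and [M] bounds the solutions. *)
pose C2 := 2 * (0 + m%:R * ((T1 + K) * M)).
have C20 : 0 <= C2 by rewrite /C2 add0r !mulr_ge0 // addr_ge0.
pose F x x' t := y x' t - y x t.
have FD x x' : U x -> U x' -> forall t : R, 0 <= t <= 1 ->
    is_derive t 1 (F x x') (B x' t *m y x' t - B x t *m y x t).
  by move=> Ux Ux' t t01; exact: is_deriveB (yD x' Ux' t t01) (yD x Ux t t01).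
have F0 x x' : U x -> U x' -> F x x' 0 = 0.
  by move=> Ux Ux'; rewrite /F !y0 // subrr.
have th_le (t h : R) : 0 <= t <= 1 -> `|t * h| <= `|h|.
  by move=> /andP[t0 t1]; rewrite normrM ler_piMl // ger0_norm.
have shift_in x j h t : U x -> U (h *: delta_mx 0 j + x) -> 0 <= t <= 1 ->
    U ((t * h) *: delta_mx 0 j + ray x t).
  by move=> Ux Ux' t01; rewrite -ray_shift; exact: ray_in.
have AK x j h t i : U x -> U (h *: delta_mx 0 j + x) -> 0 <= t <= 1 ->
    `|A i ((t * h) *: delta_mx 0 j + ray x t) - A i (ray x t)| <= K * `|h|.
  move=> Ux Ux' t01.
  have Ur := ray_in Ux t01; have Ur' := shift_in x j h t Ux Ux' t01.
  apply: le_trans (pd_lipschitz (sA i) (fun z Uz => b1 i j Uz) Ur Ur') _.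
  by rewrite ler_wpM2l // th_le.
have SB x j h t : U x -> U (h *: delta_mx 0 j + x) -> 0 <= t <= 1 ->
    `|\sum_i (x - x0) 0 i *: A i ((t * h) *: delta_mx 0 j + ray x t) - B x t|
    <= N%:R * (r * (K * `|h|)).
  move=> Ux Ux' t01; rewrite /B clamp_id // -sumrB.
  rewrite (eq_bigr (fun i => (x - x0) 0 i *: (A i ((t * h) *: delta_mx 0 j + ray x t) -
    A i (ray x t)))); last by move=> i _; rewrite scalerBr.
  apply: normr_sum_scale => [||i]; first by rewrite mulr_ge0.
    exact: diff_le.
  exact: AK.
have FL x j h t : U x -> U (h *: delta_mx 0 j + x) -> 0 <= t <= 1 ->
    `|F x (h *: delta_mx 0 j + x) t| <= C2 * `|h|.
  move=> Ux Ux' t01.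
  have G := @half_gronwall R _ _ _ _ (m%:R * ((T1 + K) * M) * `|h|) (FD _ _ Ux Ux') _ t t01.
  rewrite F0 // normr0 in G; rewrite (_ : C2 * `|h| = 2 * (0 + m%:R * ((T1 + K) * M) * `|h|)); last first.
    by rewrite /C2; ring.
  apply: G => u u01.
  rewrite (_ : B _ u *m _ - _ = B x u *m F x (h *: delta_mx 0 j + x) u +
     (B (h *: delta_mx 0 j + x) u - B x u) *m y (h *: delta_mx 0 j + x) u); last first.
    by rewrite /F mulmxBr mulmxBl [RHS]addrC subrKA.
  apply: le_trans (ler_normD _ _) _; apply: lerD; first exact: B_bound.
  have BB : `|B (h *: delta_mx 0 j + x) u - B x u| <= (T1 + K) * `|h|.
    rewrite B_shift // addrAC; apply: le_trans (ler_normD _ _) _.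
    rewrite mulrDl; apply: lerD.
      by apply: le_trans (SB x j h u Ux Ux' u01) _; rewrite /T1 !mulrA.
    by rewrite normrZ mulrC ler_wpM2r // b0 //; exact: shift_in.
  apply: le_trans (normr_mulmx_le BB (yM _ u Ux' u01)) _.
  by rewrite le_eqVlt; apply/orP; left; apply/eqP; ring.
(* One summand for each of the four error terms of [pfaff_identity], in the same order: the Taylor
   remainder of the coefficient, [S4] applied to the difference of solutions, the change of [A j],
   and [A j] applied to that difference. *)
pose C3 := m%:R * (T1 * M) + m%:R * (T1 * C2) + m%:R * (K * M) + m%:R * (K * C2).
have key x j h : U x -> U (h *: delta_mx 0 j + x) ->
    `|y (h *: delta_mx 0 j + x) 1 - y x 1 - h *: (A j x *m y x 1)| <= 2 * C3 * `|h| ^+ 2.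
  move=> Ux Ux'; set x' := h *: delta_mx 0 j + x.
  pose S3 t := \sum_i (x - x0) 0 i *: pd i (A j) (ray x t).
  pose S4 t := \sum_i (x - x0) 0 i *: pd j (A i) (ray x t).
  pose S2 t := \sum_i (x - x0) 0 i *: A i ((t * h) *: delta_mx 0 j + ray x t).
  pose Aj t := A j (ray x t).
  pose Aj' t := A j ((t * h) *: delta_mx 0 j + ray x t).
  (* The defect from the expected first-order variation; the factor [t] appears because the point at
     time [t] moves only by [t h]. *)
  pose D t := F x x' t - (t * h) *: (Aj t *m y x t).
  have DD (t : R) : 0 <= t <= 1 -> is_derive t 1 D (B x' t *m y x' t - B x t *m y x t -
     (h *: (Aj t *m y x t) + (t * h) *: (S3 t *m y x t + Aj t *m (B x t *m y x t)))).
    move=> t01; apply: is_deriveB; first exact: FD.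
    apply: is_derive_scalef.
      have E := is_deriveM (@is_derive_id R R t 1) (@is_derive_cst R R R h t 1).
      by rewrite scaler0 add0r [_ *: _]mulr1 in E.
    apply: is_derive_mulmx; last exact: yD.
    have [dr drE] := ray_derive x t.
    have := is_derive_chain_mx oU (sA j) (ray_in Ux t01) dr.
    by rewrite drE.
  (* The compatibility condition contracted with [x - x0]; [S3] is the derivative of [A j] along the
     ray. *)
  have S34 t : 0 <= t <= 1 -> S3 t + Aj t *m B x t = S4 t + B x t *m Aj t.
    move=> t01; rewrite /B clamp_id; last exact: t01.
    rewrite mulmx_sumr mulmx_suml -!big_split /=.
    apply: eq_bigr => i _; rewrite -scalemxAr -scalemxAl -!scalerDr flat; first by [].
    exact: ray_in.
  have Dle (t : R) : 0 <= t <= 1 ->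
    `|B x' t *m y x' t - B x t *m y x t -
     (h *: (Aj t *m y x t) + (t * h) *: (S3 t *m y x t + Aj t *m (B x t *m y x t)))|
     <= 2^-1 * `|D t| + C3 * `|h| ^+ 2.
    move=> t01; rewrite [B x' t]B_shift // (pfaff_identity _ _ _ _ _ _ (S34 t t01)).
    apply: le_trans (ler_normD _ _) _; apply: lerD; first exact: B_bound.
    rewrite /C3 !mulrDl.
    have Ur := ray_in Ux t01; have Ur' := shift_in x j h t Ux Ux' t01.
    have yM' := yM x' t Ux' t01.
    have F' := FL x j h t Ux Ux' t01.
    have S4K : `|S4 t| <= T1.
      by apply: normr_sum_scale => [||i]; [exact: K0|exact: diff_le|exact: b1].
    apply: le_trans (ler_normD _ _) _; apply: lerD; last first.
      rewrite normrZ mulrC (_ : _ * `|h| ^+ 2 = (m%:R * (K * (C2 * `|h|))) * `|h|); last by ring.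
      rewrite ler_wpM2r //; exact: normr_mulmx_le (b0 j Ur) F'.
    apply: le_trans (ler_normD _ _) _; apply: lerD; last first.
      rewrite normrZ mulrC (_ : _ * `|h| ^+ 2 = (m%:R * ((K * `|h|) * M)) * `|h|); last by ring.
      rewrite ler_wpM2r //; exact: normr_mulmx_le (AK x j h t j Ux Ux' t01) yM'.
    apply: le_trans (ler_normD _ _) _; apply: lerD; last first.
      rewrite normrZ mulrC (_ : _ * `|h| ^+ 2 = (m%:R * (T1 * (C2 * `|h|))) * `|h|); last by ring.
      apply: ler_pM => //; last exact: th_le.
      exact: normr_mulmx_le S4K F'.
    rewrite (_ : _ * `|h| ^+ 2 = m%:R * ((N%:R * (r * (K * `|h| ^+ 2))) * M)); last first.
      by rewrite /T1; ring.
    apply: normr_mulmx_le yM'.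
    rewrite /S2 /B clamp_id // scaler_sumr -!sumrB.
    rewrite (eq_bigr (fun i => (x - x0) 0 i *: (A i ((t * h) *: delta_mx 0 j + ray x t) -
      A i (ray x t) - (t * h) *: pd j (A i) (ray x t)))); last first.
      by move=> i _; rewrite !scalerBr !scalerA [_ * (t * h)]mulrC.
    apply: normr_sum_scale => [||i]; first by rewrite mulr_ge0 // exprn_ge0.
      exact: diff_le.
    apply: le_trans (pd_taylor (sA i) (fun z Uz => b2 i j Uz) Ur Ur') _.
    by rewrite ler_wpM2l // lerXn2r ?nnegrE // th_le.
  have := half_gronwall DD Dle o01.
  have -> : D 0 = 0 by rewrite /D F0 // mul0r scale0r subr0.
  have -> : D 1 = y x' 1 - y x 1 - h *: (A j x *m y x 1).
    by rewrite /D /F mul1r /Aj /ray scale1r subrK.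
  by rewrite normr0 add0r mulrA.
exists (fun x => y x 1); split.
  (* The ray to the centre is constant, so its coefficient vanishes and the solution keeps its
     initial value. *)
  have E := @mx_mvt0 _ _ _ _ _ 0 (yD x0 Ux0) _ 1 o01.
  apply/eqP; rewrite -(y0 x0 Ux0) -subr_eq0 -normr_le0; apply: E => t t01.
  by rewrite /B big1 ?mul0mx ?normr0 // => i _; rewrite subrr mxE scale0r.
(* Continuity is deduced from the partial derivatives, since these are uniformly bounded on the
   ball. *)
suff yd x j : U x -> is_derive x (delta_mx 0 j) (fun x => y x 1) (A j x *m y x 1).
  move=> x Ux; split => [|j]; last exact: yd.
  apply/continuous_mxP => a b.
  apply: (@bounded_pd_continuous _ _ x0 r (m%:R * (K * M))) Ux => z Uz j.
    by have [] := (is_derive_mxP _ _ _ _).1 (yd z j Uz) a b.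
  have [_] := (is_derive_mxP _ _ _ _).1 (yd z j Uz) a b; rewrite /pd => ->.
  apply: le_trans (normr_entry _ _ _) _.
  exact: normr_mulmx_le (b0 j Uz) (yM z 1 Uz o01).
move=> Ux.
have /nbhs_ballP[e /= e0 He] : nbhs x U by exact: open_nbhs_nbhs.
apply: (@is_derive_quadratic _ _ _ _ _ _ _ (2 * C3) e e0) => h he.
apply: key => //; apply: He; rewrite -ball_normE /= opprD addrC subrK normrN normrZ.
rewrite (le_lt_trans _ he) // ler_piMr //.
apply: mx_norm_le => [|a b]; first exact: ler01.
by rewrite mxE; case: (_ && _); rewrite ?normr1 ?normr0.
Qed.

End PfaffCore.

(** * The local existence theorem for compatible linear systems, and primitives of closed forms *)

Lemma is_derive_block_mx (R : realFieldType) (V : normedModType R) m1 m2 n1 n2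
    (A : V -> 'M[R]_(m1, n1)) (B : V -> 'M[R]_(m1, n2))
    (C : V -> 'M[R]_(m2, n1)) (D : V -> 'M[R]_(m2, n2)) dA dB dC dD (x v : V) :
  is_derive x v A dA -> is_derive x v B dB ->
  is_derive x v C dC -> is_derive x v D dD ->
  is_derive x v (fun y => block_mx (A y) (B y) (C y) (D y)) (block_mx dA dB dC dD).
Proof.
move=> /is_derive_mxP HA /is_derive_mxP HB /is_derive_mxP HC /is_derive_mxP HD.
apply/is_derive_mxP => i j.
have [i' ->|i' ->] := split_ordP i; have [j' ->|j' ->] := split_ordP j.
- rewrite block_mxEul (_ : (fun y => _) = fun y => A y i' j'); first exact: HA.
  by apply/funext => y; rewrite block_mxEul.
- rewrite block_mxEur (_ : (fun y => _) = fun y => B y i' j'); first exact: HB.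
  by apply/funext => y; rewrite block_mxEur.
- rewrite block_mxEdl (_ : (fun y => _) = fun y => C y i' j'); first exact: HC.
  by apply/funext => y; rewrite block_mxEdl.
- rewrite block_mxEdr (_ : (fun y => _) = fun y => D y i' j'); first exact: HD.
  by apply/funext => y; rewrite block_mxEdr.
Qed.

Section Pfaff.
Context {R : realType} {N : nat}.
Implicit Types (U : set 'rV[R]_N) (x : 'rV[R]_N).

Lemma smooth_block_mx U m1 m2 n1 n2
    (A : 'rV[R]_N -> 'M[R]_(m1, n1)) (B : 'rV[R]_N -> 'M[R]_(m1, n2))
    (C : 'rV[R]_N -> 'M[R]_(m2, n1)) (D : 'rV[R]_N -> 'M[R]_(m2, n2)) :
  open U -> smooth_on U A -> smooth_on U B -> smooth_on U C -> smooth_on U D ->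
  smooth_on U (fun y => block_mx (A y) (B y) (C y) (D y)).
Proof.
move=> oU /(smooth_mxP _ oU) HA /(smooth_mxP _ oU) HB /(smooth_mxP _ oU) HC
  /(smooth_mxP _ oU) HD; apply/(smooth_mxP _ oU) => i j.
have [i' ->|i' ->] := split_ordP i; have [j' ->|j' ->] := split_ordP j.
- by apply: (smooth_eq oU _ (HA i' j')) => x _; rewrite block_mxEul.
- by apply: (smooth_eq oU _ (HB i' j')) => x _; rewrite block_mxEur.
- by apply: (smooth_eq oU _ (HC i' j')) => x _; rewrite block_mxEdl.
- by apply: (smooth_eq oU _ (HD i' j')) => x _; rewrite block_mxEdr.
Qed.

Lemma smooth_cst_mx U m n (A : 'M[R]_(m, n)) : open U -> smooth_on U (fun=> A).
Proof.
move=> oU; apply/(smooth_mxP _ oU) => i j.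
exact: (smooth_eq oU _ (smooth_cst (A i j) oU)).
Qed.

Lemma smooth_near_bounded U (x0 : 'rV[R]_N) m n (F : 'rV[R]_N -> 'M[R]_(m, n)) (K : R) :
  open U -> U x0 -> smooth_on U F -> `|F x0| + 1 <= K ->
  \forall z \near x0, `|F z| <= K.
Proof.
move=> oU Ux0 sF FK.
have /continuous_epsP /(_ 1 ltr01) [d d0 Hd] := smooth_cont sF Ux0.
apply/nbhs_ballP; exists d => // z; rewrite -ball_normE => /Hd H.
apply: le_trans FK; rewrite -[F z](subKr (F x0)).
by apply: le_trans (ler_normB _ _) _; rewrite lerD2l.
Qed.

(** The equation expresses each partial derivative of an entry of [Y] through smooth functions and
    entries of [Y], so these generate an algebra stable under differentiation. *)
Lemma linear_pde_smooth U m d (A : 'I_N -> 'rV[R]_N -> 'M[R]_m)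
    (Y : 'rV[R]_N -> 'M[R]_(m, d)) : open U ->
  (forall i, smooth_on U (A i)) ->
  (forall x, U x -> {for x, continuous Y} /\
    forall j, is_derive x (delta_mx 0 j) Y (A j x *m Y x)) ->
  smooth_on U Y.
Proof.
move=> oU sA HY; apply/(smooth_mxP _ oU) => a b.
pose B (f : 'rV[R]_N -> R) :=
  smooth_on U f \/ exists a, exists b, f = (fun x => Y x a b).
apply: (@alg_smooth R N U B oU _ _ (fun x => Y x a b)).
- move=> f [sf|[a' [b' ->]]] x Ux.
    by split => [|i]; [exact: smooth_cont Ux|exact: smooth_derivable Ux].
  have [Yc Yd] := HY x Ux; split => [|i].
    exact: (continuous_mxP _ _).1 Yc a' b'.
  by have [] := (is_derive_mxP _ _ _ _).1 (Yd i) a' b'.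
- move=> f i [sf|[a' [b' ->]]].
    by apply: alg_base; left; exact: smooth_pd.
  apply: (@alg_eq _ _ _ _ (fun x => \sum_k A i x a' k * Y x k b')).
    move=> x Ux; have [_ Yd] := HY x Ux.
    have [_] := (is_derive_mxP _ _ _ _).1 (Yd i) a' b'.
    by rewrite /pd => ->; rewrite mxE.
  apply: alg_sum => k; apply: alg_mul; apply: alg_base.
    by left; exact: (smooth_mxP _ oU).1 (sA i) a' k.
  by right; exists k, b'.
- by apply: alg_base; right; exists a, b.
Qed.

(** The margin 1 leaves room for the bound to persist near the point by continuity. *)
Lemma finite_bound (I : finType) (F : I -> R) :
  exists2 K, 0 < K & forall i, F i + 1 <= K.
Proof.
have s0 : 0 <= \sum_i `|F i| by exact: sumr_ge0.
exists (\sum_i `|F i| + 1) => [|i]; first by rewrite ltr_wpDl.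
rewrite lerD2r (bigD1 i) //= (le_trans (ler_norm _)) // lerDl.
exact: sumr_ge0.
Qed.

(** By linearity the radius depends on the coefficients only, hence the quantification over [d] and
    [Y0] after it. *)
Theorem pfaff U (x0 : 'rV[R]_N) m (A : 'I_N -> 'rV[R]_N -> 'M[R]_m) :
  open U -> U x0 -> (forall i, smooth_on U (A i)) ->
  (forall i j x, U x ->
    pd i (A j) x + A j x *m A i x = pd j (A i) x + A i x *m A j x) ->
  exists2 r : R, 0 < r & ball x0 r `<=` U /\
    forall d (Y0 : 'M[R]_(m, d)), exists Y : 'rV[R]_N -> 'M[R]_(m, d),
      [/\ Y x0 = Y0, smooth_on (ball x0 r) Y & forall x, ball x0 r x ->
        forall j, is_derive x (delta_mx 0 j) Y (A j x *m Y x)].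
Proof.
move=> oU Ux0 sA flat.
have [K0 K0p k0] := finite_bound (fun i => `|A i x0|).
have [K1 K1p k1] := finite_bound (fun ij => `|pd ij.2 (A ij.1) x0|).
have [K2 K2p k2] := finite_bound (fun ij => `|pd ij.2 (pd ij.2 (A ij.1)) x0|).
pose K := K0 + K1 + K2.
have Kp : 0 < K by rewrite !addr_gt0.
have {}k0 i : `|A i x0| + 1 <= K.
  by apply: le_trans (k0 i) _; rewrite /K -addrA lerDl addr_ge0 // ltW.
have {}k1 i j : `|pd j (A i) x0| + 1 <= K.
  by apply: le_trans (k1 (i, j)) _; rewrite /K addrAC lerDr addr_ge0 // ltW.
have {}k2 i j : `|pd j (pd j (A i)) x0| + 1 <= K.
  by apply: le_trans (k2 (i, j)) _; rewrite /K lerDr addr_ge0 // ltW.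
have : \forall z \near x0, U z /\ forall i : 'I_N, `|A i z| <= K /\
    forall j : 'I_N, `|pd j (A i) z| <= K /\ `|pd j (pd j (A i)) z| <= K.
  apply: filterI; first exact: open_nbhs_nbhs.
  apply: (@filter_forall 'rV[R]_N 'I_N (fun (i : 'I_N) z => `|A i z| <= K /\
    forall j : 'I_N, `|pd j (A i) z| <= K /\ `|pd j (pd j (A i)) z| <= K) (nbhs x0)) => i.
  apply: filterI; first exact: (smooth_near_bounded oU Ux0 (sA i) (k0 i)).
  apply: (@filter_forall 'rV[R]_N 'I_N (fun (j : 'I_N) z =>
    `|pd j (A i) z| <= K /\ `|pd j (pd j (A i)) z| <= K) (nbhs x0)) => j.
  apply: filterI.
    exact: (smooth_near_bounded oU Ux0 (smooth_pd j (sA i)) (k1 i j)).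
  exact: (smooth_near_bounded oU Ux0 (smooth_pd j (smooth_pd j (sA i))) (k2 i j)).
move=> /nbhs_ballP[e /= e0 He].
pose c := m%:R * (N%:R * K).
have c0 : 0 <= c by rewrite !mulr_ge0 // ltW.
(* Chosen so that [r c <= 1/2]; the [+ 1] covers [c = 0]. *)
pose r := Num.min e (2 * (c + 1))^-1.
have r0 : 0 < r by rewrite lt_min e0 invr_gt0 mulr_gt0 // ltr_wpDl.
have re : ball x0 r `<=` ball x0 e.
  by apply: le_ball; rewrite ge_min lexx.
have rU : ball x0 r `<=` U by move=> z /re/He[].
exists r => //; split => // d Y0.
have small : m%:R * (N%:R * (r * K)) <= 2^-1.
  apply: (@le_trans _ _ ((2 * (c + 1))^-1 * c)).
    rewrite [leLHS](_ : _ = r * c); last by rewrite /c; ring.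
    by rewrite ler_wpM2r // ge_min lexx orbT.
  have c1 : 0 < c + 1 by rewrite ltr_wpDl.
  by rewrite invfM -mulrA ler_piMr // ler_pdivrMl // mulr1 lerDl.
have [Y [Y0E HY]] := @pfaff_core R N m x0 r K A r0 (ltW Kp)
  (fun i => smooth_sub rU (sA i))
  (fun i z bz => ((He z (re z bz)).2 i).1)
  (fun i j z bz => (((He z (re z bz)).2 i).2 j).1)
  (fun i j z bz => (((He z (re z bz)).2 i).2 j).2) small
  (fun i j z bz => flat i j z (rU z bz)) d Y0.
exists Y; split => // [|x bx j]; last by have [_] := HY x bx; exact.
apply: (@linear_pde_smooth _ _ _ A) => //; first exact: ball_open.
by move=> i; exact: smooth_sub rU (sA i).
Qed.

Lemma pd_block U m1 m2 n1 n2 (C : 'rV[R]_N -> 'M[R]_(m2, n1)) i x :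
  smooth_on U C -> U x ->
  pd i (fun y => block_mx 0 0 (C y) 0 : 'M[R]_(m1 + m2, n1 + n2)) x =
  block_mx 0 0 (pd i C x) 0.
Proof.
move=> sC Ux.
have c0 p q : is_derive x (delta_mx 0 i) (fun=> 0 : 'M[R]_(p, q)) 0.
  exact: is_derive_cst.
have H := is_derive_block_mx (c0 m1 n1) (c0 m1 n2) (smooth_is_derive i sC Ux) (c0 m2 n2).
by case: H.
Qed.

(* A primitive of [a] is the lower part of a solution of the nilpotent linear
   system with coefficients [[0, 0], [a, 0]]. *)
Theorem poincare U (x0 : 'rV[R]_N) q (a : 'I_N -> 'rV[R]_N -> 'cV[R]_q) :
  open U -> U x0 -> (forall i, smooth_on U (a i)) ->
  (forall i j x, U x -> pd i (a j) x = pd j (a i) x) ->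
  exists2 r : R, 0 < r & ball x0 r `<=` U /\
    exists b : 'rV[R]_N -> 'cV[R]_q, smooth_on (ball x0 r) b /\
      forall x, ball x0 r x -> forall i, pd i b x = a i x.
Proof.
move=> oU Ux0 sa ca.
pose A i (x : 'rV[R]_N) : 'M[R]_(1 + q) := block_mx 0 0 (a i x) 0.
have sA i : smooth_on U (A i).
  by apply: (smooth_block_mx oU) (sa i) _; exact: smooth_cst_mx.
have [i j x Ux|r r0 [rU H]] := pfaff oU Ux0 sA.
  rewrite (pd_block _ _ i (sa j) Ux) (pd_block _ _ j (sa i) Ux) ca; last exact: Ux.
  by rewrite !mulmx_block !mul0mx !mulmx0 !addr0.
exists r => //; split => //.
have ob : open (ball x0 r) by exact: ball_open.
(* The upper entry starts at 1 and has zero derivative; it stays 1, so the lower part has derivative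
   exactly [a i]. *)
have [Y [Y0 sY HY]] := H 1%N (col_mx 1%:M 0).
have dY x i : ball x0 r x -> is_derive x (delta_mx 0 i) Y (col_mx 0 (a i x *m usubmx (Y x))).
  move=> bx; have := HY x bx i.
  by rewrite -[X in _ *m X]vsubmxK mul_block_col !mul0mx !addr0.
have up x : ball x0 r x -> usubmx (Y x) = 1%:M.
  move=> bx; apply/matrixP => i j; rewrite mxE.
  rewrite (@ball_pd0_cst _ _ x0 r (fun y => Y y (lshift q i) j) _ x x0) //.
  - by rewrite Y0 col_mxEu.
  - move=> z bz k; have /is_derive_mxP /(_ (lshift q i) j) := dY z k bz.
    by rewrite col_mxEu mxE.
  - exact: ballxx.
exists (fun x => dsubmx (Y x)); split.
  apply/(smooth_mxP _ ob) => i j.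
  apply: (smooth_eq ob _ ((smooth_mxP _ ob).1 sY (rshift 1 i) j)).
  by move=> x _; rewrite mxE.
move=> x bx i.
have [] : is_derive x (delta_mx 0 i) (fun x => dsubmx (Y x)) (a i x); last by [].
apply/is_derive_mxP => k j.
have /is_derive_mxP /(_ (rshift 1 k) j) := dY x i bx.
rewrite col_mxEd up // mulmx1 (_ : (fun y => dsubmx (Y y) k j) =
  (fun y => Y y (rshift 1 k) j)) //.
by apply/funext => y; rewrite mxE.
Qed.

End Pfaff.

(** * The inverse function theorem *)

Section InverseFunction.
Context {R : realType} {N : nat}.

(** Rows are indexed by the direction of differentiation: on row vectors the differential is
    [X |-> X *m jac f x]. *)
Definition jac (f : 'rV[R]_N -> 'rV[R]_N) (x : 'rV[R]_N) : 'M[R]_N :=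
  \matrix_(i, j) pd i f x 0 j.

Lemma smooth_jac U f : open U -> smooth_on U f -> smooth_on U (jac f).
Proof.
move=> oU sf; apply/(smooth_mxP _ oU) => i j.
apply: (smooth_eq oU _ ((smooth_mxP _ oU).1 (smooth_pd i sf) 0 j)) => x _.
by rewrite mxE.
Qed.

Lemma pd_linearization (x0 : 'rV[R]_N) (r : R) (f : 'rV[R]_N -> 'rV[R]_N)
    (J : 'M[R]_N) (eps : R) : 0 <= eps ->
  smooth_on (ball x0 r) f ->
  (forall z, ball x0 r z -> forall i, `|pd i f z - row i J| <= eps) ->
  forall x y, ball x0 r x -> ball x0 r y ->
  `|f y - f x - (y - x) *m J| <= eps * N%:R * `|y - x|.
Proof.
move=> e0 sf H x y bx by_.
have ob : open (ball x0 r) by exact: ball_open.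
apply: mx_norm_le => [|i j]; first by rewrite !mulr_ge0 // ler0n.
rewrite ord1 !mxE.
have d z : ball x0 r z -> forall k, derivable (fun y => f y 0 j) z (delta_mx 0 k).
  move=> bz k; apply: smooth_derivable bz.
  exact: (smooth_mxP _ ob).1 sf 0 j.
have := @box_mvt _ _ x0 r (fun y => f y 0 j) (fun k => J k j) eps d _ x y bx by_.
rewrite (eq_bigr (fun k => (y - x) 0 k * J k j)) => [/(_ _)/le_trans|k _]; last first.
  by rewrite !mxE mulrC.
apply=> [z bz k|].
  rewrite pd_entry; last exact: smooth_derivable sf bz.
  by have := le_trans (normr_entry _ 0 j) (H z bz k); rewrite !mxE.
rewrite -mulrA ler_wpM2l //; apply: le_trans (sum_normr_entries _).
by apply: ler_sum => k _; rewrite !mxE.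
Qed.

Section Local.
Variables (x0 : 'rV[R]_N) (r : R) (f : 'rV[R]_N -> 'rV[R]_N).
Let U := ball x0 r.
Hypothesis sf : smooth_on U f.
Hypothesis near_id : forall x y, U x -> U y ->
  `|f y - f x - (y - x)| <= 2^-1 * `|y - x|.
Hypothesis jac_unit : forall x, U x -> jac f x \in unitmx.

Let oU : open U. Proof. exact: ball_open. Qed.
Let V := f @` U.

(** The triangle inequality with [near_id] absorbs half of [|y - x|]. This gives both injectivity of
    [f] and the Lipschitz bound for its inverse. *)
Let expand x y : U x -> U y -> `|y - x| <= 2 * `|f y - f x|.
Proof.
move=> Ux Uy; have := near_id Ux Uy.
have : `|y - x| <= `|f y - f x| + `|f y - f x - (y - x)|.
  by rewrite -[X in X <= _](_ : `|(f y - f x) - (f y - f x - (y - x))| = _) ?ler_normB ?subKr.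
set a := `|y - x|; set b := `|f y - f x|; set c := `|_ - _ - _|.
move: a b c => a b c; lra.
Qed.

Let f_inj x y : U x -> U y -> f x = f y -> x = y.
Proof.
move=> Ux Uy E; apply/eqP; rewrite eq_sym -subr_eq0 -normr_le0.
by have := expand Ux Uy; rewrite E subrr normr0 mulr0.
Qed.

(* The contraction [x |-> x + (y - f x)], iterated from [x1]. *)
Let surj x1 y (rho : R) : 0 < rho -> (forall x, `|x - x1| <= rho -> U x) ->
  `|y - f x1| <= rho / 2 -> exists2 x, U x & f x = y.
Proof.
move=> rho0 HU yf.
have Ux1 : U x1 by apply: HU; rewrite subrr normr0 ltW.
pose phi x := x + (y - f x).
(* The closed ball is mapped to itself: half of [rho] comes from the distance of [y] to [f x1], half
   from [near_id]. *)
have phi_in x : `|x - x1| <= rho -> `|phi x - x1| <= rho.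
  move=> xr; rewrite (_ : phi x - x1 = (y - f x1) - (f x - f x1 - (x - x1))); last first.
    by apply/matrixP => i j; rewrite /phi !mxE; ring.
  apply: le_trans (ler_normB _ _) _.
  have := near_id Ux1 (HU x xr); move: yf xr.
  set a := `|y - f x1|; set b := `|x - x1|; set c := `| _ - _ |.
  move: a b c => a b c; lra.
have phi_c x x' : `|x - x1| <= rho -> `|x' - x1| <= rho ->
    `|phi x - phi x'| <= 2^-1 * `|x - x'|.
  move=> xr xr'; rewrite (_ : phi x - phi x' = - (f x - f x' - (x - x'))).
    by rewrite normrN; apply: near_id; exact: HU.
  by apply/matrixP => i j; rewrite /phi !mxE; ring.
pose u n := iter n phi x1.
have u_in n : `|u n - x1| <= rho.
  by elim: n => [|n IH]; [rewrite subrr normr0 ltW|exact: phi_in].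
have u_c n : `|u n.+1 - u n| <= rho / 2 ^+ n.
  elim: n => [|n IH]; first by rewrite expr0 divr1; exact: u_in 1%N.
  apply: le_trans (phi_c _ _ (u_in n.+1) (u_in n)) _.
  by rewrite exprS invfM mulrCA ler_wpM2l // invr_ge0.
have [l Hl] := geometric_cvg u_c.
have l_in : `|l - x1| <= rho.
  rewrite -subr_le0; apply: (@le0_geometric _ _ (2 * rho)) => n.
  apply: le_trans (Hl n); rewrite lerBlDr -(subrKA (u n) l (- x1)).
  by apply: le_trans (ler_normD _ _) _; rewrite lerD2l.
exists l; first exact: HU.
apply/eqP; rewrite eq_sym -subr_eq0 -normr_le0.
apply: (@le0_geometric _ _ (2 * rho)) => n.
rewrite (_ : y - f l = (phi l - phi (u n)) - (l - u n.+1)); last first.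
  rewrite [u n.+1](_ : _ = phi (u n)) //; set w := phi (u n).
  by rewrite /phi; apply/matrixP => i j; rewrite !mxE; ring.
apply: le_trans (ler_normB _ _) _.
have H1 := phi_c _ _ l_in (u_in n); have H2 := Hl n; have H3 := Hl n.+1.
move: H1 H2 H3; rewrite exprS invfM.
set d := (2 ^+ n)^-1.
move: `|phi l - _| `|l - u n| `|l - u n.+1| d => a b c d; lra.
Qed.

Let V_open : open V.
Proof.
rewrite openE => _ [x1 Ux1 <-].
have /nbhs_ballP[e /= e0 He] : nbhs x1 U by exact: open_nbhs_nbhs.
(* One halving puts the closed ball of radius [e / 2] inside [U], the other is the loss in
   [surj]. *)
apply/nbhs_ballP; exists (e / 2 / 2) => [|y]; first by rewrite /= !divr_gt0.
rewrite -ball_normE /= distrC => yf.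
have [||x Ux <-] := @surj x1 y (e / 2) _ _ (ltW yf); last by exists x.
  by rewrite divr_gt0.
move=> x xe; apply: He; rewrite -ball_normE /= distrC (le_lt_trans xe) //.
by rewrite ltr_pdivrMr // ltr_pMr // ltr1n.
Qed.

Let g y := xget x0 [set x | U x /\ f x = y].

Let gP y : V y -> U (g y) /\ f (g y) = y.
Proof.
move=> [x Ux fx]; rewrite /g.
by case: xgetP => [z _ []|/(_ x) []].
Qed.

Let g_lip y y' : V y -> V y' -> `|g y' - g y| <= 2 * `|y' - y|.
Proof.
move=> /gP[Uy {2}<-] /gP[Uy' {2}<-]; exact: expand.
Qed.

(** The increment of [f] between [g y] and [g y'] is known exactly; multiplying its linearisation by
    the inverse Jacobian matrix gives the increment of [g] with an error controlled by [g_lip]. *)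
Let g_derive y i : V y ->
  is_derive y (delta_mx 0 i) g (row i (invmx (jac f (g y)))).
Proof.
move=> Vy; have [Ux fx] := gP Vy; set x := g y in Ux fx *.
set J := jac f x; have uJ : J \in unitmx by exact: jac_unit.
apply: is_derive_eps => e e0.
(* Collects [N |J^-1|] from the product with the inverse, 2 from [g_lip] and a factor [N], enlarged
   to [N + 1], from the linearisation. *)
pose c := N%:R * `|invmx J| * 2 * (N%:R + 1).
have c0 : 0 <= c by rewrite !mulr_ge0 ?ler0n // addr_ge0 // ler0n.
pose eps := e / (c + 1).
have c1 : 0 < c + 1 by rewrite ltr_wpDl.
have eps0 : 0 < eps by rewrite divr_gt0.
have : \forall z \near x, U z /\ forall i, `|pd i f z - row i J| <= eps.
  apply: filterI; first exact: open_nbhs_nbhs.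
  apply: (@filter_forall 'rV[R]_N 'I_N (fun i z => `|pd i f z - row i J| <= eps) (nbhs x)) => k.
  have /continuous_epsP /(_ _ eps0) [d' d'0 Hd] := smooth_cont (smooth_pd k sf) Ux.
  apply/nbhs_ballP; exists d' => // z; rewrite -ball_normE /= => /Hd.
  rewrite distrC (_ : pd k f x = row k J) //.
  by apply/rowP => a; rewrite !mxE.
move=> /nbhs_ballP[d /= d0 Hd].
have /nbhs_ballP[d' /= d'0 Hd'] : nbhs y V by apply: open_nbhs_nbhs; split.
exists (Num.min d' (d / 2)) => [|h]; first by rewrite lt_min d'0 divr_gt0.
rewrite lt_min => /andP[hd' hd].
have hn : `|h *: (delta_mx 0 i : 'rV[R]_N)| <= `|h|.
  rewrite normrZ ler_piMr //; apply: mx_norm_le => [|a b]; first exact: ler01.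
  by rewrite mxE; case: (_ && _); rewrite ?normr1 ?normr0.
have Vy' : V (h *: delta_mx 0 i + y).
  apply: Hd'; rewrite -ball_normE /= opprD addrC subrK normrN.
  exact: le_lt_trans hd'.
set y' := h *: delta_mx 0 i + y in Vy' *.
have [Ux' fx'] := gP Vy'; set x' := g y' in Ux' fx' *.
have xx' : `|x' - x| <= 2 * `|h|.
  apply: le_trans (g_lip Vy Vy') _; rewrite ler_wpM2l //.
  by rewrite /y' addrK.
have bx' : ball x d x'.
  rewrite -ball_normE /= distrC (le_lt_trans xx') // mulrC -ltr_pdivlMr //.
have L := pd_linearization (ltW eps0) (smooth_sub (fun z bz => (Hd z bz).1) sf)
  (fun z bz => (Hd z bz).2) (ballxx x d0) bx'.
rewrite fx fx' in L.
rewrite (_ : _ - _ - _ = - ((y' - y - (x' - x) *m J) *m invmx J)); last first.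
  by rewrite mulmxBl mulmxK // opprB /y' addrK -scalemxAl -rowE.
rewrite normrN; apply: le_trans (normr_mulmx_le L (lexx _)) _.
apply: (@le_trans _ _ (N%:R * (eps * N%:R * (2 * `|h|) * `|invmx J|))).
  rewrite ler_wpM2l ?ler0n // ler_wpM2r // ler_wpM2l // mulr_ge0 ?ler0n //.
  exact: ltW.
rewrite (_ : N%:R * _ = (N%:R * `|invmx J| * 2 * N%:R) * eps * `|h|); last by ring.
rewrite ler_wpM2r // /eps mulrCA -[leRHS]mulr1 ler_wpM2l ?(ltW e0) //.
rewrite ler_pdivrMr // mul1r.
apply: (@le_trans _ _ c); last by rewrite lerDl.
by rewrite /c ler_wpM2l ?mulr_ge0 ?ler0n // lerDl.
Qed.

(** For smoothness, the composites [h \o g] with [h] smooth on [U] are taken as generators: their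
    derivatives are sums of products of such composites, because the inverse Jacobian matrix is
    smooth on [U]. *)
Lemma local_inverse : [/\ open V, smooth_on V g & forall x, U x -> g (f x) = x].
Proof.
split; first exact: V_open; last first.
  move=> x Ux; have Vf : V (f x) by exists x.
  by have [Ug] := gP Vf; exact: f_inj.
have sJ := smooth_invmx oU jac_unit (smooth_jac oU sf).
pose B (h' : 'rV[R]_N -> R) := exists2 h : 'rV[R]_N -> R, smooth_on U h & h' = h \o g.
have pdE (h : 'rV[R]_N -> R) i y : smooth_on U h -> V y ->
    is_derive y (delta_mx 0 i) (h \o g)
      (\sum_j invmx (jac f (g y)) i j * pd j h (g y)).
  move=> sh Vy; have [dg dgE] := g_derive i Vy.
  have := is_derive_chain oU sh (gP Vy).1 dg; rewrite dgE.
  by under eq_bigr do rewrite mxE.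
apply/(smooth_mxP _ V_open) => a b.
apply: (@alg_smooth R N V B V_open).
- move=> _ [h sh ->] y Vy; split => [|i]; last by have [] := pdE h i y sh Vy.
  apply: continuous_comp; last exact: smooth_cont sh (gP Vy).1.
  apply/continuous_epsP => e e0.
  have /nbhs_ballP[d /= d0 Hd] : nbhs y V by apply: open_nbhs_nbhs; split => //; exact: V_open.
  exists (Num.min d (e / 2)) => [|y']; first by rewrite lt_min d0 divr_gt0.
  rewrite lt_min => /andP[yd ye].
  have Vy' : V y' by apply: Hd; rewrite -ball_normE.
  apply: le_trans (g_lip Vy' Vy) _.
  by rewrite mulrC -ler_pdivlMr // ltW.
- move=> _ i [h sh ->].
  apply: (@alg_eq _ _ _ _ (fun y => \sum_j invmx (jac f (g y)) i j * pd j h (g y))).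
    by move=> y Vy; have [_] := pdE h i y sh Vy.
  apply: alg_sum => j; apply: alg_mul; apply: alg_base.
    exists (fun x => invmx (jac f x) i j); last exact: erefl.
    exact: (smooth_mxP _ oU).1 sJ i j.
  by exists (pd j h); [exact: smooth_pd|exact: erefl].
- apply: alg_base; exists (fun x => x a b); last exact: erefl.
  exact: smooth_coord.
Qed.

End Local.

(** The normalisation of the Jacobian matrix at [x0] makes [f] minus the identity a contraction
    nearby; flat coordinates meet it through the initial value 1 of their frame. *)
Theorem inverse_function (U : set 'rV[R]_N) (x0 : 'rV[R]_N)
    (f : 'rV[R]_N -> 'rV[R]_N) : open U -> U x0 -> smooth_on U f ->
  jac f x0 = 1%:M -> (forall x, U x -> jac f x \in unitmx) ->
  exists2 r : R, 0 < r & [/\ ball x0 r `<=` U, open (f @` ball x0 r) &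
    exists2 g : 'rV[R]_N -> 'rV[R]_N, smooth_on (f @` ball x0 r) g &
      forall x, ball x0 r x -> g (f x) = x].
Proof.
move=> oU Ux0 sf J1 uJ.
pose eps : R := (2 * (N%:R + 1))^-1.
have N1 : 0 < N%:R + 1 :> R by rewrite ltr_wpDl // ler0n.
have eps0 : 0 < eps by rewrite invr_gt0 mulr_gt0.
have : \forall z \near x0, U z /\ forall i : 'I_N, `|pd i f z - row i 1%:M| <= eps.
  apply: filterI; first exact: open_nbhs_nbhs.
  apply: (@filter_forall 'rV[R]_N 'I_N (fun i z => `|pd i f z - row i 1%:M| <= eps) (nbhs x0)) => k.
  have /continuous_epsP /(_ _ eps0) [d' d'0 Hd] := smooth_cont (smooth_pd k sf) Ux0.
  apply/nbhs_ballP; exists d' => // z; rewrite -ball_normE /= => /Hd.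
  rewrite distrC (_ : pd k f x0 = row k 1%:M) // -J1.
  by apply/rowP => a; rewrite !mxE.
move=> /nbhs_ballP[r /= r0 Hr].
have bU : ball x0 r `<=` U by move=> z /Hr[].
have sf' := smooth_sub bU sf.
have near_id x y : ball x0 r x -> ball x0 r y ->
    `|f y - f x - (y - x)| <= 2^-1 * `|y - x|.
  move=> bx by_; rewrite -[X in _ - X]mulmx1.
  apply: le_trans (pd_linearization (ltW eps0) sf' (fun z bz => (Hr z bz).2) bx by_) _.
  by rewrite ler_wpM2r // /eps invfM -mulrA ler_piMr ?invr_ge0 // ler_pdivrMl // mulr1 lerDl.
have [oV sg gf] := local_inverse sf' near_id (fun x bx => uJ x (bU x bx)).
by exists r => //; split => //; eexists; [exact: sg|exact: gf].
Qed.

End InverseFunction.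

(** * Flat coordinates *)

Section FlatCoordinates.
Context {R : realType} {N : nat}.
Variables (U : set 'rV[R]_N) (G : 'rV[R]_N -> 'M[R]_N).
Hypothesis oU : open U.
Hypothesis sG : forall i j, smooth_on U (fun x => G x i j).
Hypothesis ndG : forall x, U x -> nondeg_sym (G x).

Definition basis_field (i : 'I_N) (x : 'rV[R]_N) : 'rV[R]_N := delta_mx 0 i.

Lemma sum_delta_row (T : 'I_N -> R) (k : 'I_N) :
  \sum_i T i * (delta_mx 0 k : 'rV[R]_N) 0 i = T k.
Proof.
rewrite (bigD1 k) //= mxE !eqxx mulr1 big1 ?addr0 // => i /negbTE ik.
by rewrite mxE ik andbF mulr0.
Qed.

Lemma nabla_basis i (Z : 'rV[R]_N -> 'rV[R]_N) x :
  nabla G (basis_field i) Z x = 'D_(delta_mx 0 i) Z x +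
    \row_l \sum_b christoffel G l i b x * Z x 0 b.
Proof.
rewrite /nabla; congr (_ + _); apply/rowP => l; rewrite !mxE.
rewrite exchange_big /=; apply: eq_bigr => b _.
by rewrite -mulr_suml sum_delta_row.
Qed.

Lemma nabla_basis_basis i k :
  nabla G (basis_field i) (basis_field k) = fun x => \row_l christoffel G l i k x.
Proof.
apply/funext => x; rewrite nabla_basis derive_cst add0r.
by apply/rowP => l; rewrite !mxE sum_delta_row.
Qed.

Lemma smooth_basis_field i : smooth_on U (basis_field i).
Proof. exact: smooth_cst_mx. Qed.

Lemma metric_pd_sym i j k x : U x ->
  pd k (fun y => G y i j) x = pd k (fun y => G y j i) x.
Proof.
move=> Ux; apply: pd_eq oU Ux _ => y Uy; have [Gs _] := ndG Uy.
by rewrite -[in LHS]Gs mxE.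
Qed.

Lemma christoffel_sym l i j x : U x -> christoffel G l i j x = christoffel G l j i x.
Proof.
move=> Ux; rewrite /christoffel; congr (_ * _); apply: eq_bigr => s _.
congr (_ * _); rewrite (metric_pd_sym s j i Ux) (metric_pd_sym i s j Ux).
by rewrite (metric_pd_sym i j s Ux) addrC [pd j _ _ + _]addrC addrC.
Qed.

Let sGm : smooth_on U G. Proof. exact/(smooth_mxP _ oU). Qed.
Let sP : smooth_on U (fun x => invmx (G x)).
Proof. by apply: smooth_invmx => // x /ndG[]. Qed.

Lemma smooth_christoffel l i j : smooth_on U (christoffel G l i j).
Proof.
apply: smoothM => //; first exact: smooth_cst.
apply: smooth_sum => // s; apply: smoothM => //.
  exact: (smooth_mxP _ oU).1 sP l s.
have sN := smoothM oU (smooth_cst (-1) oU) (smooth_pd s (sG i j)).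
have sD := smoothD oU (smoothD oU (smooth_pd i (sG s j)) (smooth_pd j (sG i s))) sN.
by apply: (smooth_eq oU _ sD) => x _; rewrite mulN1r.
Qed.

(** Arranged so that [gam i x *m Y] is the contraction [Gamma^l_ik Y_l]: the columns of a solution
    are the components of parallel 1-forms. *)
Definition gam (i : 'I_N) (x : 'rV[R]_N) : 'M[R]_N :=
  \matrix_(k, l) christoffel G l i k x.

Lemma smooth_gam i : smooth_on U (gam i).
Proof.
apply/(smooth_mxP _ oU) => k l.
by apply: (smooth_eq oU _ (smooth_christoffel l i k)) => x _; rewrite mxE.
Qed.

(** This is [nabla G = 0]. Lowering the upper index gives the Christoffel symbols of the first kind,
    whose sum over the two orders of [i] and [j] leaves only the derivative of [G_ij]. *)
Lemma pd_metric k x : U x -> pd k G x = gam k x *m G x + G x *m (gam k x)^T.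
Proof.
move=> Ux; have [Gs uG] := ndG Ux.
pose b s i := pd k (fun y => G y s i) x + pd i (fun y => G y k s) x
     - pd s (fun y => G y k i) x.
have H i j : (gam k x *m G x) i j = 2^-1 * b j i.
  transitivity (2^-1 * \sum_s (\sum_l invmx (G x) s l * G x l j) * b s i).
    rewrite mxE /christoffel.
    rewrite (eq_bigr (fun l => \sum_s 2^-1 * (invmx (G x) s l * G x l j * b s i))).
      rewrite exchange_big /= mulr_sumr; apply: eq_bigr => s _.
      by rewrite mulr_suml mulr_sumr.
    move=> l _; rewrite mxE -mulrA mulr_suml mulr_sumr; apply: eq_bigr => s _.
    have iGs : invmx (G x) l s = invmx (G x) s l by rewrite -[in LHS]Gs -trmx_inv mxE.
    by rewrite iGs /b; ring.
  congr (_ * _); rewrite (eq_bigr (fun s => b s i * (s == j)%:R)).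
    by rewrite (bigD1 j) //= eqxx mulr1 big1 ?addr0 // => s /negbTE ->; rewrite mulr0.
  move=> s _; rewrite mulrC; congr (_ * _).
  by have /matrixP /(_ s j) := mulVmx uG; rewrite !mxE.
have -> : G x *m (gam k x)^T = (gam k x *m G x)^T by rewrite trmx_mul Gs.
apply/matrixP => i j; rewrite -pd_entry; last exact: smooth_derivable sGm Ux.
rewrite mxE [X in _ + X]mxE !H /b.
rewrite (metric_pd_sym j i k Ux) (metric_pd_sym k j i Ux) (metric_pd_sym k i j Ux).
by field.
Qed.

(** Differentiate [G G^-1 = 1]. The dual metric is what pairs parallel 1-forms, and this formula
    makes those pairings constant. *)
Lemma pd_invmx_metric k x : U x ->
  pd k (fun y => invmx (G y)) x =
  - (invmx (G x) *m gam k x + (gam k x)^T *m invmx (G x)).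
Proof.
move=> Ux; have [Gs uG] := ndG Ux.
have dG := smooth_is_derive k sGm Ux; have dP := smooth_is_derive k sP Ux.
have [_ dGP] := is_derive_mulmx dG dP.
have d1 : 'D_(delta_mx 0 k) (fun y => G y *m invmx (G y)) x = 0.
  transitivity ('D_(delta_mx 0 k) (cst (1%:M : 'M[R]_N)) x); last exact: derive_cst.
  apply: near_eq_derive; apply: open_near_eq oU Ux _ => y /ndG[_ uGy].
  by rewrite mulmxV.
move/eqP: dGP; rewrite d1 eq_sym addrC addr_eq0 => /eqP /(congr1 (mulmx (invmx (G x)))).
rewrite mulKmx // => ->; rewrite pd_metric // mulmxN mulmxDl -mulmxA mulmxV // mulmx1.
by rewrite mulmxDr -mulmxA mulKmx.
Qed.

Hypothesis flatG : forall X Y Z : 'rV[R]_N -> 'rV[R]_N,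
  smooth_on U X -> smooth_on U Y -> smooth_on U Z ->
  forall x, U x -> riemann G X Y Z x = 0.

(** Vanishing of the curvature on coordinate fields, whose brackets are zero, is word for word the
    compatibility condition of the system with coefficients [gam]. *)
Lemma gam_flat i j x : U x ->
  pd i (gam j) x + gam j x *m gam i x = pd j (gam i) x + gam i x *m gam j x.
Proof.
move=> Ux; apply/matrixP => k l.
have := flatG (smooth_basis_field i) (smooth_basis_field j) (smooth_basis_field k) Ux.
rewrite /riemann !nabla_basis_basis !nabla_basis.
have -> : lie_bracket (basis_field i) (basis_field j) = fun=> 0.
  by apply/funext => y; rewrite /lie_bracket !derive_cst subrr.
have -> : nabla G (fun=> 0) (basis_field k) x = 0.
  rewrite /nabla derive0 add0r; apply/rowP => a; rewrite !mxE big1 // => b _.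
  by rewrite big1 // => c _; rewrite mxE mulr0 mul0r.
have E a b : 'D_(delta_mx 0 a) (fun y => \row_l christoffel G l b k y) x 0 l =
    pd a (gam b) x k l.
  rewrite -pd_entry; last exact: smooth_derivable (smooth_gam b) Ux.
  have s1 : smooth_on U (fun y => \row_l christoffel G l b k y).
    apply/(smooth_mxP _ oU) => a' b'.
    by apply: (smooth_eq oU _ (smooth_christoffel b' b k)) => y _; rewrite mxE.
  have H := pd_entry (F := fun y => \row_l christoffel G l b k y) 0 l
    (smooth_derivable (i := a) s1 Ux).
  transitivity (pd a (fun y => (\row_l0 christoffel G l0 b k y : 'rV[R]_N) 0 l) x).
    by symmetry; exact: H.
  by congr (pd a _ x); apply/funext => y; rewrite !mxE.
rewrite subr0 => /eqP; rewrite subr_eq0 => /eqP/rowP/(_ l).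
move: (E i j) (E j i).
move: ('D_(delta_mx 0 i) _ x) ('D_(delta_mx 0 j) _ x) => D1 D2 E1 E2.
rewrite [LHS]mxE [RHS]mxE E1 E2 => H.
rewrite [LHS]mxE [RHS]mxE.
have gE a b : (gam b x *m gam a x) k l =
    (\row_l0 \sum_c christoffel G l0 a c x * (\row_l1 christoffel G l1 b k x) 0 c) 0 l.
  by rewrite !mxE; apply: eq_bigr => c _; rewrite !mxE mulrC.
by rewrite (gE i j) (gE j i).
Qed.

(** The last clause says that the metric is pulled back from the constant matrix [G x0]; it is
    stated in the old coordinates, before any inverse of [f] exists. *)
Theorem flat_coordinates x0 : U x0 ->
  exists2 r : R, 0 < r & ball x0 r `<=` U /\
    exists f : 'rV[R]_N -> 'rV[R]_N, [/\ smooth_on (ball x0 r) f,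
      jac f x0 = 1%:M, forall x, ball x0 r x -> jac f x \in unitmx &
      forall x, ball x0 r x -> G x = jac f x *m G x0 *m (jac f x)^T].
Proof.
move=> Ux0.
have [r1 r10 [b1U H1]] := pfaff oU Ux0 smooth_gam gam_flat.
have [Y [Y0 sY HY]] := H1 N 1%:M.
have ob1 : open (ball x0 r1) by exact: ball_open.
(* The candidate for the derivative of the new coordinates in the old direction [k]; symmetry of the
   Christoffel symbols makes the family closed. *)
pose a k x : 'cV[R]_N := (row k (Y x))^T.
have sa k : smooth_on (ball x0 r1) (a k).
  apply/(smooth_mxP _ ob1) => i j.
  apply: (smooth_eq ob1 _ ((smooth_mxP _ ob1).1 sY k i)) => x _.
  by rewrite !mxE.
have pda i j x : ball x0 r1 x -> pd i (a j) x = (row j (gam i x *m Y x))^T.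
  move=> bx; apply/matrixP => p q; rewrite -pd_entry; last exact: smooth_derivable (sa j) bx.
  rewrite [RHS]mxE [RHS]mxE; have [_ <-] := (is_derive_mxP _ _ _ _).1 (HY x bx i) j p.
  by congr (pd i _ x); apply/funext => y; rewrite !mxE.
have [|r r0 [bb [u [su Hu]]]] := poincare ob1 (ballxx x0 r10) sa.
  move=> i j x bx; rewrite (pda _ _ _ bx) (pda _ _ _ bx); congr (_^T); apply/rowP => p; rewrite !mxE.
  apply: eq_bigr => l _; rewrite !mxE christoffel_sym //; exact: b1U.
have ob : open (ball x0 r) by exact: ball_open.
have jacE x : ball x0 r x -> jac (fun x => (u x)^T) x = Y x.
  move=> bx; apply/matrixP => k j.
  have su' := smooth_trmx ob su.
  rewrite mxE -pd_entry; last exact: smooth_derivable su' bx.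
  rewrite (_ : (fun y => _) = (fun y => u y j 0)); last first.
    by apply/funext => y; rewrite mxE.
  rewrite pd_entry; last exact: smooth_derivable su bx.
  by rewrite Hu // !mxE.
(* The matrix of dual scalar products of the parallel 1-forms is constant, and its value is read off
   at [x0]. *)
have QE x : ball x0 r x -> (Y x)^T *m (invmx (G x) *m Y x) = invmx (G x0).
  move=> bx.
  have dQ z k : ball x0 r z ->
      is_derive z (delta_mx 0 k) (fun x => (Y x)^T *m (invmx (G x) *m Y x)) 0.
    move=> bz; have bz1 := bb z bz; have Uz := b1U z bz1.
    have dY := HY z bz1 k.
    have := is_derive_mulmx (is_derive_trmx dY)
      (is_derive_mulmx (smooth_is_derive k sP Uz) dY).
    rewrite (pd_invmx_metric k Uz); set e := (X in is_derive _ _ _ X).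
    suff -> : e = 0 by [].
    rewrite /e trmx_mul mulNmx mulmxDl -!mulmxA opprD addrAC addNr add0r.
    by rewrite mulmxN subrr.
  have -> : invmx (G x0) = (Y x0)^T *m (invmx (G x0) *m Y x0).
    by rewrite Y0 trmx1 mul1mx mulmx1.
  apply/matrixP => i j.
  apply: (@ball_pd0_cst _ _ x0 r (fun x => ((Y x)^T *m (invmx (G x) *m Y x)) i j)) => //.
    move=> z bz k; have /is_derive_mxP /(_ i j) := dQ z k bz.
    by rewrite mxE.
  exact: ballxx.
have [_ uG0] := ndG Ux0.
(* Nondegeneracy of this constant matrix already forces the frame to be invertible. *)
have uY x : ball x0 r x -> Y x \in unitmx.
  move=> bx; have := QE x bx; rewrite mulmxA => E.
  have : (Y x)^T *m invmx (G x) *m Y x \in unitmx by rewrite E unitmx_inv.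
  by rewrite unitmx_mul => /andP[].
exists r => //; split; first by move=> x /bb/b1U.
exists (fun x => (u x)^T); split.
- exact: smooth_trmx.
- by rewrite jacE //; exact: ballxx.
- by move=> x bx; rewrite jacE // uY.
move=> x bx; rewrite jacE //.
have [_ uG] := ndG (b1U x (bb x bx)).
have E : Y x *m G x0 *m (Y x)^T *m invmx (G x) *m Y x = Y x.
  by rewrite -!mulmxA QE // mulmxV // mulmx1.
have {}E : Y x *m G x0 *m (Y x)^T *m invmx (G x) = 1%:M.
  by rewrite -[LHS](mulmxK (uY x bx)) E mulmxV // uY.
by rewrite -[LHS]mul1mx -E mulmxKV.
Qed.

End FlatCoordinates.

(** * Charts *)

(* [vector.coord] shadows the chart projection. *)
Local Notation coord := Defs.coord.

Section Charts.
Context {R : realType} {N : nat}.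

Section OneChart.
Context {T : topologicalType}.
Implicit Types (c : chart R N T).

Lemma coord_at c q : dom c q -> {for q, continuous (coord c)}.
Proof.
have := @coord_cont R N T c; rewrite continuous_open_subspace; last exact: dom_open.
by move=> H dq; apply: H; rewrite inE.
Qed.

Lemma icoord_at c x : img c x -> {for x, continuous (icoord c)}.
Proof.
have := @icoord_cont R N T c; rewrite continuous_open_subspace; last exact: img_open.
by move=> H dq; apply: H; rewrite inE.
Qed.

Lemma icoord_dom c x : img c x -> dom c (icoord c x).
Proof. by move=> [q dq <-]; rewrite coordK. Qed.

Lemma icoordK c x : img c x -> coord c (icoord c x) = x.
Proof. by move=> [q dq <-]; rewrite coordK. Qed.

Lemma overlapP c c' x : overlap c c' x <-> img c x /\ dom c' (icoord c x).
Proof.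
split=> [[q [dq dq'] <-]|[ix d]].
  by rewrite coordK //; split => //; exists q.
by exists (icoord c x); [split => //; exact: icoord_dom|exact: icoordK].
Qed.

Lemma overlap_open c c' : open (overlap c c').
Proof.
rewrite openE => x /overlapP[ix d].
have H1 : nbhs x (img c) by apply: open_nbhs_nbhs; split => //; exact: img_open.
have H2 : nbhs (icoord c x) (dom c').
  by apply: open_nbhs_nbhs; split => //; exact: dom_open.
have H3 := icoord_at ix H2.
apply: (@filterS _ (nbhs x) _ (img c `&` (icoord c @^-1` dom c'))).
  by move=> y [iy dy]; apply/overlapP.
exact: filterI.
Qed.

(** The domain is cut down to the points whose old coordinates lie in [U]. The fields of the new
    chart are exported as equations, since tensor components are compared through them. *)
Lemma reparam_chart c (U : set 'rV[R]_N) (f g : 'rV[R]_N -> 'rV[R]_N) :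
  open U -> U `<=` img c -> (forall x, U x -> {for x, continuous f}) ->
  open (f @` U) -> (forall y, (f @` U) y -> {for y, continuous g}) ->
  (forall x, U x -> g (f x) = x) ->
  exists c' : chart R N T, [/\ dom c' = dom c `&` coord c @^-1` U,
    coord c' = f \o coord c, icoord c' = icoord c \o g & img c' = f @` U].
Proof.
move=> oU Uc fc oV gc gf.
have oD : open (dom c `&` coord c @^-1` U).
  rewrite openE => q [dq Uq].
  have H1 : nbhs q (dom c) by apply: open_nbhs_nbhs; split => //; exact: dom_open.
  have H2 : nbhs (coord c q) U by exact: open_nbhs_nbhs.
  have H3 := coord_at dq H2.
  exact: filterI.
have imgE : (f \o coord c) @` (dom c `&` coord c @^-1` U) = f @` U.
  apply/seteqP; split=> y.
    by move=> [q [dq Uq] <-]; exists (coord c q).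
  move=> [x Ux <-]; have ix := Uc x Ux.
  exists (icoord c x); last by rewrite /= icoordK.
  by split; [exact: icoord_dom|rewrite /= icoordK].
have oI : open ((f \o coord c) @` (dom c `&` coord c @^-1` U)) by rewrite imgE.
have K q : (dom c `&` coord c @^-1` U) q -> (icoord c \o g) ((f \o coord c) q) = q.
  by move=> [dq Uq] /=; rewrite gf // coordK.
have cc : {within dom c `&` coord c @^-1` U, continuous (f \o coord c)}.
  rewrite continuous_open_subspace // => q; rewrite inE => -[dq Uq].
  apply: continuous_comp; [exact: coord_at|exact: fc].
have ic : {within (f \o coord c) @` (dom c `&` coord c @^-1` U),
    continuous (icoord c \o g)}.
  rewrite continuous_open_subspace // imgE => y; rewrite inE => Vy.
  apply: continuous_comp; first exact: gc.
  by apply: icoord_at; have [x Ux <-] := Vy; rewrite gf //; exact: Uc.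
by exists (Chart oD oI K cc ic).
Qed.

End OneChart.

(** By maximality it is enough to compare with charts of the atlas, and there the transition maps
    are those of [c] composed with [g] on one side and [f] on the other. *)
Lemma reparam_atlas (M : manifold R N) (c : chart R N M) (U : set 'rV[R]_N)
    (f g : 'rV[R]_N -> 'rV[R]_N) : atlas c ->
  open U -> U `<=` img c -> smooth_on U f ->
  open (f @` U) -> smooth_on (f @` U) g -> (forall x, U x -> g (f x) = x) ->
  exists c' : chart R N M, atlas c' /\ [/\ dom c' = dom c `&` coord c @^-1` U,
    coord c' = f \o coord c, icoord c' = icoord c \o g & img c' = f @` U].
Proof.
move=> ac oU Uc sf oV sg gf.
have [c' [dE cE iE mE]] := reparam_chart oU Uc (fun x Ux => smooth_cont sf Ux)
  oV (fun y Vy => smooth_cont sg Vy) gf.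
exists c'; split => //; apply: atlas_maximal => c'' ac''.
have [s1 s2] := atlas_compatible ac ac''.
split.
- have H x : overlap c' c'' x -> (f @` U) x /\ overlap c c'' (g x).
    move=> /overlapP[]; rewrite mE iE => Vx d; split => //; apply/overlapP; split => //.
    by have [z Uz <-] := Vx; rewrite gf //; exact: Uc.
  have -> : change c' c'' = change c c'' \o g by rewrite /change iE.
  have sg' : smooth_on (overlap c' c'') g by apply: smooth_sub sg => x /H[].
  have H2 x : overlap c' c'' x -> overlap c c'' (g x) by move=> /H[].
  exact: (smooth_comp_mx (@overlap_open _ c' c'') (@overlap_open _ c c'') sg' H2 s1).
- have H x : overlap c'' c' x -> overlap c'' c x /\ U (change c'' c x).
    by move=> /overlapP[ix]; rewrite dE => -[d1 d2]; split => //; apply/overlapP.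
  have -> : change c'' c' = f \o change c'' c by rewrite /change cE.
  have s2' : smooth_on (overlap c'' c') (change c'' c).
    by apply: smooth_sub s2 => x /H[].
  have H2 x : overlap c'' c' x -> U (change c'' c x) by move=> /H[].
  exact: (smooth_comp_mx (@overlap_open _ c'' c') oU s2' H2 sf).
Qed.

Lemma derive_jac (U : set 'rV[R]_N) (f : 'rV[R]_N -> 'rV[R]_N) x (X : 'rV[R]_N) :
  open U -> U x -> smooth_on U f -> 'D_X f x = X *m jac f x.
Proof.
move=> oU Ux sf.
have d : derivable (fun y : 'rV[R]_N => y) x X by exact: derivable_id.
have [_] := is_derive_chain_mx oU sf Ux d; rewrite derive_id => H.
rewrite [LHS]H; apply/rowP => j; rewrite summxE mxE.
by apply: eq_bigr => i _; rewrite !mxE.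
Qed.

Lemma bform_inj (A B : 'M[R]_N) : (forall X Y, bform A X Y = bform B X Y) -> A = B.
Proof.
have H (C : 'M[R]_N) i j : bform C (delta_mx 0 i) (delta_mx 0 j) = C i j.
  by rewrite /bform -rowE trmx_delta -colE !mxE.
by move=> E; apply/matrixP => i j; rewrite -!H E.
Qed.

Lemma reparam_metric (M : manifold R N) (F : frobenius M) (c c' : chart R N M)
    (U : set 'rV[R]_N) (f : 'rV[R]_N -> 'rV[R]_N) :
  atlas c -> atlas c' -> open U -> U `<=` img c -> smooth_on U f ->
  dom c' = dom c `&` coord c @^-1` U -> coord c' = f \o coord c ->
  forall x, U x -> metric F c x = jac f x *m metric F c' (f x) *m (jac f x)^T.
Proof.
move=> ac ac' oU Uc sf dE cE x Ux.
have ix := Uc x Ux.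
have chE y : U y -> change c c' y = f y.
  by move=> Uy; rewrite /change /= cE /= icoordK //; exact: Uc.
have ov : overlap c c' x.
  by apply/overlapP; rewrite dE; split => //; split; [exact: icoord_dom|rewrite /= icoordK].
have D X : 'D_X (change c c') x = X *m jac f x.
  rewrite -(derive_jac _ oU Ux sf); apply: near_eq_derive.
  exact: open_near_eq chE.
apply: bform_inj => X Y; rewrite (metric_tensorial F ac ac' ov) !D chE //.
by rewrite /bform trmx_mul !mulmxA.
Qed.

(** With [J] the Jacobian matrix, [G = J G0 J^T] by construction and [G = J G' J^T] by tensoriality,
    where [G'] is the metric in the new chart. As [J] is invertible, [G' = G0]. *)
Lemma flat_chart (M : manifold R N) (F : frobenius M) (q : M) :
  exists c : chart R N M, [/\ atlas c, dom c q & exists G0 : 'M[R]_N,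
    nondeg_sym G0 /\ forall x, img c x -> metric F c x = G0].
Proof.
have [c ac dq] := atlas_cover q.
set x0 := coord c q; have ix0 : img c x0 by exists q.
have oI : open (img c) by exact: img_open.
have [r r0 [bI [f [sf J1 uJ GE]]]] := flat_coordinates oI (metric_smooth F ac)
  (metric_nondeg F ac) (frob_flat F ac) ix0.
have ob : open (ball x0 r) by exact: ball_open.
have [r1 r10 [bb oV [g sg gf]]] := inverse_function ob (ballxx x0 r0) sf J1 uJ.
have ob1 : open (ball x0 r1) by exact: ball_open.
have [c' [ac' [dE cE iE mE]]] := reparam_atlas ac ob1 (subset_trans bb bI)
  (smooth_sub bb sf) oV sg gf.
exists c'; split => //; first by rewrite dE; split => //; exact: ballxx.
exists (metric F c x0); split; first exact: metric_nondeg.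
rewrite mE => y [x bx <-].
have H := reparam_metric F ac ac' ob1 (subset_trans bb bI) (smooth_sub bb sf) dE cE bx.
have uJx := uJ x (bb x bx).
have uJT : (jac f x)^T \in unitmx by rewrite unitmx_tr.
move: H; rewrite (GE x (bb x bx)) => /(congr1 (mulmxr (invmx (jac f x)^T))) /=.
rewrite !mulmxK // => /(congr1 (mulmx (invmx (jac f x)))).
by rewrite !mulKmx.
Qed.

Lemma sum_delta_scale (W : lmodType R) (T : 'I_N -> W) (k : 'I_N) :
  \sum_i (delta_mx 0 k : 'rV[R]_N) 0 i *: T i = T k.
Proof.
rewrite (bigD1 k) //= mxE !eqxx scale1r big1 ?addr0 // => i /negbTE ik.
by rewrite mxE ik andbF scale0r.
Qed.

Lemma tmul_basis (C : 'I_N -> 'I_N -> 'rV[R]_N) i j :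
  tmul C (delta_mx 0 i) (delta_mx 0 j) = C i j.
Proof.
rewrite /tmul -[RHS](sum_delta_scale (fun i => C i j)); apply: eq_bigr => a _.
rewrite -[in RHS](sum_delta_scale (C a) j) scaler_sumr.
by apply: eq_bigr => b _; rewrite scalerA.
Qed.

(** Reparametrisation by the identity. Tensor components are indexed by charts, so their agreement
    on the smaller chart has to be derived from tensoriality. *)
Lemma restrict_chart (M : manifold R N) (F : frobenius M) (c : chart R N M)
    (U : set 'rV[R]_N) (q : M) : atlas c -> dom c q ->
  open U -> U `<=` img c -> U (coord c q) ->
  exists c' : chart R N M, [/\ atlas c', dom c' q, img c' = U,
    forall x, U x -> metric F c' x = metric F c x &
    forall x, U x -> forall i j, product F c' x i j = product F c x i j].
Proof.
move=> ac dq oU Uc Uq.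
have sid : smooth_on U (fun x : 'rV[R]_N => x).
  by apply/(smooth_mxP _ oU) => i j; exact: smooth_coord.
have idE : (fun x : 'rV[R]_N => x) @` U = U.
  by apply/seteqP; split => [x [y Uy <-]//|x Ux]; exists x.
have [c' [ac' [dE cE iE mE]]] := @reparam_atlas M c U (fun x => x) (fun x => x)
  ac oU Uc sid (eq_ind_r open oU idE) (eq_ind_r (fun V => smooth_on V _) sid idE)
  (fun x _ => erefl).
have chE x : U x -> change c c' x = x.
  by move=> Ux; rewrite /change cE /= icoordK //; exact: Uc.
have ov x : U x -> overlap c c' x.
  move=> Ux; have ix := Uc x Ux.
  by apply/overlapP; rewrite dE; split => //; split; [exact: icoord_dom|rewrite /= icoordK].
have D x X : U x -> 'D_X (change c c') x = X.
  move=> Ux; rewrite -[RHS](derive_id x X); apply: near_eq_derive.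
  exact: open_near_eq oU Ux chE.
exists c'; split => //; first by rewrite dE.
- by rewrite mE idE.
- move=> x Ux; apply: bform_inj => X Y.
  by rewrite (metric_tensorial F ac ac' (ov x Ux)) !D // chE.
- move=> x Ux i j; rewrite -(tmul_basis (product F c' x)) -(tmul_basis (product F c x)).
  have := product_tensorial F ac ac' (ov x Ux) (delta_mx 0 i) (delta_mx 0 j).
  by rewrite !D // chE // => ->.
Qed.

End Charts.

(** * Potentials and moving frames *)

Section Potential.
Context {R : realType} {N : nat}.
Implicit Types (U : set 'rV[R]_N).

(** Stacking the family into one column gives all members a primitive on a common ball. *)
Lemma poincare_family U (x0 : 'rV[R]_N) (I : finType)
    (a : I -> 'I_N -> 'rV[R]_N -> R) :
  open U -> U x0 -> (forall p i, smooth_on U (a p i)) ->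
  (forall p i j x, U x -> pd i (a p j) x = pd j (a p i) x) ->
  exists2 r : R, 0 < r & ball x0 r `<=` U /\
    exists b : I -> 'rV[R]_N -> R, (forall p, smooth_on (ball x0 r) (b p)) /\
      forall x, ball x0 r x -> forall p i, pd i (b p) x = a p i x.
Proof.
move=> oU Ux0 sa ca.
pose A i (x : 'rV[R]_N) : 'cV[R]_#|I| := \col_p a (enum_val p) i x.
have sA i : smooth_on U (A i).
  apply/(smooth_mxP _ oU) => p q.
  by apply: (smooth_eq oU _ (sa (enum_val p) i)) => x _; rewrite mxE.
have pA i j x p q : U x -> pd i (A j) x p q = pd i (a (enum_val p) j) x.
  move=> Ux; rewrite -pd_entry; last exact: smooth_derivable (sA j) Ux.
  by congr (pd i _ x); apply/funext => y; rewrite mxE.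
have [i j x Ux|r r0 [rU [b [sb Hb]]]] := poincare oU Ux0 sA.
  by apply/matrixP => p q; rewrite !pA //; exact: ca.
exists r => //; split => //.
have ob : open (ball x0 r) by exact: ball_open.
exists (fun p x => b x (enum_rank p) 0); split.
  by move=> p; exact: (smooth_mxP _ ob).1 sb (enum_rank p) 0.
move=> x bx p i; rewrite pd_entry; last exact: smooth_derivable sb bx.
by rewrite Hb // mxE enum_rankK.
Qed.

(** Each of the three integrations uses one symmetry: the symmetric derivative of [a], then the
    symmetry of [a] in its first two indices, then that of the second-order potentials. *)
Lemma potential_exists U (x0 : 'rV[R]_N) (a : 'I_N -> 'I_N -> 'I_N -> 'rV[R]_N -> R) :
  open U -> U x0 -> (forall i j m, smooth_on U (a i j m)) ->
  (forall i j m x, U x -> a i j m x = a j i m x) ->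
  (forall i j m x, U x -> a i j m x = a i m j x) ->
  (forall l i j m x, U x -> pd l (a i j m) x = pd i (a l j m) x) ->
  exists2 r : R, 0 < r & ball x0 r `<=` U /\
    exists Phi : 'rV[R]_N -> R, smooth_on (ball x0 r) Phi /\
      forall x, ball x0 r x -> forall i j m, pd3 Phi i j m x = a i j m x.
Proof.
move=> oU Ux0 sa a12 a23 ca.
have [|r1 r10 [r1U [B [sB HB]]]] := @poincare_family U x0 ('I_N * 'I_N)%type
  (fun p i => a i p.1 p.2) oU Ux0 (fun p i => sa i p.1 p.2).
  by move=> p i j x Ux; exact: ca.
have o1 : open (ball x0 r1) by exact: ball_open.
(* The primitives [B (j, k)] and [B (k, j)] may differ by a constant of integration; the mean is
   symmetric and has the same derivatives because of [a23]. *)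
pose B' j k x := 2^-1 * (B (j, k) x + B (k, j) x).
have sB' j k : smooth_on (ball x0 r1) (B' j k).
  apply: (smoothM o1 (smooth_cst _ o1)).
  exact: smoothD o1 (sB _) (sB _).
have B'C j k x : B' j k x = B' k j x by rewrite /B' addrC.
have pB' i j k x : ball x0 r1 x -> pd i (B' j k) x = a i j k x.
  move=> bx; have Ux := r1U x bx.
  have d1 := smooth_is_derive i (sB (j, k)) bx.
  have d2 := smooth_is_derive i (sB (k, j)) bx.
  have [_] := is_deriveM (@is_derive_cst R _ R (2^-1) x (delta_mx 0 i)) (is_deriveD d1 d2).
  rewrite /pd => H; rewrite [LHS]H scaler0 addr0 -!/(pd i _ _) !HB //= (a23 i k j) //.
  rewrite [LHS](_ : _ = 2^-1 * (a i j k x + a i j k x)) //; by field.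
have [|r2 r20 [r2U [C [sC HC]]]] := @poincare_family (ball x0 r1) x0 'I_N
  (fun k j => B' j k) o1 (ballxx x0 r10) (fun k j => sB' j k).
  by move=> k i j x bx; rewrite !pB' // a12 //; exact: r1U.
have o2 : open (ball x0 r2) by exact: ball_open.
have [|r r0 [rU [Phi [sPhi HPhi]]]] := @poincare_family (ball x0 r2) x0 unit
  (fun _ k => C k) o2 (ballxx x0 r20) (fun _ k => sC k).
  by move=> _ i j x bx; rewrite !HC.
have ob : open (ball x0 r) by exact: ball_open.
exists r => //; split; first by move=> x /rU/r2U/r1U.
exists (Phi tt); split; first exact: sPhi.
move=> x bx i j m; rewrite /pd3.
rewrite (pd_eq i ob bx (g := pd j (C m))); last first.
  by move=> y by_; apply: pd_eq ob by_ _ => z bz; exact: HPhi.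
rewrite (pd_eq i ob bx (g := B' j m)); last by move=> y by_; rewrite HC //; exact: rU.
by rewrite pB' //; exact: r2U _ (rU _ bx).
Qed.

End Potential.

(** * The moving frame and the submanifold *)

Section Frame.
Context {R : realType} {N L : nat}.
Variables (U : set 'rV[R]_N) (g eta : 'M[R]_N) (mu : 'M[R]_L) (S : 'M[R]_(N, L))
  (kappa : R) (W : 'I_N -> 'rV[R]_N -> 'M[R]_N) (x0 : 'rV[R]_N).
Hypothesis oU : open U.
Hypothesis Ux0 : U x0.
Hypothesis g_nd : nondeg_sym g.
Hypothesis etaE : eta = invmx g.
Hypothesis mu_nd : nondeg_sym mu.
Hypothesis Smu : S *m mu *m S^T = kappa *: eta.
Hypothesis sW : forall i, smooth_on U (W i).
Hypothesis W_sym : forall i x, U x -> (W i x)^T = W i x.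
Hypothesis W_swap : forall i j x, U x -> row j (W i x) = row i (W j x).
Hypothesis W_closed : forall i j x, U x -> pd i (W j) x = pd j (W i) x.
Hypothesis W_comm : forall i j x, U x ->
  W i x *m eta *m W j x = W j x *m eta *m W i x.

(** Gram matrix of the frame, with tangent block [g] and normal block [mu^-1]. Since the frame
    starts at the identity, it is also the scalar product of the ambient space. *)
Let Q : 'M[R]_(N + L) := block_mx g 0 0 (invmx mu).

(** [mu] and [eta] raise indices. The tangent block vanishes because the first fundamental form is
    constant, the normal block because the torsion is zero. *)
Let A i (x : 'rV[R]_N) : 'M[R]_(N + L) :=
  block_mx 0 (W i x *m (S *m mu)) (- S^T *m (W i x *m eta)) 0.

Let cst_smooth (V : set 'rV[R]_N) m n (M : 'M[R]_(m, n)) : open V -> smooth_on V (fun=> M : 'M[R]_(m, n)).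
Proof. exact: smooth_cst_mx. Qed.

Let sA i : smooth_on U (A i).
Proof.
apply: (smooth_block_mx oU (cst_smooth _ oU) _ _ (cst_smooth _ oU)).
  exact: smooth_mulmx oU (sW i) (cst_smooth _ oU).
exact: smooth_mulmx oU (cst_smooth _ oU) (smooth_mulmx oU (sW i) (cst_smooth _ oU)).
Qed.

Let pdA i j x : U x -> pd i (A j) x =
  block_mx 0 (pd i (W j) x *m (S *m mu)) (- S^T *m (pd i (W j) x *m eta)) 0.
Proof.
move=> Ux.
have c0 m n (M : 'M[R]_(m, n)) : is_derive x (delta_mx 0 i) (fun=> M : 'M[R]_(m, n)) 0.
  exact: is_derive_cst.
have dW := smooth_is_derive i (sW j) Ux.
have d1 := is_derive_mulmx dW (c0 _ _ (S *m mu)); rewrite mulmx0 addr0 in d1.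
have d2 := is_derive_mulmx dW (c0 _ _ eta); rewrite mulmx0 addr0 in d2.
have d3 := is_derive_mulmx (c0 _ _ (- S^T)) d2; rewrite mul0mx add0r in d3.
by have [] := is_derive_block_mx (c0 _ _ 0) d1 d3 (c0 _ _ 0).
Qed.

Let mu_sym : mu^T = mu. Proof. by case: mu_nd. Qed.
Let mu_unit : mu \in unitmx. Proof. by case: mu_nd. Qed.
Let g_sym : g^T = g. Proof. by case: g_nd. Qed.
Let g_unit : g \in unitmx. Proof. by case: g_nd. Qed.
Let eta_g : eta *m g = 1%:M. Proof. by rewrite etaE mulVmx. Qed.

(** The derivatives fill the off-diagonal blocks and agree by [W_closed] (Codazzi). The products
    fill the diagonal: the upper block is [kappa] times a commutator (Gauss), the lower one is the
    commutator between [S^T] and [S mu] (Ricci); both follow from [W_comm]. *)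
Let flatA i j x : U x ->
  pd i (A j) x + A j x *m A i x = pd j (A i) x + A i x *m A j x.
Proof.
move=> Ux; rewrite !pdA // W_closed //; congr (_ + _).
rewrite /A !mulmx_block !mul0mx !mulmx0 !addr0 !add0r.
have E a b : W a x *m (S *m mu) *m (- S^T *m (W b x *m eta)) =
    - (kappa *: (W a x *m eta *m W b x *m eta)).
  rewrite mulNmx mulmxN; congr (- _).
  by rewrite !mulmxA -[_ *m S *m mu]mulmxA -[_ *m _ *m S^T]mulmxA Smu -scalemxAr -!scalemxAl.
have E' a b : - S^T *m (W a x *m eta) *m (W b x *m (S *m mu)) =
    - S^T *m (W a x *m eta *m W b x) *m (S *m mu) by rewrite !mulmxA.
by rewrite !E !E' (W_comm j i Ux).
Qed.

Let Q_unit : Q \in unitmx.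
Proof. by rewrite /Q unitmxE det_ublock unitrM -!unitmxE g_unit unitmx_inv. Qed.

Let Q_sym : Q^T = Q.
Proof. by rewrite /Q tr_block_mx !trmx0 trmx_inv mu_sym g_sym. Qed.

Let AQE i x : A i x *m Q = block_mx 0 (W i x *m S) (- (S^T *m W i x)) 0.
Proof.
rewrite /A /Q mulmx_block !mul0mx !mulmx0 !addr0 !add0r.
by rewrite -!mulmxA eta_g mulmx1 mulmxV // mulmx1 mulNmx.
Qed.

(** [A Q] is skew-symmetric, i.e. [A] is an infinitesimal isometry of [Q]; so the Gram matrix of the
    frame is preserved. *)
Let AQ i x : U x -> Q *m (A i x)^T = - (A i x *m Q).
Proof.
move=> Ux; rewrite -{1}Q_sym -trmx_mul AQE tr_block_mx !trmx0 opp_block_mx !oppr0.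
by rewrite linearN /= !trmx_mul trmxK W_sym // opprK.
Qed.

(* [Q Y^T Q^-1] is a first integral inverse to the frame [Y]. *)
Lemma frame_exists : exists2 r : R, 0 < r & ball x0 r `<=` U /\
  exists Y : 'rV[R]_N -> 'M[R]_(N + L), [/\ smooth_on (ball x0 r) Y,
    forall x, ball x0 r x -> Y x *m Q *m (Y x)^T = Q &
    forall x, ball x0 r x -> forall i, pd i Y x = A i x *m Y x].
Proof.
have [r r0 [rU H]] := pfaff oU Ux0 sA flatA.
have [Y [Y0 sY HY]] := H (N + L)%N 1%:M.
exists r => //; split => //; exists Y; split => // [x bx|x bx i]; last first.
  by have [] := HY x bx i.
have dQ z k : ball x0 r z ->
    is_derive z (delta_mx 0 k) (fun x => (Y x)^T *m (invmx Q *m Y x)) 0.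
  move=> bz; have dY := HY z bz k.
  have c0 : is_derive z (delta_mx 0 k) (fun=> invmx Q : 'M[R]_(N + L)) 0.
    exact: is_derive_cst.
  have := is_derive_mulmx (is_derive_trmx dY) (is_derive_mulmx c0 dY).
  rewrite mul0mx add0r trmx_mul -!mulmxA -mulmxDr.
  suff -> : (A k z)^T *m (invmx Q *m Y z) + invmx Q *m (A k z *m Y z) = 0.
    by rewrite mulmx0.
  have E : (A k z)^T = - (invmx Q *m (A k z *m Q)).
    by rewrite -mulmxN -AQ ?mulKmx //; exact: rU.
  by rewrite E mulNmx -!mulmxA mulKVmx // addNr.
have QE : (Y x)^T *m (invmx Q *m Y x) = invmx Q.
  transitivity ((Y x0)^T *m (invmx Q *m Y x0)); last first.
    by rewrite Y0 trmx1 mul1mx mulmx1.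
  apply/matrixP => i j.
  apply: (@ball_pd0_cst _ _ x0 r (fun x => ((Y x)^T *m (invmx Q *m Y x)) i j)) => //.
    move=> z bz k; have /is_derive_mxP /(_ i j) := dQ z k bz.
    by rewrite mxE.
  exact: ballxx.
have I1 : Q *m (Y x)^T *m invmx Q *m Y x = 1%:M.
  by rewrite -!mulmxA QE mulmxV.
(* A left inverse of a square matrix is a right inverse: this passes from the first integral
   [Y^T Q^-1 Y] to the Gram matrix [Y Q Y^T]. *)
have I2 := mulmx1C I1.
by rewrite -[RHS]mul1mx -I2 !mulmxA mulmxKV.
Qed.

(** The ambient dimension is a variable tied to [N + L] by an equation, so that the result can be
    used at [(k+1)N + p], which is equal but not convertible to it. *)
Theorem submanifold_exists : exists2 rho : R, 0 < rho & ball x0 rho `<=` U /\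
  forall d, d = (N + L)%N -> exists (E : 'M[R]_d) (r : 'rV[R]_N -> 'rV[R]_d)
    (n : 'I_L -> 'rV[R]_N -> 'rV[R]_d),
  [/\ nondeg_sym E, smooth_on (ball x0 rho) r,
      (forall x, ball x0 rho x -> row_free (tangent r x)),
      (forall x, ball x0 rho x -> tangent r x *m E *m (tangent r x)^T = g) &
      normal_basis (ball x0 rho) E r n] /\
  forall x, ball x0 rho x ->
    [/\ forall i j, bform E (pd i r x) (pd j r x) = g i j,
        forall a b, bform E (n a x) (n b x) = invmx mu a b,
        forall a b i, bform E (pd i (n a) x) (n b x) = 0 &
        forall a i j, bform E (pd i (pd j r) x) (n a x) = (W i x *m S) j a].
Proof.
have [r1 r10 [r1U [Y [sY YQ dY]]]] := frame_exists.
have o1 : open (ball x0 r1) by exact: ball_open.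
pose T j x : 'cV[R]_(N + L) := (row (lshift L j) (Y x))^T.
have sYrow a : smooth_on (ball x0 r1) (fun x => row a (Y x)).
  apply/(smooth_mxP _ o1) => i j.
  apply: (smooth_eq o1 _ ((smooth_mxP _ o1).1 sY a j)) => x _.
  by rewrite mxE.
have pdYrow a i x : ball x0 r1 x -> pd i (fun x => row a (Y x)) x = row a (A i x *m Y x).
  move=> bx; apply/rowP => j; rewrite -pd_entry; last exact: smooth_derivable (sYrow a) bx.
  rewrite [RHS]mxE -dY // -pd_entry; last exact: smooth_derivable sY bx.
  by congr (pd i _ x); apply/funext => y; rewrite mxE.
have pdT i j x : ball x0 r1 x -> pd i (T j) x = (row (lshift L j) (A i x *m Y x))^T.
  move=> bx; have [_] := is_derive_trmx (smooth_is_derive i (sYrow (lshift L j)) bx).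
  by rewrite pdYrow.
have rowTA i j x : row (lshift L j) (A i x *m Y x) =
    row j (W i x) *m (S *m mu) *m dsubmx (Y x).
  rewrite -[in LHS](vsubmxK (Y x)) mul_block_col !mul0mx add0r addr0.
  by rewrite -row_usubmx col_mxKu !row_mul !mulmxA.
(* The tangent rows are closed because [W_swap] makes the second fundamental form symmetric in its
   two tangent indices; their primitive is the immersion. *)
have [|rho rho0 [r2U [u [su Hu]]]] := poincare o1 (ballxx x0 r10)
    (fun j => smooth_trmx o1 (sYrow (lshift L j))) (a := T).
  by move=> i j x bx; rewrite !pdT // !rowTA W_swap //; exact: r1U.
have ob : open (ball x0 rho) by exact: ball_open.
exists rho => //; split; first by move=> x /r2U/r1U.
move=> d ->.
pose r x : 'rV[R]_(N + L) := (u x)^T.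
have sr : smooth_on (ball x0 rho) r by exact: smooth_trmx.
pose n a x : 'rV[R]_(N + L) := row (rshift N a) (Y x).
have pr i x : ball x0 rho x -> pd i r x = row (lshift L i) (Y x).
  move=> bx; have [_] := is_derive_trmx (smooth_is_derive i su bx).
  by rewrite /pd => ->; rewrite -/(pd i u x) Hu // trmxK.
have TE x : ball x0 rho x -> tangent r x = usubmx (Y x).
  by move=> bx; apply/row_matrixP => i; rewrite rowK pr // -row_usubmx.
have nE x : \matrix_(a < L) n a x = dsubmx (Y x).
  by apply/row_matrixP => i; rewrite rowK row_dsubmx.
have YE x : ball x0 rho x -> block_mx
     (usubmx (Y x) *m Q *m (usubmx (Y x))^T) (usubmx (Y x) *m Q *m (dsubmx (Y x))^T)
     (dsubmx (Y x) *m Q *m (usubmx (Y x))^T) (dsubmx (Y x) *m Q *m (dsubmx (Y x))^T) = Q.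
  move=> /r2U bx; rewrite -[RHS](YQ x bx) -[in RHS](vsubmxK (Y x)).
  by rewrite tr_col_mx mul_col_mx mul_col_row.
have YE4 x : ball x0 rho x ->
    [/\ usubmx (Y x) *m Q *m (usubmx (Y x))^T = g,
      usubmx (Y x) *m Q *m (dsubmx (Y x))^T = 0,
      dsubmx (Y x) *m Q *m (usubmx (Y x))^T = 0 &
      dsubmx (Y x) *m Q *m (dsubmx (Y x))^T = invmx mu].
  by move=> bx; have := YE x bx; rewrite {4}/Q => /eq_block_mx[].
(* Since [Y Q Y^T = Q], pairing rows of [M Y] with the frame yields entries of [M Q]. With [M = A i]
   this reads the second fundamental forms and the torsion off [AQE]. *)
have bf M a b x : ball x0 rho x ->
    bform Q (row a (M *m Y x)) (row b (Y x)) = (M *m Q) a b.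
  move=> /r2U bx; rewrite -[in RHS](YQ x bx) !mulmxA /bform -row_mul !mxE.
  by apply: eq_bigr => k _; rewrite !mxE.
have bf1 a b x : ball x0 rho x -> bform Q (row a (Y x)) (row b (Y x)) = Q a b.
  by move=> bx; rewrite -[X in row a X]mul1mx bf // mul1mx.
have bT v x : ball x0 rho x -> (forall i, bform Q v (pd i r x) = 0) <->
    v *m Q *m (usubmx (Y x))^T = 0.
  move=> bx; have E i : bform Q v (pd i r x) = (v *m Q *m (usubmx (Y x))^T) 0 i.
    rewrite pr // -row_usubmx /bform !mxE; apply: eq_bigr => k _.
    by rewrite !mxE.
  split=> [H|H i]; last by rewrite E H mxE.
  by apply/rowP => i; rewrite -E H mxE.
have pn i a x : ball x0 rho x -> pd i (n a) x = row (rshift N a) (A i x *m Y x).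
  by move=> /r2U bx; exact: pdYrow.
have ppr i j x : ball x0 rho x -> pd i (pd j r) x = row (lshift L j) (A i x *m Y x).
  move=> bx; rewrite (pd_eq i ob bx (g := fun y => row (lshift L j) (Y y))).
    by apply: pdYrow; exact: r2U.
  by move=> y by_; exact: pr.
exists Q, r, n; split; first split.
- by split.
- exact: sr.
- move=> x bx; have [E _ _ _] := YE4 x bx; rewrite TE // /row_free eqn_leq rank_leq_row.
  have : \rank g = N by apply/eqP; rewrite -/(row_free g) row_free_unit.
  by move=> {1}<-; rewrite -E -mulmxA mxrankM_maxl.
- by move=> x bx; have [E _ _ _] := YE4 x bx; rewrite TE.
- split=> [a|x bx]; first exact: smooth_sub r2U (sYrow _).
  have [E1 E2 E3 E4] := YE4 x bx.
  rewrite nE; split.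
    rewrite /row_free eqn_leq rank_leq_row.
    have : \rank (invmx mu) = L.
      by apply/eqP; rewrite -/(row_free _) row_free_unit unitmx_inv.
    by move=> {1}<-; rewrite -E4 -mulmxA mxrankM_maxl.
  move=> v; split=> [/(bT v x bx) H|/submxP[w ->]]; last first.
    by apply/(bT _ x bx); rewrite -!mulmxA [X in w *m X]mulmxA E3 mulmx0.
  (* Expand [v] in the frame: orthogonality to the tangent rows annihilates its tangential
     coefficients because [g] is invertible. *)
  have uY : Y x \in unitmx.
    have : Y x *m Q *m (Y x)^T \in unitmx by rewrite YQ //; exact: r2U.
    by rewrite unitmx_mul => /andP[_]; rewrite unitmx_tr.
  have vE : v = lsubmx (v *m invmx (Y x)) *m usubmx (Y x) +
      rsubmx (v *m invmx (Y x)) *m dsubmx (Y x).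
    by rewrite -mul_row_col hsubmxK vsubmxK mulmxKV.
  move: vE; set w1 := lsubmx _; set w2 := rsubmx _ => vE.
  have : w1 *m g = 0.
    by rewrite -H vE !mulmxDl -!mulmxA !(mulmxA _ Q) E1 E3 mulmx0 addr0.
  move=> /(congr1 (mulmxr eta)) /=; rewrite mul0mx etaE mulmxK // => w10.
  by rewrite vE w10 mul0mx add0r submxMl.
- move=> x bx; split=> [i j|a b|a b i|a i j].
  + by rewrite !pr // bf1 // block_mxEul.
  + by rewrite bf1 // block_mxEdr.
  + by rewrite pn // bf // AQE block_mxEdr mxE.
  + by rewrite ppr // bf // AQE block_mxEur.
Qed.

End Frame.

(** * The Gram matrix of the normals as a Kronecker product *)

Section Kronecker.
Context {R : comUnitRingType} {k N p : nat}.

(** Identifies the numbering of the normals with the index of tensor products of matrices. *)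
Lemma blkE (s : 'I_k) (m : 'I_N) : blk p s m = lshift p (mxtens_index (s, m)).
Proof. exact: val_inj. Qed.

Lemma sum_mxtens (V : nmodType) (f : 'I_k -> 'I_N -> V) :
  \sum_(b < k * N) f (mxtens_unindex b).1 (mxtens_unindex b).2 =
  \sum_s \sum_m f s m.
Proof.
rewrite pair_bigA /=.
by rewrite (reindex _ (onW_bij _ (Bijective (@mxtens_unindexK k N) (@mxtens_indexK k N)))).
Qed.

Lemma sum_kronecker (I : finType) (j : I) (f : I -> R) :
  \sum_i (i == j)%:R * f i = f j.
Proof.
by rewrite (bigD1 j) //= eqxx mul1r big1 ?addr0 // => i /negbTE ->; rewrite mul0r.
Qed.

Lemma tens1_1 : (1%:M : 'M[R]_k) *t (1%:M : 'M[R]_N) = 1%:M.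
Proof.
apply/matrixP => a b; case: (mxtens_indexP a) => s m; case: (mxtens_indexP b) => t n.
rewrite tensmxE !mxE (can_eq (@mxtens_indexK k N)) xpair_eqE.
by rewrite -natrM mulnb.
Qed.

(** The inverse Gram matrix of the normals for [c = 1], completed by the identity on the [p] extra
    normals. *)
Definition kron_block (eta : 'M[R]_N) : 'M[R]_(k * N + p) :=
  block_mx (1%:M *t eta) 0 0 1%:M.

Lemma kron_block_nondeg (eta : 'M[R]_N) :
  eta^T = eta -> eta \in unitmx ->
  (kron_block eta)^T = kron_block eta /\ kron_block eta \in unitmx.
Proof.
move=> es eu; split; first by rewrite /kron_block tr_block_mx !trmx0 trmx_tens es !trmx1.
rewrite /kron_block unitmxE det_ublock det1 mulr1 -unitmxE.
have : (1%:M *t eta) *m (1%:M *t invmx eta) = (1%:M : 'M[R]_(k * N)).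
  by rewrite tensmx_mul mulmx1 mulmxV // tens1_1.
by case/mulmx1_unit.
Qed.

(** The matrix [S] of the overview: right multiplication repeats a square matrix in each of the [k]
    blocks and puts zeros on the extra normals. *)
Definition block_sum : 'M[R]_(N, k * N + p) :=
  row_mx (\matrix_(m, b) ((mxtens_unindex b).2 == m)%:R) 0.

Lemma mul_block_sum (W : 'M[R]_N) j s m : (W *m block_sum) j (blk p s m) = W j m.
Proof.
rewrite /block_sum mul_mx_row blkE row_mxEl mxE -[RHS]sum_kronecker.
by apply: eq_bigr => l _; rewrite mxE mxtens_indexK eq_sym mulrC.
Qed.

Lemma mul_block_sum0 (W : 'M[R]_N) j a : (W *m block_sum) j (rshift (k * N) a) = 0.
Proof. by rewrite /block_sum mul_mx_row row_mxEr mulmx0 mxE. Qed.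

(** Only the diagonal blocks of [1 (x) eta] are nonzero and each contributes one [eta]; the extra
    columns contribute nothing. *)
Lemma block_sum_kron (eta : 'M[R]_N) :
  block_sum *m kron_block eta *m block_sum^T = k%:R *: eta.
Proof.
rewrite /block_sum /kron_block mul_row_block !mulmx0 !mul0mx !addr0.
rewrite tr_row_mx mul_row_col trmx0 mulmx0 addr0.
set S := \matrix_(m, b) _.
have E m g : (S *m (1%:M *t eta)) m g = eta m (mxtens_unindex g).2.
  pose f s n := (n == m)%:R *
    ((s == (mxtens_unindex g).1)%:R * eta n (mxtens_unindex g).2).
  rewrite mxE (eq_bigr (fun b => f (mxtens_unindex b).1 (mxtens_unindex b).2)).
    rewrite sum_mxtens /f (eq_bigr (fun s => (s == (mxtens_unindex g).1)%:R *
      eta m (mxtens_unindex g).2)); first by rewrite sum_kronecker.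
    by move=> s _; rewrite sum_kronecker.
  move=> b _; rewrite {}/f; case: (mxtens_indexP b) => s n.
  by case: (mxtens_indexP g) => t n'; rewrite tensmxE !mxtens_indexK !mxE mxtens_indexK.
apply/matrixP => m n; rewrite mxE.
pose f (_ : 'I_k) l := eta m l * (l == n)%:R.
rewrite (eq_bigr (fun b => f (mxtens_unindex b).1 (mxtens_unindex b).2)); last by move=> b _; rewrite E !mxE.
rewrite sum_mxtens (eq_bigr (fun _ => eta m n)).
  by rewrite sumr_const card_ord mxE mulr_natl.
move=> s _; rewrite -[RHS](sum_kronecker n (eta m)).
by apply: eq_bigr => l _; rewrite mulrC.
Qed.

End Kronecker.

(** * The multiplication in a chart with constant metric *)

Section FlatProduct.
Context {R : realType} {N : nat} {M : manifold R N}.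
Variables (F : frobenius M) (c : chart R N M) (g : 'M[R]_N).
Hypothesis ac : atlas c.
Hypothesis g_nd : nondeg_sym g.
Hypothesis metricE : forall x, img c x -> metric F c x = g.

Definition lowered (i j m : 'I_N) (x : 'rV[R]_N) : R :=
  (product F c x i j *m g) 0 m.

Let oU : open (img c). Proof. exact: img_open. Qed.

Lemma bform_delta (v : 'rV[R]_N) m : bform g v (delta_mx 0 m) = (v *m g) 0 m.
Proof. by rewrite /bform trmx_delta -colE mxE. Qed.

Lemma smooth_lowered i j m : smooth_on (img c) (lowered i j m).
Proof.
have H := smooth_mulmx oU (product_smooth F ac i j) (smooth_cst_mx g oU).
exact: (smooth_mxP _ oU).1 H 0 m.
Qed.

Lemma tensorA_basis i j m x : img c x ->
  tensorA (metric F c x) (product F c x) (delta_mx 0 i) (delta_mx 0 j) (delta_mx 0 m) =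
  lowered i j m x.
Proof. by move=> Ux; rewrite /tensorA tmul_basis metricE // bform_delta. Qed.

Lemma lowered12 i j m x : img c x -> lowered i j m x = lowered j i m x.
Proof.
move=> Ux; rewrite -!tensorA_basis //.
by have [] := frob_A_sym F ac Ux (delta_mx 0 i) (delta_mx 0 j) (delta_mx 0 m).
Qed.

Lemma lowered23 i j m x : img c x -> lowered i j m x = lowered i m j x.
Proof.
move=> Ux; rewrite -!tensorA_basis //.
by have [] := frob_A_sym F ac Ux (delta_mx 0 i) (delta_mx 0 j) (delta_mx 0 m).
Qed.

Lemma christoffel0 l i j x : img c x -> christoffel (metric F c) l i j x = 0.
Proof.
move=> Ux; have pd0 k a b : pd k (fun y => metric F c y a b) x = 0.
  rewrite (pd_eq k oU Ux (g := fun=> g a b)) ?/pd ?derive_cst //.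
  by move=> y Uy; rewrite metricE.
rewrite /christoffel big1 ?mulr0 // => s _.
by rewrite !pd0 addr0 subrr mulr0.
Qed.

(** Where the metric is constant the Christoffel symbols vanish, and with them all correction terms
    for coordinate fields. *)
Lemma nablaA_basis w i j m x : img c x ->
  nablaA (metric F c) (product F c) (basis_field w) (basis_field i) (basis_field j)
    (basis_field m) x = pd w (lowered i j m) x.
Proof.
move=> Ux; have n0 k : nabla (metric F c) (basis_field w) (basis_field k) x = 0.
  by rewrite nabla_basis_basis; apply/rowP => l; rewrite !mxE christoffel0.
have t1 Y : tmul (product F c x) 0 Y = 0.
  by rewrite /tmul big1 // => a _; rewrite big1 // => b _; rewrite mxE mul0r scale0r.
have t2 Y : tmul (product F c x) Y 0 = 0.
  by rewrite /tmul big1 // => a _; rewrite big1 // => b _; rewrite mxE mulr0 scale0r.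
rewrite /nablaA !n0 /tensorA t1 t2 /bform !mul0mx trmx0 !mulmx0 mxE !subr0.
apply: near_eq_derive; apply: open_near_eq oU Ux _ => y Uy.
exact: tensorA_basis.
Qed.

Lemma lowered_closed l i j m x : img c x ->
  pd l (lowered i j m) x = pd i (lowered l j m) x.
Proof.
move=> Ux; rewrite -!nablaA_basis //.
have sb i' : smooth_on (img c) (basis_field i') by exact: smooth_basis_field.
by have [] := frob_nablaA_sym F ac (sb l) (sb i) (sb j) (sb m) Ux.
Qed.

Lemma product_lowered x i j : product F c x i j =
  (\row_m lowered i j m x) *m invmx g.
Proof.
have [_ ug] := g_nd.
rewrite -[LHS](mulmxK ug); congr (_ *m _).
by apply/rowP => m; rewrite [RHS]mxE.
Qed.

(** Identifies the contraction in the associativity equations with the scalar product of [e_i o e_j]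
    and [e_m o e_n]. *)
Lemma lowered_contract x i j m n :
  \sum_a \sum_b lowered i j a x * invmx g a b * lowered m n b x =
  bform g (product F c x i j) (product F c x m n).
Proof.
have [gs ug] := g_nd.
have gi : (invmx g)^T = invmx g by rewrite trmx_inv gs.
rewrite !product_lowered /bform trmx_mul gi mulmxKV // exchange_big /=.
rewrite mulmxA mxE; apply: eq_bigr => b _.
by rewrite !mxE mulr_suml; apply: eq_bigr => a _; rewrite !mxE.
Qed.

(** Invariance gives [g(e_i o e_j, e_m o e_n) = g((e_i o e_j) o e_m, e_n)], and by associativity and
    commutativity [j] and [m] may be exchanged. Both WDVV and the commutation of the [W_i] rest on
    this. *)
Lemma product_swap x i j m n : img c x ->
  bform g (product F c x i j) (product F c x m n) =
  bform g (product F c x i m) (product F c x j n).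
Proof.
move=> Ux.
have P a b : product F c x a b = tmul (product F c x) (delta_mx 0 a) (delta_mx 0 b).
  by rewrite tmul_basis.
have inv X Y Z : bform g (tmul (product F c x) X Y) Z =
    bform g X (tmul (product F c x) Y Z).
  by rewrite -(metricE Ux); exact: frob_invariant.
rewrite [product F c x m n]P [product F c x j n]P -!inv !P.
rewrite !(frob_assoc F ac Ux).
by congr (bform _ (tmul _ _ _) _); exact: frob_comm.
Qed.

Lemma product_sym x i j : img c x -> product F c x i j = product F c x j i.
Proof.
by move=> Ux; rewrite -!(tmul_basis (product F c x)); exact: frob_comm.
Qed.

End FlatProduct.

(** * Assembling the chart, the potential and the submanifold *)

Theorem theorem5p4 (R : realType) (N k p : nat) (M : manifold R N)
    (F : frobenius M) (hk : (1 <= k)%N) :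
  forall q : M, exists c : chart R N M,
    [/\ atlas c,
        dom c q &
        exists (D : potential_data k p (img c))
               (E : 'M[R]_(k.+1 * N + p))
               (r : 'rV[R]_N -> 'rV[R]_(k.+1 * N + p)),
          [/\ potential_submanifold E r D,
              forall x, img c x -> metric F c x = invmx (etaU D) &
              forall x, img c x -> forall i j,
                product F c x i j =
                \sum_l (\sum_s etaU D l s * pd3 (Phi D) s i j x) *: delta_mx 0 l]].
Proof.
move=> q; have [c ac [dq [g [g_nd gE]]]] : exists2 c : chart R N M, atlas c &
    dom c q /\ exists g, nondeg_sym g /\ forall x, img c x -> metric F c x = g.
  by have [c [ac dq [g [? ?]]]] := flat_chart F q; exists c => //; split => //; exists g.
have [gs ug] := g_nd.
pose eta := invmx g.
have es : eta^T = eta by rewrite /eta trmx_inv gs.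
have ue : eta \in unitmx by rewrite unitmx_inv.
set x0 := coord c q; have Ux0 : img c x0 by exists q.
pose a := lowered F c g.
have sa i j m : smooth_on (img c) (a i j m) by exact: smooth_lowered.
have a12 i j m x : img c x -> a i j m x = a j i m x by exact: lowered12.
have a23 i j m x : img c x -> a i j m x = a i m j x by exact: lowered23.
have acl l i j m x : img c x -> pd l (a i j m) x = pd i (a l j m) x.
  exact: lowered_closed.
have [r1 r10 [r1U [Phi [sPhi PhiE]]]] :=
  potential_exists (@img_open _ _ _ c) Ux0 sa a12 a23 acl.
have o1 : open (ball x0 r1) by exact: ball_open.
pose W i (x : 'rV[R]_N) : 'M[R]_N := \matrix_(j, m) a i j m x.
have sW i : smooth_on (ball x0 r1) (W i).
  apply/(smooth_mxP _ o1) => j m; apply: (smooth_eq o1 _ (smooth_sub r1U (sa i j m))).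
  by move=> x _; rewrite mxE.
have W_sym i x : ball x0 r1 x -> (W i x)^T = W i x.
  by move=> bx; apply/matrixP => j m; rewrite !mxE a23 //; exact: r1U.
have W_swap i j x : ball x0 r1 x -> row j (W i x) = row i (W j x).
  by move=> bx; apply/rowP => m; rewrite !mxE a12 //; exact: r1U.
have W_closed i j x : ball x0 r1 x -> pd i (W j) x = pd j (W i) x.
  move=> bx; apply/matrixP => l m.
  have E i' j' : pd i' (W j') x l m = pd i' (a j' l m) x.
    rewrite -pd_entry; last exact: smooth_derivable (sW j') bx.
    by congr (pd _ _ x); apply/funext => y; rewrite mxE.
  by rewrite !E acl //; exact: r1U.
(* The entry [(l, m)] of the product is [g(e_i o e_l, e_j o e_m)]; one swap turns it into
   [g(e_i o e_j, e_l o e_m)], symmetric in [i] and [j]. *)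
have W_comm i j x : ball x0 r1 x -> W i x *m eta *m W j x = W j x *m eta *m W i x.
  move=> bx; have Ux := r1U x bx.
  have E i' j' l m : (W i' x *m eta *m W j' x) l m =
      bform g (product F c x i' l) (product F c x j' m).
    rewrite -(lowered_contract F c g_nd) exchange_big mxE; apply: eq_bigr => b _.
    rewrite mxE mulr_suml; apply: eq_bigr => d _.
    by rewrite !mxE (a23 j' b m x Ux).
  apply/matrixP => l m; rewrite !E.
  rewrite (product_swap ac gE _ _ _ _ Ux) [RHS](product_swap ac gE _ _ _ _ Ux).
  by rewrite (product_sym F ac i j Ux).
(* The data are fixed here as [c = 1] and [mu] the Kronecker block matrix, so that the scalar
   [kappa] of the frame system is [k]. *)
have [mu_s mu_u] := @kron_block_nondeg R k N p eta es ue.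
have [rho rho0 [bb H]] := submanifold_exists o1 (ballxx x0 r10) g_nd (erefl (invmx g))
  (conj mu_s mu_u) (@block_sum_kron R k N p eta) sW W_sym W_swap W_closed W_comm.
have ob : open (ball x0 rho) by exact: ball_open.
have bU : ball x0 rho `<=` img c by move=> x /bb/r1U.
(* The flat chart is cut down to the ball where both potential and immersion exist; its image is
   then that ball. *)
have [c' [ac' dq' mE metE prE]] := restrict_chart F ac dq ob bU (ballxx x0 rho0).
exists c'; split; [exact: ac'|exact: dq'|rewrite mE].
have PhiE' x : ball x0 rho x -> forall i j m, pd3 Phi i j m x = a i j m x.
  by move=> /bb bx i j m; exact: PhiE.
have blk_ok (s t : 'I_k) (m n : 'I_N) :
    kron_block eta (blk p s m) (blk p t n) = (1%:M : 'M[R]_k) s t * eta m n.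
  by rewrite !blkE /kron_block block_mxEul tensmxE.
have wdvv_ok : wdvv (ball x0 rho) eta Phi.
  move=> x bx i j m n; have Ux := bU x bx.
  have E i' j' m' n' : \sum_b \sum_d pd3 Phi i' j' b x * eta b d * pd3 Phi d m' n' x =
      bform g (product F c x i' j') (product F c x m' n').
    rewrite -(lowered_contract F c g_nd); apply: eq_bigr => b _.
    apply: eq_bigr => d _; rewrite !PhiE' //; congr (_ * _).
    by rewrite (a12 d m' n' x Ux) (a23 m' d n' x Ux).
  transitivity (bform g (product F c x i j) (product F c x m n)); first exact: E.
  transitivity (bform g (product F c x i m) (product F c x j n)).
    exact: (product_swap ac gE).
  by symmetry; exact: E.
have one_nd : nondeg_sym (1%:M : 'M[R]_k) by split; [exact: trmx1|exact: unitmx1].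
pose D := PotentialData (conj es ue) one_nd (conj mu_s mu_u) blk_ok
  (smooth_sub bb sPhi) wdvv_ok.
have dimE : (k.+1 * N + p)%N = (N + (k * N + p))%N by rewrite mulSn addnA.
have [E [r [n [[ndE sr rf tg nb] K]]]] := H _ dimE.
exists D, E, r; split.
- split; first by split => // x bx; rewrite tg.
  exists n; split; first exact: nb.
  move=> x bx; have Ux := bU x bx; have [K1 K2 K3 K4] := K x bx; split.
  + by move=> i j; rewrite K1 /= invmxK.
  + exact: K2.
  + exact: K3.
  + move=> s m i j; rewrite K4 mul_block_sum mxE /= PhiE' //.
    by rewrite (a23 i j m x Ux) (a12 i m j x Ux).
  + by move=> b i j; rewrite K4 mul_block_sum0.
- by move=> x bx; rewrite metE // gE ?invmxK //; exact: bU.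
- move=> x bx i j; rewrite prE // [LHS](product_lowered F c g_nd) [LHS]row_sum_delta.
  apply: eq_bigr => l _; congr (_ *: _); rewrite mxE; apply: eq_bigr => s _ /=.
  have Ux := bU x bx.
  rewrite mxE PhiE' // mulrC (a12 s i j x Ux) (a23 i s j x Ux); congr (_ * _).
  by rewrite -[LHS]/(eta s l) -[in LHS]es mxE.
Qed.
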